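(* Let $p_1,p_2,\ldots\in(-1,\infty)$ be distinct. For every $n\ge1$ we have $$\mathcal{A}_n^+=\mathcal{A}_n^-=\mathcal{B}_n=\mathcal{C}_n.$$ Moreover, these sets are homeomorphic to the closed Euclidean ball $B_2^n$ and their boundary is $\Psi_n(\mathcal{L}_{n-1}^+)\cup\Psi_n(\mathcal{L}_{n-1}^-)$.
   Context: Write $\mathbb{R}_+=[0,\infty)$ and $x_+=\max(x,0)$. A function $f:\mathbb{R}\to\mathbb{R}_+$ is log-concave if $f=e^{-V}$ for a convex function $V:\mathbb{R}\to\mathbb{R}\cup\{\infty\}$. $\mathcal{L}$ is the class of symmetric (even) log-concave functions $f:\mathbb{R}\to\mathbb{R}_+$ with $f(0)=1$. Set $m_i(f)=\int_0^\infty t^{p_i}f(t)\,\mathrm{d}t\in[0,\infty]$ and $\Psi_n(f)=(m_1(f),\ldots,m_n(f))\in[0,\infty]^n$, where $[0,\infty]^n$ carries its usual compact topology. The classes $\mathcal{L}_n^\pm$ of simple log-concave functions on $\mathbb{R}$ are defined as follows: $\mathcal{L}_0^+=\mathcal{L}_0^-=\{\mathbf{1}_{\{0\}},1\}$; $\mathcal{L}_{2k}^-$ ($k\ge1$) is the set of functions $f(t)=\exp\big(-a_1|t|-a_2(|t|-b_2)_+-\cdots-a_k(|t|-b_k)_+\big)\mathbf{1}_{|t|\le b_{k+1}}$; $\mathcal{L}_{2k+1}^+$ ($k\ge0$) is the set of functions $f(t)=\exp\big(-a_1|t|-a_2(|t|-b_2)_+-\cdots-a_{k+1}(|t|-b_{k+1})_+\big)$;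 $\mathcal{L}_{2k}^+$ ($k\ge1$) is the set of functions $f(t)=\exp\big(-a_1(|t|-b_1)_+-\cdots-a_k(|t|-b_k)_+\big)$; $\mathcal{L}_{2k+1}^-$ ($k\ge0$) is the set of functions $f(t)=\exp\big(-a_1(|t|-b_1)_+-\cdots-a_k(|t|-b_k)_+\big)\mathbf{1}_{|t|\le b_{k+1}}$. Here the parameters range over all $a_1,a_2,\ldots\in[0,\infty]$ and $0\le b_1\le b_2\le\cdots\le\infty$ (only those that occur in the formula), with the conventions $\infty\cdot0=0$ and $e^{-\infty}=0$. Define $\mathcal{A}_n^\pm=\Psi_n(\mathcal{L}_n^\pm)$ and $\mathcal{B}_n=\Psi_n(\mathcal{L})$. For $(m_1,\ldots,m_{n-1})\in\mathcal{B}_{n-1}$ let $$F_+(m_1,\ldots,m_{n-1})=\sup\{m_n(f):\ f\in\mathcal{L},\ m_i(f)=m_i,\ i=1,\ldots,n-1\},$$ $$F_-(m_1,\ldots,m_{n-1})=\inf\{m_n(f):\ f\in\mathcal{L},\ m_i(f)=m_i,\ i=1,\ldots,n-1\},$$ and $$\mathcal{C}_n=\{(m_1,\ldots,m_n)\in\mathcal{B}_{n-1}\times[0,\infty]:\ F_-(m_1,\ldots,m_{n-1})\le m_n\le F_+(m_1,\ldots,m_{n-1})\}.$$ For $n=1$ there are no constraints, i.e. $\mathcal{C}_1=[\inf_{f\in\mathcal{L}}m_1(f),\sup_{f\in\mathcal{L}}m_1(f)]$. ''Boundary'' is understood after identifying $[0,\infty]$ with a compact interval of $\mathbb{R}$,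 so that $[0,\infty]^n\subset\mathbb{R}^n$ (equivalently, it is the image of the sphere $\partial B_2^n$ under a homeomorphism from $B_2^n$). *)

(* Defs.v *)
(* MathComp / MathComp-Analysis *)
From HB Require Import structures.
From mathcomp Require Export all_boot all_order all_algebra.
From mathcomp Require Export all_classical all_reals all_analysis.
Export Order.TTheory GRing.Theory Num.Theory.
Export numFieldNormedType.Exports.

Set Implicit Arguments.
Unset Strict Implicit.
Unset Printing Implicit Defensive.

Local Open Scope classical_set_scope.
Local Open Scope ring_scope.

Section LogConcave.
Variable R : realType.
Implicit Types (f : R -> R) (V : R -> \bar R).

(* Convexity of V : R -> (-oo, +oo]. The products follow the convention
   0 * +oo = 0, so the end cases t = 0 and t = 1 are vacuous. *)
Definition convex_extended V : Prop :=
  (forall x, V x != -oo%E) /\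
  forall (x y t : R), 0 <= t <= 1 ->
    (V (t * x + (1 - t) * y)%R <= t%:E * V x + (1 - t)%:E * V y)%E.

Definition log_concave f : Prop :=
  exists V, convex_extended V /\ forall x, (f x)%:E = expeR (- V x)%E.

Definition even_log_concave : set (R -> R) :=
  [set f | [/\ log_concave f, forall x, f (- x) = f x & f 0 = 1]].

(* The point 0, where t `^ q has a junk value for q <= 0, is left out of the
   domain of integration; this does not affect the integral. *)
Definition moment (q : R) f : \bar R :=
  (\int[@lebesgue_measure R]_(t in `]0%R, +oo[) (t `^ q * f t)%:E)%E.

(* The exponents p_1, p_2, ... are p 0, p 1, ... *)
Definition Psi (p : nat -> R) n f : 'rV[\bar R]_n :=
  \row_(i < n) moment (p i) f.

End LogConcave.

Section SimpleFunctions.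
Variable R : realType.
Implicit Types a b : nat -> \bar R.

(* Parameters are indexed from 1, as in a_1, b_1, ...; the values of a and b at
   indices which do not occur in a given formula are irrelevant, since any
   finite choice of parameters extends to sequences satisfying this predicate. *)
Definition params a b : Prop :=
  [/\ forall i, (0 <= a i)%E, forall i, (0 <= b i)%E &
      forall i j, (i <= j)%N -> (b i <= b j)%E].

(* (|t| - c)_+, equal to 0 when c = +oo. *)
Definition ramp (c : \bar R) (t : R) : \bar R := maxe (`|t|%:E - c)%E 0%E.

(* a_1 |t| + a_2 (|t| - b_2)_+ + ... + a_m (|t| - b_m)_+, for m >= 1 *)
Definition pot_lin m a b (t : R) : \bar R :=
  (a 1%N * `|t|%:E + \sum_(2 <= i < m.+1) a i * ramp (b i) t)%E.

(* a_1 (|t| - b_1)_+ + ... + a_m (|t| - b_m)_+ *)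
Definition pot_ramp m a b (t : R) : \bar R :=
  (\sum_(1 <= i < m.+1) a i * ramp (b i) t)%E.

(* e ^ (- v), a real number for v in [0, +oo]. *)
Definition expN (v : \bar R) : R := fine (expeR (- v)%E).

Definition cutoff (c : \bar R) (t : R) : R := (`|t|%:E <= c)%E%:R.

Definition simple0 : set (R -> R) := [set \1_[set 0]; cst 1].

Definition simple_plus n : set (R -> R) :=
  if n is 0 then simple0 else
  let k := n./2 in
  if odd n then
    [set f | exists a b, params a b /\ f = fun t => expN (pot_lin k.+1 a b t)]
  else
    [set f | exists a b, params a b /\ f = fun t => expN (pot_ramp k a b t)].

Definition simple_minus n : set (R -> R) :=
  if n is 0 then simple0 else
  let k := n./2 in
  if odd n then
    [set f | exists a b, params a b /\
       f = fun t => expN (pot_ramp k a b t) * cutoff (b k.+1) t]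
  else
    [set f | exists a b, params a b /\
       f = fun t => expN (pot_lin k a b t) * cutoff (b k.+1) t].

End SimpleFunctions.

Arguments simple_plus R n _ : clear implicits.
Arguments simple_minus R n _ : clear implicits.

Section MomentSets.
Variables (R : realType) (p : nat -> R).

Definition A_plus n : set 'rV[\bar R]_n := Psi p n @` simple_plus R n.
Definition A_minus n : set 'rV[\bar R]_n := Psi p n @` simple_minus R n.
Definition B_set n : set 'rV[\bar R]_n := Psi p n @` @even_log_concave R.

(* For x = (m_1, ..., m_n), the extreme values of m_{n+1}. *)
Definition F_plus n (x : 'rV[\bar R]_n) : \bar R :=
  ereal_sup [set moment (p n) f
            | f in [set f | even_log_concave f /\ Psi p n f = x]].
Definition F_minus n (x : 'rV[\bar R]_n) : \bar R :=
  ereal_inf [set moment (p n) f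
            | f in [set f | even_log_concave f /\ Psi p n f = x]].

Definition front n (x : 'rV[\bar R]_n.+1) : 'rV[\bar R]_n :=
  \row_(i < n) x ord0 (widen_ord (leqnSn n) i).

(* C_{n+1}. For n = 0 the space 'rV_0 is a point, which belongs to B_0, so that
   this is the interval between the infimum and the supremum of m_1. *)
Definition C_setS n : set 'rV[\bar R]_n.+1 :=
  [set x | [/\ B_set (front x), (0 <= x ord0 ord_max)%E &
     (F_minus (front x) <= x ord0 ord_max <= F_plus (front x))%E]].

End MomentSets.

Arguments A_plus {R} p n _.
Arguments A_minus {R} p n _.
Arguments B_set {R} p n _.
Arguments C_setS {R} p n _.

Section Topology.

Definition homeomorphic (T U : topologicalType) (A : set T) (B : set U) : Prop :=
  exists (h : T -> U) (g : U -> T),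
    [/\ {within A, continuous h}, {within B, continuous g},
        forall x, A x -> B (h x) /\ g (h x) = x &
        forall y, B y -> A (g y) /\ h (g y) = y].

Variable R : realType.

Definition euclidean_ball n : set 'rV[R]_n :=
  [set x | \sum_(i < n) x ord0 i ^+ 2 <= 1].

Definition frontier (T : topologicalType) (A : set T) : set T :=
  closure A `\` interior A.

(* [0, +oo] is identified with [0, 1] through contract, i.e. r |-> r / (1 + r)
   and +oo |-> 1, hence [0, +oo]^n with the cube [0, 1]^n in R^n. *)
Definition to_cube n (x : 'rV[\bar R]_n) : 'rV[R]_n := map_mx (@contract R) x.

(* D is the boundary of A, both being regarded as subsets of R^n. *)
Definition is_boundary n (A D : set 'rV[\bar R]_n) : Prop :=
  frontier (@to_cube n @` A) = @to_cube n @` D.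

End Topology.

Arguments euclidean_ball R n _ : clear implicits.

(* Main.v *)
Require Import Defs.
From mathcomp Require Import measurable_realfun ring lra.

(** Everything is reduced to functions on the half-line. There, the simple
functions are those obtained from the indicator of 0 or from the constant 1 by
applying alternately two operations: a tilt, i.e. multiplication by a decreasing
exponential, and a delay, i.e. the insertion of an initial plateau of height 1.
Slopes and lengths in [[0, +oo]] are encoded by parameters in [[0, 1]], so that
the simple functions [sim n e], with [n] operations the first of which is a tilt
or a delay according to [e], are parametrized by a compact cube, on which the
moments are continuous ([cconv_sim], [cconv_moment]).

Extremality. If [g] is log-concave, then [g - sim n e th] has at most [n] sign
changes and a known first sign ([profile_sim_sign_changes]). Suppose that the
moments of orders [p 0], ..., [p n.-1] of the two functions agree. If there are
exactly [n] sign changes, choose a nonzero combination [P] of the powers with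
exponents [p 0], ..., [p n] that vanishes at all of them. By Descartes' rule of
signs [P] has no other zeros ([gpoly_alternates]), hence [P * (g - sim n e th)] has
constant sign, while its integral is a multiple of the difference of the moments
of order [p n]. If there are fewer sign changes, fewer powers suffice, and the
integral of a function of constant sign is 0. Therefore simple functions minimize
or maximize the next moment, opposite kinds [e] attaining opposite bounds, with
equality only if the functions agree almost everywhere ([moment_comparison],
[sim_extremal]).

Existence. Every sequence of [n] moments of a log-concave function is attained
by simple functions of order [n] of either kind ([interpolation]). In the
induction step the two extremal functions of order [n] that match the first [n]
moments are joined within the simple functions of order [n.+1] by moving the
first parameter. For each value of this parameter the other parameters can be
adjusted by the induction hypothesis, applied under a prefix of operations.
There need not be a continuous choice; instead, compactness of the parameters
and connectedness of the segment yield a first parameter for which the next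
moment can be at most and can be at least the prescribed value, and by
extremality it takes only one value there ([intermediate_moment]).

Shape. It follows that the set of moment vectors of length [n.+1] consists of the
segments between the graphs of two functions [lo] and [hi] over the set of moment
vectors of length [n]; the graphs are the moments of the simple functions of
order [n] ([body_rec]). By compactness [lo] and [hi] are continuous. They agree
exactly over the boundary ([rim_rec]), because if the two extremal functions
coincide then one of them begins with a trivial operation: a proper tilt is
strictly below 1 from the start, a proper delay is not. A set fibred over a ball
by segments that degenerate exactly over the sphere is a ball, whose boundary is
the union of the two graphs ([fibration_ball_model], [body_frontier]). *)

Set Implicit Arguments.
Unset Strict Implicit.
Unset Printing Implicit Defensive.

Local Open Scope classical_set_scope.
Local Open Scope ring_scope.

(** * Generalized polynomials and sign changes *)

Section Descartes.
Variable R : realType.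
Implicit Types (F G D : R -> R) (s t u v x : R) (xs ys Z : seq R).

Definition gpoly n (c q : nat -> R) t : R :=
  \sum_(0 <= i < n.+1) c i * t `^ q i.

Fixpoint alternates s u xs F : Prop :=
  if xs is x :: xs' then
    [/\ u < x, forall t, u < t < x -> 0 < s * F t & alternates (- s) x xs' F]
  else forall t, u < t -> 0 < s * F t.

Fixpoint interlaced x ys xs : Prop :=
  match ys, xs with
  | [::], [::] => True
  | y :: ys', x' :: xs' => x < y < x' /\ interlaced x' ys' xs'
  | _, _ => False
  end.

Lemma alternates_pos_mul F G xs s u : 0 <= u ->
  (forall t, 0 < t -> exists2 w, 0 < w & F t = w * G t) ->
  alternates s u xs G -> alternates s u xs F.
Proof.
move=> + FG; elim: xs s u => [|x xs IH] s u u0 /=.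
  move=> H t ut; have [|w w0 ->] := FG t; first exact: le_lt_trans ut.
  by rewrite mulrCA mulr_gt0 ?H.
move=> [ux H A]; split=> //.
  move=> t /andP[ut tx]; have [|w w0 ->] := FG t; first exact: le_lt_trans ut.
  by rewrite mulrCA mulr_gt0 ?H ?ut.
by apply: IH A; exact: le_trans u0 (ltW ux).
Qed.

Lemma alternates_neq0 s u xs F : alternates s u xs F -> s != 0.
Proof.
case: xs => [|x xs] /=.
  move=> /(_ (u + 1)); rewrite ltrDl ltr01 => /(_ isT).
  by apply: contraTneq => ->; rewrite mul0r ltxx.
move=> [ux /(_ ((u + x) / 2)) + _]; rewrite !midf_lt //= => /(_ isT).
by apply: contraTneq => ->; rewrite mul0r ltxx.
Qed.

Lemma interlaced_path u x ys xs : u < x -> interlaced x ys xs ->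
  path <%R u ys.
Proof.
elim: ys u x xs => [//|y ys IH] u x [//|x' xs] ux /= [/andP[xy yx'] I].
by rewrite (lt_trans ux xy) /=; apply: IH I.
Qed.

Section Rolle.
Variables (F F' : R -> R).
Hypothesis dF : forall t, 0 < t -> is_derive t 1 F (F' t).

Let cF a b : 0 < a -> {within `[a, b], continuous F}.
Proof.
move=> a0; apply: continuous_in_subspaceT => t.
rewrite inE /= in_itv /= => /andP[a_t _].
have t0 : 0 < t by exact: lt_le_trans a_t.
by apply: differentiable_continuous; apply/derivable1_diffP;
  case: (dF t0).
Qed.

Lemma rolle_zeros x xs : 0 < x -> path <%R x xs -> F x = 0 ->
  all (fun x => F x == 0) xs ->
  exists ys, [/\ size ys = size xs, interlaced x ys xs &
                 all (fun y => F' y == 0) ys].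
Proof.
elim: xs x => [|x' xs IH] x x0 /=; first by exists [::].
move=> /andP[xx' px'] Fx0 /andP[/eqP Fx' Fxs].
have [ys [sys iys Fys]] := IH x' (lt_trans x0 xx') px' Fx' Fxs.
have [t] : exists2 c, c \in `]x, x'[%R & is_derive c 1 F 0.
  apply: Rolle => //; last by rewrite Fx0 Fx'.
    move=> t; rewrite in_itv/= => /andP[xt _].
    by case: (dF (lt_trans x0 xt)).
  exact: cF.
rewrite in_itv/= => /andP[xt tx'] [_ Dt].
exists (t :: ys); split=> /=; [by rewrite sys|by rewrite xt tx'|].
rewrite Fys andbT; apply/eqP.
by have [_ <-] := dF (lt_trans x0 xt).
Qed.

Lemma derive_sign_lt s a b : 0 < a -> a < b ->
  (forall c, a < c < b -> 0 < s * F' c) -> s * F a < s * F b.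
Proof.
move=> a0 ab H.
have [c] := @MVT R F F' a b ab
  (fun x hx => dF (lt_trans a0 (andP hx).1)) (cF a0).
rewrite in_itv/= => /H sc E.
by rewrite -subr_gt0 -mulrBr E mulrA mulr_gt0 // subr_gt0.
Qed.

(** Between two consecutive zeros of [F] its derivative changes sign once, so the
signs of [F] are those of [F'], opposite on the first interval since [F] runs
towards its zero [x] there. *)
Lemma alternates_antiderivative ys xs u x s : 0 <= u -> u < x ->
  interlaced x ys xs -> F x = 0 -> all (fun x => F x == 0) xs ->
  alternates s u ys F' -> alternates (- s) u (x :: xs) F.
Proof.
elim: ys xs u x s => [|y ys IH] [|x' xs] u x s u0 ux //=.
  move=> _ Fx _ H; split=> //.
    move=> t /andP[ut tx]; have := @derive_sign_lt s t x.
    rewrite Fx mulr0 mulNr oppr_gt0; apply => //; first exact: le_lt_trans ut.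
    by move=> c /andP[tc _]; apply: H; exact: lt_trans tc.
  move=> t xt; have := @derive_sign_lt s x t.
  rewrite Fx mulr0 opprK; apply => //; first exact: le_lt_trans ux.
  by move=> c /andP[tc _]; apply: H; exact: lt_trans tc.
move=> [/andP[xy yx'] I] Fx /andP[/eqP Fx' Fxs] [uy H A].
have {IH} [_ Hy Ax] :=
  IH xs y x' (- s) (le_trans u0 (ltW uy)) yx' I Fx' Fxs A.
rewrite !opprK in Hy Ax *; split=> //.
  move=> t /andP[ut tx]; have := @derive_sign_lt s t x.
  rewrite Fx mulr0 mulNr oppr_gt0; apply => //; first exact: le_lt_trans ut.
  move=> c /andP[tc cx]; apply: H; rewrite (lt_trans ut tc) /=.
  exact: lt_trans xy.
split=> //; first exact: lt_trans yx'.
move=> t /andP[xt tx']; have [ty|yt] := leP t y; last by rewrite Hy ?yt.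
have := @derive_sign_lt s x t.
rewrite Fx mulr0; apply => //; first exact: le_lt_trans ux.
move=> c /andP[tc cx]; apply: H.
by rewrite (lt_trans ux tc) (lt_le_trans cx ty).
Qed.

End Rolle.

Lemma gpoly_derive n c q t : 0 < t ->
  is_derive t 1 (gpoly n c q) (gpoly n (fun i => c i * q i) (fun i => q i - 1) t).
Proof.
move=> t0; rewrite /gpoly; elim: n.+1 => [|k IH].
  under [X in is_derive _ _ X]eq_fun do rewrite big_geq //.
  by rewrite big_geq //; exact: is_derive_cst.
under [X in is_derive _ _ X]eq_fun do rewrite big_nat_recr //=.
rewrite big_nat_recr //=; apply: is_deriveD.
have -> : (fun x : R => c k * x `^ q k) = c k \*: (fun x => x `^ q k) by [].
have H := is_derive1_powR (q k) t0.
by apply: is_derive_eq; rewrite -mulrA.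
Qed.

(** The extremal case of Descartes' rule of signs: a generalized polynomial with
[n.+1] terms has at most [n] positive zeros, so [n] given zeros are simple and
are the only ones. The induction divides by [t `^ q 0] and differentiates, which
kills one term and, by Rolle's theorem, at most one zero; the first sign is
tracked because the leading coefficient picks up the factor [q n - q 0]. *)
Lemma gpoly_alternates n c q xs : injective q -> size xs = n ->
  path <%R 0 xs -> (exists2 i, (i <= n)%N & c i != 0) ->
  all (fun x => gpoly n c q x == 0) xs ->
  alternates (c n * \prod_(i < n) (q i - q n)) 0 xs (gpoly n c q).
Proof.
elim: n c q xs => [|n IH] c q [|x xs] //= q_inj.
  move=> _ _ [[]// _ c0] _ t t0.
  rewrite /gpoly big_nat1 big_ord0 mulr1 mulrA mulr_gt0 ?powR_gt0 //.
  by rewrite -expr2 exprn_even_gt0.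
move=> [sxs] /andP[x0 pxs] [i0 i0n ci0] /andP[/eqP Px Pxs].
(* The first exponent becomes 0, so its term disappears in the derivative. *)
pose r i := q i - q 0%N.
pose F := gpoly n.+1 c r.
have PF t : 0 < t -> exists2 w, 0 < w & gpoly n.+1 c q t = w * F t.
  move=> t0; exists (t `^ q 0%N); rewrite ?powR_gt0 // /F /gpoly big_distrr /=.
  apply: eq_bigr => i _; rewrite mulrCA -powRD /r; last first.
    by apply/implyP => _; rewrite gt_eqF.
  by congr (_ * _ `^ _); ring.
have F0 t : 0 < t -> gpoly n.+1 c q t = 0 -> F t = 0.
  by move=> /PF[w w0 ->] /eqP; rewrite mulf_eq0 gt_eqF //= => /eqP.
have Fx : F x = 0 by exact: F0.
have Fxs : all (fun x => F x == 0) xs.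
  apply/allP => y yxs; apply/eqP/F0; last exact/eqP/(allP Pxs).
  apply: lt_trans x0 _.
  by move: pxs; rewrite (path_sortedE lt_trans) => /andP[/allP/(_ _ yxs)].
pose c' i := c i.+1 * r i.+1; pose q' i := r i.+1 - 1.
have dF t : 0 < t -> is_derive t 1 F (gpoly n c' q' t).
  move=> /(gpoly_derive n.+1 c r); rewrite {2}/gpoly big_nat_recl //.
  by rewrite (_ : r 0%N = 0) ?mulr0 ?mul0r ?add0r // /r subrr.
have [ys [sys iys Fys]] := rolle_zeros dF x0 pxs Fx Fxs.
apply: (@alternates_pos_mul _ F (x :: xs) _ 0 (lexx 0) PF).
have q'_inj : injective q'.
  by move=> i j; rewrite /q' /r => /addIr/addIr/q_inj[].
have rn i : r i.+1 != 0.
  by rewrite subr_eq0; apply/eqP => /q_inj.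
have c'_neq0 : exists2 i, (i <= n)%N & c' i != 0.
  have [[i [i_n ci]]|c0] := pselect (exists i, (i <= n)%N /\ c i.+1 != 0).
    by exists i; rewrite // mulf_neq0.
  have cS i : (i <= n)%N -> c i.+1 = 0.
    by move=> i_n; apply: contrapT => /eqP ci; apply: c0; exists i.
  have c00 : c 0%N != 0 by case: i0 i0n ci0 => // i i_n; rewrite cS ?eqxx.
  move: Fx; rewrite /F /gpoly big_nat_recl // big_nat big1 => [|i i_n]; last first.
    by rewrite cS ?mul0r.
  by rewrite /r subrr powRr0 mulr1 addr0 => /eqP; rewrite (negbTE c00).
have := IH c' q' ys q'_inj (etrans sys sxs) (interlaced_path x0 iys) c'_neq0 Fys.
have -> : c' n * \prod_(i < n) (q' i - q' n) =
          - (c n.+1 * \prod_(i < n.+1) (q i - q n.+1)).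
  rewrite big_ord_recl (eq_bigr (fun i : 'I_n => q (lift ord0 i) - q n.+1)).
    by rewrite /c' /r /=; ring.
  by move=> i _; rewrite lift0 /q' /r; ring.
move=> /(alternates_antiderivative dF (lexx 0) x0 iys Fx Fxs).
by rewrite opprK.
Qed.

(** There is one coefficient more than there are linear conditions. *)
Lemma gpoly_vanishing n (q : nat -> R) xs : size xs = n ->
  exists c, (exists2 i, (i <= n)%N & c i != 0) /\
            all (fun x => gpoly n c q x == 0) xs.
Proof.
move=> sxs; pose M : 'M[R]_(n.+1, n) := \matrix_(i, j) (nth 0 xs j `^ q i).
have : kermx M != 0.
  rewrite -mxrank_eq0 mxrank_ker subn_eq0 -ltnNge ltnS.
  exact: rank_leq_col.
move=> /rowV0Pn[v /sub_kermxP vM v0].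
exists (fun i => v ord0 (inord i)); split.
  have /existsP[i vi] : [exists i, v ord0 i != 0].
    apply: contraNT v0; rewrite negb_exists => /forallP v0.
    by apply/eqP/rowP => i; rewrite mxE; apply/eqP; move: (v0 i); rewrite negbK.
  by exists i; [rewrite -ltnS|rewrite inord_val].
apply/(all_nthP 0) => j; rewrite sxs => jn; apply/eqP.
have /matrixP/(_ ord0 (Ordinal jn)) := vM.
rewrite mxE [RHS]mxE => E; apply: etrans E.
by rewrite /gpoly big_mkord; apply: eq_bigr => i _; rewrite mxE inord_val.
Qed.

(** Allowing degenerate intervals, and zeros inside the intervals, makes the bound [k]
on the number of sign changes easy to propagate through products, shifts and
extensions. *)
Fixpoint sign_changes k s u D : Prop :=
  (forall t, u < t -> 0 <= s * D t) \/
  (if k is k'.+1 then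
     exists v, [/\ u <= v, forall t, u < t < v -> 0 <= s * D t &
                  sign_changes k' (- s) v D]
   else False).

(** [Z] is a finite set of points at which nothing is required: merging two
adjacent intervals of the same sign leaves their common endpoint out. *)
Fixpoint weakly_alternates Z s u xs D : Prop :=
  if xs is x :: xs' then
    [/\ u < x, forall t, u < t < x -> t \notin Z -> 0 <= s * D t
      & weakly_alternates Z (- s) x xs' D]
  else forall t, u < t -> t \notin Z -> 0 <= s * D t.

Lemma weakly_alternates_cons Z v s u xs D :
  weakly_alternates Z s u xs D -> weakly_alternates (v :: Z) s u xs D.
Proof.
elim: xs s u => [|x xs IH] s u /=.
  by move=> H t ut; rewrite in_cons negb_or => /andP[_ /H]; exact.
move=> [ux H A]; split => //; last exact: IH.
by move=> t ut; rewrite in_cons negb_or => /andP[_ /H]; exact.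
Qed.

Lemma same_sign_ge0 s s' d : 0 < s * s' -> 0 <= s * d -> 0 <= s' * d.
Proof.
move=> ss' sd.
have s2 : 0 < s * s.
  rewrite -expr2 exprn_even_gt0 //=.
  by apply: contraTneq ss' => ->; rewrite mul0r ltxx.
by rewrite -(pmulr_rge0 _ s2) mulrACA mulr_ge0 // ltW.
Qed.

(** Degenerate intervals can be removed. Either all [k] sign changes survive, and
the first sign is still [s], or there are fewer of them; in the application the
latter case gives equality of the functions outright. *)
Lemma sign_changes_normal k s u D : s != 0 -> sign_changes k s u D ->
  exists Z xs s', [/\ weakly_alternates Z s' u xs D, path <%R u xs,
    (size xs <= k)%N, s' != 0 & size xs = k -> s' = s].
Proof.
elim: k s u => [|k IH] s u s0 /=.
  by move=> [H|//]; exists [::], [::], s; split=> // t ut _; exact: H.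
move=> [H|[v [uv H C]]].
  by exists [::], [::], s; split=> // t ut _; exact: H.
have [|Z [xs [s' [A pxs sxs s'0 E]]]] := IH _ _ _ C; first by rewrite oppr_eq0.
move: uv; rewrite le_eqVlt => /predU1P[uv|uv].
  rewrite uv; exists Z, xs, s'; split=> //; first exact: leqW.
  by move=> e; move: sxs; rewrite e ltnn.
have := weakly_alternates_cons v A.
have [ss'|ss'] := ltP 0 (s * s'); last first.
  exists (v :: Z), (v :: xs), (- s'); split => //=.
  - split=> //; last by rewrite opprK.
    move=> t tv _; apply: (same_sign_ge0 (s := s)) (H t tv).
    by rewrite mulrN oppr_gt0 lt_neqAle ss' mulf_neq0.
  - by rewrite uv.
  - by rewrite oppr_eq0.
  - by move=> [/E ->]; rewrite opprK.
move=> {}A; exists (v :: Z), xs, s'.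
have sgn t : 0 <= s * D t -> 0 <= s' * D t by exact: same_sign_ge0.
split => //.
- case: xs A {pxs sxs E} => [|x xs] /=.
    move=> H' t ut; have [tv _|vt] := ltP t v; first by apply/sgn/H; rewrite ut.
    move=> /[dup] + /H'; rewrite in_cons negb_or => /andP[tv _]; apply.
    by rewrite lt_neqAle eq_sym tv.
  move=> [vx H' A]; split=> //; first exact: lt_trans vx.
  move=> t /andP[ut tx]; have [tv _|vt] := ltP t v.
    by apply/sgn/H; rewrite ut.
  move=> /[dup] + /H'; rewrite in_cons negb_or => /andP[tv _]; apply.
  by rewrite lt_neqAle eq_sym tv vt.
- by case: xs pxs {A sxs E} => //= x xs /andP[vx ->]; rewrite (lt_trans uv vx).
- exact: leqW.
- by move=> e; move: sxs; rewrite e ltnn.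
Qed.

Lemma alternates_mul_ge0 Z s s' u xs F D :
  alternates s u xs F -> weakly_alternates Z s' u xs D ->
  forall t, u < t -> t \notin xs -> t \notin Z ->
    F t != 0 /\ 0 <= (s * F t) * (s' * D t).
Proof.
elim: xs s s' u => [|x xs IH] s s' u /=.
  move=> HF HD t ut _ tZ; have Ft := HF t ut; have Dt := HD t ut tZ.
  split; last exact: mulr_ge0 (ltW Ft) Dt.
  by apply: contraTneq Ft => ->; rewrite mulr0 ltxx.
move=> [ux HF AF] [_ HD AD] t ut; rewrite in_cons negb_or => /andP[tx txs] tZ.
have [xt|tlx|e] := ltgtP x t; last by rewrite e eqxx in tx.
  by have := IH _ _ _ AF AD t xt txs tZ; rewrite !mulNr mulrN opprK.
have Ft := HF t; have Dt := HD t; rewrite ut tlx in Ft Dt.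
split; last by rewrite mulr_ge0 // ?Dt // ltW // Ft.
by apply: contraTneq (Ft isT) => ->; rewrite mulr0 ltxx.
Qed.

End Descartes.

(** * Log-concave functions restricted to the half-line *)

Section Profiles.
Variable R : realType.
Implicit Types (f g F : R -> R) (q t x y z : R).

(** Log-concavity on the half-line in a form without logarithms: a nonincreasing
function is log-concave as soon as all its products with growing exponentials
are quasiconcave. This is stable under tilts and shifts, and directly bounds the
number of sign changes. *)
Definition tilt_quasiconcave F := forall c x y z, 0 <= c -> 0 <= x ->
  x < y < z ->
  Num.min (expR (c * x) * F x) (expR (c * z) * F z) <= expR (c * y) * F y.

(** The restriction to the half-line of an even log-concave function that takes the
value 1 at 0. *)
Definition profile f :=
  [/\ f 0 = 1, forall t, 0 <= t -> 0 <= f t,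
      forall x y, 0 <= x <= y -> f y <= f x & tilt_quasiconcave f].

Lemma profile_le1 f t : profile f -> 0 <= t -> f t <= 1.
Proof. by case=> <- _ + _ t0; apply; rewrite lexx t0. Qed.

Lemma profile_measurable f : profile f ->
  measurable_fun (`]0, +oo[ : set R) f.
Proof.
case=> _ _ ni _.
apply: (eq_measurable_fun (fun x => f (Num.max 0 x))).
  by move=> x; rewrite inE/= in_itv/= andbT => x0; rewrite max_r // ltW.
apply: nonincreasing_measurable => // x y xy.
by apply: ni; rewrite le_max lexx /= ge_max !le_max lexx xy orbT.
Qed.

Lemma moment_fun_measurable q f : profile f ->
  measurable_fun (`]0, +oo[ : set R) (fun t => t `^ q * f t).
Proof.
move=> pf; apply: measurable_funM; last exact: profile_measurable.
exact: measurable_funTS (measurable_powR q).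
Qed.

Lemma moment_fun_ge0 q f t : profile f -> t \in `]0, +oo[%R ->
  (0 <= (t `^ q * f t)%:E)%E.
Proof.
case=> _ f0 _ _; rewrite in_itv/= andbT => t0.
by rewrite lee_fin mulr_ge0 ?powR_ge0 ?f0 ?ltW.
Qed.

Lemma moment_ge0 q f : profile f -> (0 <= moment q f)%E.
Proof. by move=> pf; apply: integral_ge0 => t; exact: moment_fun_ge0. Qed.

Lemma moment_le q f g : profile f -> profile g ->
  (forall t, 0 < t -> f t <= g t) -> (moment q f <= moment q g)%E.
Proof.
move=> pf pg fg; apply: ge0_le_integral => //.
- by move=> t; exact: moment_fun_ge0.
- by apply/measurable_EFinP; exact: moment_fun_measurable.
- by apply/measurable_EFinP; exact: moment_fun_measurable.
- move=> t /=; rewrite in_itv/= andbT => t0.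
  by rewrite lee_fin ler_wpM2l ?powR_ge0 ?fg.
Qed.

Lemma moment_eq q f g : (forall t, 0 < t -> f t = g t) ->
  moment q f = moment q g.
Proof.
by move=> fg; apply: eq_integral => t; rewrite inE/= in_itv/= andbT => /fg ->.
Qed.

Lemma integral_powR q a b : -1 < q -> 0 < a -> a < b ->
  (\int[@lebesgue_measure R]_(t in `[a, b]) (t `^ q)%:E =
   ((b `^ (q + 1) - a `^ (q + 1)) / (q + 1))%:E)%E.
Proof.
move=> q1 a0 ab.
have q0 : q + 1 != 0 by rewrite gt_eqF //; lra.
pose F t : R := t `^ (q + 1) / (q + 1).
have dF t : 0 < t -> is_derive t 1 F (t `^ q).
  move=> t0; have H := is_derive1_powR (q + 1) t0.
  rewrite /F.
  have -> : (fun t => t `^ (q + 1) / (q + 1)) = (q + 1)^-1 \*: (fun x => x `^ (q + 1)).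
    by apply/funext => x; rewrite mulrC.
  apply: is_derive_eq.
  by rewrite /GRing.scale /= addrK mulrA mulVf // mul1r.
have cont_F t : 0 < t -> {for t, continuous F}.
  by move=> t0; apply: differentiable_continuous; apply/derivable1_diffP;
    case: (dF t t0).
rewrite (@continuous_FTC2 _ (fun t => t `^ q) F) //.
- by rewrite -EFinB /F mulrBl.
- apply: continuous_in_subspaceT => t; rewrite inE/= in_itv/= => /andP[a_t _].
  have t0 : 0 < t by exact: lt_le_trans a_t.
  apply: differentiable_continuous; apply/derivable1_diffP.
  by have [] := is_derive1_powR q t0.
- split.
  + move=> t; rewrite in_itv/= => /andP[a_t _].
    by case: (dF t (lt_trans a0 a_t)).
  + by apply: cvg_at_right_filter; exact: cont_F.
  + by apply: cvg_at_left_filter; apply: cont_F; exact: lt_trans ab.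
- move=> t; rewrite in_itv/= => /andP[a_t _]; rewrite derive1E.
  by have [_ ->] := dF t (lt_trans a0 a_t).
Qed.

Lemma integral_powR01 q : -1 < q ->
  (\int[@lebesgue_measure R]_(t in `]0%R, 1%R]) (t `^ q)%:E < +oo)%E.
Proof.
move=> q1; pose A n : set R := `[n.+2%:R^-1, 1]%classic.
have mf (D : set R) : measurable_fun D (EFin \o (fun t : R => t `^ q)).
  by apply/measurable_EFinP; exact: measurable_funTS (measurable_powR q).
have -> : `]0%R, 1%R]%classic = \bigcup_n A n :> set R.
  apply/seteqP; split => x /=.
    rewrite in_itv/= => /andP[x0 x1].
    exists (Num.trunc (x^-1)); rewrite // /A /= in_itv/= x1 andbT.
    rewrite -[leRHS]invrK lef_pV2 ?posrE ?invr_gt0 //.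
    rewrite ltW // (lt_trans (truncnS_gt _)) // ltr_nat.
    exact: ltnSn.
  by move=> [n _]; rewrite /A/= !in_itv/= => /andP[+ ->]; rewrite andbT; apply: lt_le_trans.
apply: le_lt_trans (ltry (1 / (q + 1))).
have H : (\int[@lebesgue_measure R]_(t in A n) (t `^ q)%:E)%E @[n --> \oo] -->
         (\int[@lebesgue_measure R]_(t in \bigcup_n A n) (t `^ q)%:E)%E.
  apply: ge0_nondecreasing_set_cvg_integral.
  - move=> n m nm; apply/subsetPset => x; rewrite /A/= !in_itv/= => /andP[nx ->].
    rewrite andbT; apply: le_trans nx; rewrite lef_pV2 ?posrE //.
    by rewrite ler_nat !ltnS.
  - by move=> n; exact: measurable_itv.
  - by move=> n; exact: mf.
  - by move=> n x _; rewrite lee_fin powR_ge0.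
apply: (cvge_to_le H).
apply: nearW => n; rewrite /A /= integral_powR //.
- rewrite lee_fin ler_pM2r ?invr_gt0; last lra.
  by rewrite powR1 lerBlDr lerDl powR_ge0.
- by rewrite invf_lt1 // ltr1n.
Qed.

(** The function is dominated by [t `^ q] near 0 and by a multiple of an exponential
density at infinity. *)
Lemma integrable_gamma q c : -1 < q -> 0 < c ->
  (@lebesgue_measure R).-integrable `]0, +oo[
    (EFin \o (fun t => t `^ q * expR (- c * t))).
Proof.
move=> q1 c0.
pose Q := `|q| + 1; have Q0 : 0 < Q by rewrite ltr_wpDl.
pose a := c / (2 * Q); have a0 : 0 < a by rewrite divr_gt0 // mulr_gt0.
pose K := expR (- Q * ln a).
have mp (D : set R) : measurable_fun D (fun t : R => t `^ q).
  exact: measurable_funTS (measurable_powR q).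
have I1 : (@lebesgue_measure R).-integrable `]0%R, +oo[
    (EFin \o ((fun t : R => t `^ q) \_ `]0, 1])).
  have -> : EFin \o ((fun t : R => t `^ q) \_ `]0, 1]) =
            (EFin \o (fun t : R => t `^ q)) \_ `]0, 1].
    by apply/funext => t /=; rewrite !patchE; case: ifP.
  have : (@lebesgue_measure R).-integrable `]0%R, 1%R] (EFin \o (fun t : R => t `^ q)).
    apply/integrableP; split; first by apply/measurable_EFinP; exact: mp.
    under eq_integral do rewrite /= ger0_norm ?powR_ge0 //.
    exact: integral_powR01.
  have E := @integrable_mkcond _ _ _ (@lebesgue_measure R) `]0%R, 1%R]%classic
    (EFin \o (fun t : R => t `^ q)) (measurable_itv _).
  move=> /E H.
  exact: integrableS H.
have I2 : (@lebesgue_measure R).-integrable `]0%R, +oo[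
    (fun t => ((K / (c / 2))%:E * (EFin \o exponential_pdf (c / 2)) t)%E).
  apply: integrableZl => //; apply: integrableS (integrable_exponential_pdf _) => //.
  by rewrite divr_gt0.
apply: le_integrable (integrableD _ I1 I2) => //.
  apply/measurable_EFinP; apply: measurable_funM; first exact: mp.
  apply: measurable_funTS; apply: measurableT_comp => //.
move=> t /=; rewrite in_itv/= andbT => t0.
have c20 : c / 2 != 0 by rewrite gt_eqF // divr_gt0.
have E : exponential_pdf (c / 2) t = c / 2 * expR (- (c / 2) * t).
  by rewrite /exponential_pdf patchE mem_set //= in_itv/= andbT ltW.
rewrite E lee_fin.
have -> : K / (c / 2) * (c / 2 * expR (- (c / 2) * t)) = K * expR (- (c / 2) * t).
  by rewrite mulrA divfK.
have pos1 : 0 <= ((fun t => t `^ q) \_ `]0, 1]) t.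
  by rewrite patchE; case: ifP => //; rewrite powR_ge0.
rewrite !ger0_norm ?addr_ge0 ?mulr_ge0 ?powR_ge0 ?expR_ge0 //.
have [t1|t1] := leP t 1.
  rewrite patchE mem_set /= ?in_itv/= ?t0 //.
  rewrite -[leLHS]addr0 lerD ?mulr_ge0 ?expR_ge0 //.
  rewrite ler_piMr ?powR_ge0 // -expR0 ler_expR.
  by rewrite mulNr oppr_le0 mulr_ge0 // ltW.
rewrite -[leLHS]add0r lerD //.
rewrite /powR gt_eqF // /K -!expRD ler_expR.
have lnt : 0 <= ln t by rewrite ln_ge0 // ltW.
have : q * ln t <= Q * ln t.
  by rewrite ler_wpM2r // /Q (le_trans (ler_norm q)) // lerDl.
have : ln a + ln t < a * t by rewrite -lnM ?posrE // ln_sublinear // mulr_gt0.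
have : Q * (a * t) = c / 2 * t by rewrite /a; field; rewrite gt_eqF.
move=> Ea; rewrite -(ltr_pM2l Q0) Ea => ? ?; lra.
Qed.
End Profiles.

(** * Comparison and continuity of moments *)

Section Moments.
Variable R : realType.
Implicit Types (f g F H : R -> R) (q t x y z : R).

Local Notation mu := (@lebesgue_measure R).

(** By log-concavity the mean decay rate [- ln (f t) / t] is nondecreasing, so it is
at least [- ln rho / t0] after [t0]; half of this rate is used. That the bound is
uniform in [f] provides the dominating function for limits of moments. *)
Lemma profile_decay rho t0 : 0 < rho < 1 -> 0 < t0 ->
  exists C c, [/\ 0 < C, 0 < c & forall f, profile f -> f t0 <= rho ->
    forall t, 0 < t -> f t <= C * expR (- c * t)].
Proof.
move=> /andP[r0 r1] t00; pose c := - ln rho / (2 * t0).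
have lnr : ln rho < 0 by rewrite ln_lt0 // r0.
have c0 : 0 < c by rewrite divr_gt0 ?mulr_gt0 // oppr_gt0.
exists (expR (c * t0)), c; split=> //; first exact: expR_gt0.
move=> f pf fr t t_gt0.
rewrite -expRD mulNr -mulrBr; have [tt0|t0t] := leP t t0.
  apply: le_trans (profile_le1 pf (ltW t_gt0)) _.
  by rewrite -expR0 ler_expR mulr_ge0 ?subr_ge0 // ltW.
have [f0 f_ge0 _ Q] := pf.
have := Q c 0 t0 t (ltW c0) (lexx 0); rewrite t00 t0t => /(_ isT).
rewrite mulr0 expR0 f0 mul1r => le1.
have lt1 : expR (c * t0) * f t0 < 1.
  apply: (@le_lt_trans _ _ (expR (c * t0) * rho)).
    by rewrite ler_pM2l ?expR_gt0.
  rewrite -[X in _ * X](@lnK _ rho) ?posrE // -expRD -expR0 ltr_expR.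
  have -> : c * t0 = - ln rho / 2 by rewrite /c; field; rewrite gt_eqF.
  lra.
have ct1 : expR (c * t) * f t < 1.
  rewrite ltNge; apply/negP => ge1; move: le1.
  by rewrite min_l // leNgt lt1.
have ct0 : 1 <= expR (c * t0).
  by rewrite -expR0 ler_expR mulr_ge0 // ltW.
rewrite mulrBr expRB ler_pdivlMr ?expR_gt0 // mulrC.
exact: le_trans (ltW ct1) ct0.
Qed.

(** The constant 1 is the only profile that is not nontrivial, and the only one
whose moments are infinite. *)
Definition nontrivial f := exists2 t, 0 < t & f t < 1.

Lemma profile_integrable q f : -1 < q -> profile f -> nontrivial f ->
  mu.-integrable `]0, +oo[ (EFin \o (fun t => t `^ q * f t)).
Proof.
move=> q1 pf [t0 t00 ft0].
have ft0_ge0 : 0 <= f t0 by case: pf => _ + _ _; apply; exact: ltW.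
have r01 : 0 < (f t0 + 1) / 2 < 1 by lra.
have [C [c [C0 c0 /(_ f pf)]]] := profile_decay r01 t00.
move=> /(_ ltac:(lra)) fC.
apply: (le_integrable _ _ _ (integrableZl _ C (integrable_gamma q1 c0))) => //.
  by apply/measurable_EFinP; exact: moment_fun_measurable.
move=> t /=; rewrite in_itv/= andbT => t_gt0; rewrite lee_fin.
have ft : 0 <= f t by case: pf => _ + _ _; apply; exact: ltW.
rewrite !ger0_norm ?mulr_ge0 ?powR_ge0 ?expR_ge0 ?(ltW C0) // mulrCA.
by rewrite ler_wpM2l ?powR_ge0 // fC.
Qed.

Lemma moment_fin q f : -1 < q -> profile f -> nontrivial f ->
  moment q f \is a fin_num.
Proof. by move=> q1 pf nf; apply: integrable_fin_num => //; exact: profile_integrable. Qed.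

(** A profile is at least [f b] on all of [[0, b]], which bounds its moments from below. *)
Lemma moment_ge_initial q f b : -1 < q -> profile f -> 1 < b ->
  ((f b * ((b `^ (q + 1) - 1) / (q + 1)))%:E <= moment q f)%E.
Proof.
move=> q1 pf b1; have [_ f_ge0 ni _] := pf.
have b0 : 0 < b by exact: lt_trans b1.
have mp (D : set R) : measurable_fun D (fun t : R => t `^ q).
  exact: measurable_funTS (measurable_powR q).
apply: (@le_trans _ _ (\int[mu]_(t in `[1%R, b]) (t `^ q * f t)%:E)%E); last first.
  apply: ge0_subset_integral => //.
  - by apply/measurable_EFinP; exact: moment_fun_measurable.
  - by move=> t; exact: moment_fun_ge0.
  - by move=> t /=; rewrite !in_itv/= andbT => /andP[t1 _]; exact: lt_le_trans t1.
have -> : (f b * ((b `^ (q + 1) - 1) / (q + 1)))%:E =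
          (\int[mu]_(t in `[1%R, b]) ((f b)%:E * (t `^ q)%:E))%E.
  rewrite ge0_integralZl //; first by rewrite integral_powR // powR1 EFinM.
  - by apply/measurable_EFinP; exact: mp.
  - by move=> t _; rewrite lee_fin powR_ge0.
  - by rewrite lee_fin f_ge0 // ltW.
apply: ge0_le_integral => //.
- by move=> t _; rewrite lee_fin mulr_ge0 ?powR_ge0 // f_ge0 // ltW.
- apply/measurable_EFinP; apply: measurable_funM => //; exact: mp.
- apply/measurable_EFinP; apply: measurable_funS (moment_fun_measurable q pf) => //.
  by move=> t /=; rewrite !in_itv/= andbT => /andP[t1 _]; exact: lt_le_trans t1.
- move=> t /=; rewrite in_itv/= => /andP[t1 tb]; rewrite lee_fin mulrC.
  by rewrite ler_wpM2l ?powR_ge0 // ni // tb andbT (le_trans _ t1).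
Qed.

Lemma powR_unbounded q A (Z : seq R) : -1 < q ->
  exists b, [/\ 1 < b, b \notin Z & A <= (b `^ (q + 1) - 1) / (q + 1)].
Proof.
move=> q1; have q0 : 0 < q + 1 by lra.
have [M MZ] : exists M, forall z, z \in Z -> z <= M.
  elim: Z => [|z Z [M IH]]; first by exists 0.
  exists (Num.max z M) => x; rewrite in_cons => /predU1P[->|/IH xM].
    by rewrite le_max lexx.
  by rewrite le_max xM orbT.
pose a := 1 + `|A| * (q + 1); have a1 : 1 <= a.
  by rewrite lerDl mulr_ge0 // ltW.
pose b0 := a `^ (q + 1)^-1.
exists (Num.max b0 (Num.max M 1) + 1); split.
- by rewrite ltrDr !lt_max; apply/or3P; constructor 3; lra.
- apply/negP => /MZ; apply/negP; rewrite -ltNge.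
  by rewrite (@le_lt_trans _ _ (Num.max b0 (Num.max M 1))) ?ltrDl // !le_max lexx orbT.
rewrite ler_pdivlMr // lerBrDr.
apply: (@le_trans _ _ a).
  by rewrite /a addrC lerD2l ler_wpM2r ?ler_norm // ltW.
have -> : a = b0 `^ (q + 1).
  by rewrite /b0 -powRrM mulVf ?gt_eqF // powRr1 // (le_trans _ a1).
rewrite ge0_ler_powR ?nnegrE ?ltW ?powR_ge0 //.
- by rewrite powR_gt0 // (lt_le_trans _ a1).
- by rewrite (@lt_le_trans _ _ 1) // lerDr !le_max ler01 !orbT.
by rewrite (@le_lt_trans _ _ (Num.max b0 (Num.max M 1))) ?ltrDl // le_max lexx.
Qed.

Lemma moment_trivial q f : -1 < q -> profile f ->
  ~ nontrivial f -> moment q f = +oo%E.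
Proof.
move=> q1 pf nf; apply/eqyP => A A0.
have [b [b1 _ Ab]] := powR_unbounded A [::] q1.
apply: le_trans (moment_ge_initial q1 pf b1); rewrite lee_fin.
have -> : f b = 1; last by rewrite mul1r.
apply/eqP; rewrite eq_le profile_le1 //=; last exact: ltW (lt_trans _ b1).
rewrite leNgt; apply/negP => fb; apply: nf; exists b => //.
exact: lt_trans b1.
Qed.

(** Continuous convergence off a finite set: pointwise convergence would not survive
delays by varying lengths, while jumps at finitely many points, as created by
cutoffs, do not affect moments. *)
Definition cconv (g_ : nat -> R -> R) g := exists Z : seq R,
  forall t, 0 < t -> t \notin Z ->
  forall u : nat -> R, u @ \oo --> t -> (fun k => g_ k (u k)) @ \oo --> g t.

(** If the limit is nontrivial, so are almost all terms, with a common exponential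
bound, and dominated convergence applies. If the limit is the constant 1, then
all moments blow up by the bound on initial segments. *)
Lemma cconv_moment q (g_ : nat -> R -> R) g : -1 < q ->
  (forall k, profile (g_ k)) -> profile g -> cconv g_ g ->
  (fun k => moment q (g_ k)) @ \oo --> moment q g.
Proof.
move=> q1 pg_ pg [Z gZ].
have gpt t : 0 < t -> t \notin Z -> (fun k => g_ k t) @ \oo --> g t.
  by move=> t0 tZ; apply: (gZ t t0 tZ (fun _ => t)); exact: cvg_cst.
(* The limit is 1: the terms are eventually at least 1/2 at a distant point. *)
have [[t1 t10 gt1]|nt] := pselect (nontrivial g); last first.
  rewrite (moment_trivial q1 pg nt); apply/cvgeyPge => A.
  have [b [b1 bZ Ab]] := powR_unbounded (2 * `|A|) Z q1.
  have b0 : 0 < b by exact: lt_trans b1.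
  have gb : g b = 1.
    apply/eqP; rewrite eq_le profile_le1 ?(ltW b0) //=.
    by rewrite leNgt; apply/negP => gb; apply: nt; exists b.
  have := gpt b b0 bZ; rewrite gb => /cvgr_ge /(_ (2^-1)).
  rewrite invf_lt1 ?ltr1n // => /(_ isT); apply: filterS => k gkb.
  apply: le_trans (moment_ge_initial q1 (pg_ k) b1); rewrite lee_fin.
  apply: (@le_trans _ _ (2^-1 * (2 * `|A|))).
    by rewrite mulrA mulVf // mul1r ler_norm.
  exact: ler_pM.
have [t2 [t20 t2Z gt2]] : exists t, [/\ 0 < t, t \notin Z & g t < 1].
  have [b [b1 bZ Ab]] := powR_unbounded 0 [seq z - t1 | z <- Z] q1.
  have b0 : 0 < b by exact: lt_trans b1.
  exists (b + t1); split; first exact: addr_gt0.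
    apply: contra bZ => bZ; apply/mapP; exists (b + t1) => //.
    by rewrite addrK.
  apply: le_lt_trans gt1; case: pg => _ _ + _; apply.
  by rewrite (ltW t10) lerDr ltW.
have g2_ge0 : 0 <= g t2 by case: pg => _ + _ _; apply; exact: ltW.
pose rho := (g t2 + 1) / 2.
have r01 : 0 < rho < 1 by rewrite /rho; lra.
have [C [c [C0 c0 dom]]] := profile_decay r01 t20.
have [N _ HN] : \forall k \near \oo, g_ k t2 <= rho.
  by have /cvgr_le := gpt t2 t20 t2Z; apply; rewrite /rho; lra.
rewrite -(cvg_shiftn N).
have mfun f : profile f -> measurable_fun (`]0, +oo[ : set R)
    (EFin \o (fun t => t `^ q * f t)).
  by move=> pf; apply/measurable_EFinP; exact: moment_fun_measurable.
have [] := @dominated_convergence _ _ _ mu `]0, +oo[%classic (measurable_itv _)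
  (fun n => EFin \o (fun t => t `^ q * g_ (n + N)%N t))
  (EFin \o (fun t => t `^ q * g t))
  (fun t : R => (C%:E * (t `^ q * expR (- c * t))%:E)%E).
- by move=> n; exact: mfun.
- exact: mfun.
- exists [set` Z]; split.
  + apply: countable_measurable => //.
    exact/finite_set_countable/finite_seq.
  + exact/countable_lebesgue_measure0/finite_set_countable/finite_seq.
  + move=> t /= /not_implyP[]; rewrite in_itv/= andbT => t0 ncv.
    apply: contrapT => /negP tZ; apply: ncv; apply: cvg_EFin.
      exact: nearW.
    rewrite /comp /=; apply: cvgMr.
    have := gpt t t0 tZ; rewrite -(cvg_shiftn N); exact.
- by apply: integrableZl => //; exact: integrable_gamma.
- apply: aeW => t n /=; rewrite in_itv/= andbT => t0; rewrite lee_fin.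
  have gt : 0 <= g_ (n + N)%N t by case: (pg_ (n + N)%N) => _ + _ _; apply; exact: ltW.
  rewrite ger0_norm ?mulr_ge0 ?powR_ge0 // mulrCA.
  rewrite ler_wpM2l ?powR_ge0 // dom //.
  by apply: HN => /=; rewrite leq_addl.
by [].
Qed.

Section Comparison.
Variables (q : nat -> R) (F H : R -> R).
Hypotheses (q_gt : forall i, -1 < q i) (q_inj : injective q).
Hypotheses (pF : profile F) (pH : profile H).
Hypotheses (nF : nontrivial F) (nH : nontrivial H).

Let gap i := fine (moment (q i) F) - fine (moment (q i) H).
Let D t := F t - H t.

Let gap_integral i :
  mu.-integrable `]0, +oo[ (EFin \o (fun t => t `^ q i * D t)) /\
  \int[mu]_(t in `]0, +oo[) (t `^ q i * D t) = gap i.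
Proof.
have IF := profile_integrable (q_gt i) pF nF.
have IH := profile_integrable (q_gt i) pH nH.
have -> : (fun t => t `^ q i * D t) = (fun t => t `^ q i * F t - t `^ q i * H t).
  by apply/funext => t; rewrite /D mulrBr.
split; first exact: integrableB IF IH.
by rewrite RintegralB.
Qed.

Let sum_integral n c :
  mu.-integrable `]0, +oo[ (EFin \o (fun t => gpoly n c q t * D t)) /\
  \int[mu]_(t in `]0, +oo[) (gpoly n c q t * D t) = \sum_(0 <= i < n.+1) c i * gap i.
Proof.
rewrite /gpoly; elim: n.+1 => [|k [IH1 IH2]].
  have -> : (fun t => (\sum_(0 <= i < 0) c i * t `^ q i) * D t) = cst 0.
    by apply/funext => t; rewrite big_geq // mul0r.
  split; first exact: integrable0.
  by rewrite big_geq // Rintegral_cst // mul0r.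
have -> : (fun t => (\sum_(0 <= i < k.+1) c i * t `^ q i) * D t) =
  (fun t => (\sum_(0 <= i < k) c i * t `^ q i) * D t + c k * (t `^ q k * D t)).
  by apply/funext => t; rewrite big_nat_recr //= mulrDl mulrA.
have [G1 G2] := gap_integral k.
have I : mu.-integrable `]0, +oo[ (EFin \o (fun t => c k * (t `^ q k * D t))).
  exact: integrableZl G1.
split; first exact: integrableD IH1 I.
by rewrite RintegralD // IH2 big_nat_recr //= RintegralZl // G2.
Qed.

(** A null set contains no interval, so an almost everywhere equality holds at
points arbitrarily close to 0. *)
Lemma ae_eq_dense : (\forall t \ae mu, 0 < t -> F t = H t) ->
  forall b, 0 < b -> exists2 t, 0 < t < b & F t = H t.
Proof.
move=> [N [mN N0 subN]] b b0; apply: contrapT => noeq.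
have : (mu `]0%R, b[%classic <= mu N)%E.
  apply: le_measure; rewrite ?inE //.
  move=> t /=; rewrite in_itv/= => tb; apply: subN => /= /(_ (andP tb).1) e.
  by apply: noeq; exists t.
by rewrite N0 lebesgue_measure_itv /= lte_fin b0 sube0 leNgt lte_fin b0.
Qed.

(** Let [P] be a generalized polynomial in the powers [q 0], ..., [q k] that vanishes
exactly at the [k <= n] sign changes of [F - H]. Then [P * (F - H)] has constant
sign, while its integral reduces to the term of order [k], all lower moments
being equal. If [k < n] this term vanishes too, so [F = H] almost everywhere. If
[k = n] the sign of [P] computed by Descartes' rule gives the sign of the gap
between the moments of order [n]. *)
Lemma moment_comparison n s : s != 0 -> sign_changes n s 0 D ->
  (forall i, (i < n)%N -> moment (q i) F = moment (q i) H) ->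
  0 <= s * \prod_(i < n) (q i - q n) * gap n /\
  (gap n = 0 -> \forall t \ae mu, 0 < t -> F t = H t).
Proof.
move=> s0 /(sign_changes_normal s0)[Z [xs [s' [wa pxs sxs s'0 ss']]]] meq.
have gap0 i : (i < n)%N -> gap i = 0 by move=> /meq E; rewrite /gap E subrr.
pose k := size xs.
have [c [cnz Pz]] := @gpoly_vanishing R k q xs erefl.
have alt := gpoly_alternates q_inj (erefl k) pxs cnz Pz.
set sg := c k * _ in alt.
have sg0 : sg != 0 := alternates_neq0 alt.
have prodE t := alternates_mul_ge0 alt wa (t := t).
have [I J] := sum_integral k c.
have Jk : \sum_(0 <= i < k.+1) c i * gap i = c k * gap k.
  rewrite big_nat_recr //= big_nat big1 ?add0r // => i ik.
  by rewrite gap0 ?mulr0 // (leq_trans ik).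
rewrite {}Jk in J.
pose E t := (sg * s') * (gpoly k c q t * D t).
have IE : mu.-integrable `]0, +oo[ (EFin \o E) by exact: integrableZl I.
have JE : \int[mu]_(t in `]0, +oo[) E t = sg * s' * (c k * gap k).
  by rewrite RintegralZl // J.
have neg0 : mu.-negligible [set` Z ++ xs].
  exists [set` Z ++ xs]; split=> //.
    apply: countable_measurable => //.
    exact/finite_set_countable/finite_seq.
  exact/countable_lebesgue_measure0/finite_set_countable/finite_seq.
have E_ge0 t : 0 < t -> t \notin Z ++ xs -> 0 <= E t.
  rewrite mem_cat negb_or => t0 /andP[tZ txs].
  by have [_] := prodE t t0 txs tZ; rewrite mulrACA.
have JabsE : \int[mu]_(t in `]0, +oo[) `|E t| = sg * s' * (c k * gap k).
  rewrite -JE; congr fine; apply: ae_eq_integral => //.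
  - by apply: measurable_int; exact: integrable_abse IE.
  - exact: measurable_int IE.
  - apply: negligibleS neg0 => t /= /not_implyP[].
    rewrite in_itv/= andbT => t0 nE; apply: contrapT => /negP tZ; apply: nE.
    by rewrite ger0_norm // E_ge0.
have J_ge0 : 0 <= sg * s' * (c k * gap k).
  by rewrite -JabsE; apply: Rintegral_ge0.
have zero_eq : gap k = 0 -> \forall t \ae mu, 0 < t -> F t = H t.
  move=> gk.
  have : (\int[mu]_(t in `]0%R, +oo[) `|(EFin \o E) t| = 0)%E.
    rewrite -[LHS]fineK; last first.
      by apply: integrable_fin_num => //; exact: integrable_abse.
    by have := JabsE; rewrite /Rintegral gk !mulr0 => ->.
  move=> /(ae_eq_integral_abs mu (measurable_itv _) (measurable_int mu IE)) neg1.
  apply: negligibleS (negligibleU neg0 neg1) => t /= /not_implyP[t0 FH].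
  have [tZ|tZ] := boolP (t \in Z ++ xs); first by left.
  right; apply/not_implyP; split; first by rewrite in_itv/= t0.
  move=> Et0; have {Et0}/eqP : E t = 0 by exact: EFin_inj Et0.
  move: (tZ); rewrite mem_cat negb_or => /andP[tZ' txs].
  rewrite /E mulf_eq0 (negbTE (mulf_neq0 sg0 s'0)) /= mulf_eq0.
  by rewrite (negbTE (prodE t t0 txs tZ').1) /= subr_eq0 => /eqP.
(* Fewer than [n] sign changes: the integral vanishes, hence so does every gap. *)
have [kn|kn] := eqVneq k n; last first.
  have {}kn : (k < n)%N by rewrite ltn_neqAle kn.
  have eqs := zero_eq (gap0 k kn).
  have -> : gap n = 0; last by rewrite mulr0.
  apply/eqP; rewrite subr_eq0; apply/eqP; congr fine.
  apply: ae_eq_integral => //.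
  - by apply/measurable_EFinP; exact: moment_fun_measurable.
  - by apply/measurable_EFinP; exact: moment_fun_measurable.
  - apply: negligibleS eqs => t /= /not_implyP[]; rewrite in_itv/= andbT.
    by move=> t0 ne FH; apply: ne; rewrite FH.
rewrite kn in zero_eq; split=> //.
have cn0 : 0 < c n * c n.
  rewrite -expr2 exprn_even_gt0 //=.
  by apply: contraNneq sg0; rewrite /sg kn => ->; rewrite mul0r.
move: J_ge0; rewrite /sg kn ss' // => J_ge0; rewrite -(pmulr_rge0 _ cn0).
apply: le_trans J_ge0 _; rewrite le_eqVlt; apply/orP; left; apply/eqP; ring.
Qed.

End Comparison.
End Moments.

(** * Tilts, delays and simple functions *)

Section Patterns.
Variable R : realType.
Implicit Types (f g F D : R -> R) (q t x y z s u v d : R) (th : nat -> R).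

(** A parameter [x] in [[0, 1]] encodes the slope [- ln (1 - x)] in [[0, +oo]], so
that the parameter space is compact; [x = 1] gives the indicator of 0. *)
Definition tilt x g t : R := (1 - x) `^ t * g t.
(** A plateau of height 1 and length [x / (1 - x)] in [[0, +oo]] is put in front of
[g]. The test is written without division so that [x = 1] gives the constant 1. *)
Definition delay x g t : R :=
  if t * (1 - x) <= x then 1 else g (t - x / (1 - x)).
Definition step (e : bool) x g : R -> R := if e then tilt x g else delay x g.
Fixpoint steps (l : seq (bool * R)) g : R -> R :=
  if l is (e, x) :: l' then step e x (steps l' g) else g.
(** Simple functions of order [n], with parameters [th 0], ..., [th n.-1]. Tilts and
delays alternate, starting with a tilt if [e] is [true], and the last one acts
on the indicator of 0 or on the constant 1 so that it is never redundant. *)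
Fixpoint sim n (e : bool) th : R -> R :=
  if n is n'.+1 then step e (th 0%N) (sim n' (~~ e) (fun i => th i.+1))
  else if e then fun t => (t == 0)%:R else cst 1.

Definition unit_param th := forall i, 0 <= th i <= 1.

Lemma delayE x g t : 0 <= x < 1 ->
  delay x g t = if t <= x / (1 - x) then 1 else g (t - x / (1 - x)).
Proof. by move=> /andP[x0 x1]; rewrite /delay ler_pdivlMr // subr_gt0. Qed.

Lemma delay1 g t : delay 1 g t = 1.
Proof. by rewrite /delay subrr mulr0 ler01. Qed.

Lemma tilt1 g t : 0 < t -> tilt 1 g t = 0.
Proof. by move=> t0; rewrite /tilt subrr powR0 ?mul0r // gt_eqF. Qed.

Lemma tiltE x g t : x < 1 -> tilt x g t = expR (ln (1 - x) * t) * g t.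
Proof. by move=> x1; rewrite /tilt /powR subr_eq0 gt_eqF // mulrC [t * _]mulrC mulrC. Qed.

Lemma ln1x_le0 x : 0 <= x < 1 -> ln (1 - x) <= 0 :> R.
Proof. by move=> /andP[x0 x1]; rewrite -ln1 ler_ln ?posrE ?subr_gt0 // gerBl. Qed.

Lemma delay_ge0 x : 0 <= x < 1 -> 0 <= x / (1 - x).
Proof. by move=> /andP[x0 x1]; rewrite divr_ge0 // subr_ge0 ltW. Qed.

Lemma tilt_quasiconcave_tilt a F : 0 <= a -> tilt_quasiconcave F ->
  tilt_quasiconcave (fun t => expR (a * t) * F t).
Proof.
move=> a0 Q c x y z c0 x0 xyz.
by rewrite !mulrA -!expRD -!mulrDl; apply: Q => //; exact: addr_ge0.
Qed.

Lemma tilt_quasiconcave_shift d F : 0 <= d -> tilt_quasiconcave F ->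
  tilt_quasiconcave (fun t => F (d + t)).
Proof.
move=> d0 Q c x y z c0 x0 xyz.
have := Q c (d + x) (d + y) (d + z) c0 (addr_ge0 d0 x0).
rewrite !ltrD2l => /(_ xyz); rewrite !mulrDr !expRD -!mulrA.
by rewrite -minr_pMr ?expR_ge0 // ler_pM2l ?expR_gt0.
Qed.

Lemma profile_cst1 : profile (cst 1 : R -> R).
Proof.
split=> //.
move=> c x y z c0 x0 /andP[xy yz]; rewrite /= !mulr1 ge_min ler_expR.
by rewrite ler_wpM2l // ltW.
Qed.

Lemma profile_point : profile (fun t : R => (t == 0)%:R).
Proof.
split; first by rewrite eqxx.
- by move=> t _; exact: ler0n.
- move=> x y /andP[x0 xy]; have [y0|_] := eqVneq y 0; last exact: ler0n.
  by have -> : x = 0; [apply/eqP; rewrite eq_le x0 -y0 xy|rewrite eqxx].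
- move=> c x y z c0 x0 /andP[xy yz].
  have z0 : 0 < z by rewrite (le_lt_trans x0) // (lt_trans xy).
  by rewrite (gt_eqF z0) mulr0 ge_min mulr_ge0 ?orbT ?expR_ge0 // ler0n.
Qed.

(** For growth rates exceeding the slope of the tilt this is the quasiconcavity of
[g]; for smaller ones the product is nonincreasing. *)
Lemma profile_tilt x g : 0 <= x <= 1 -> profile g -> profile (tilt x g).
Proof.
move=> /andP[x0 x1] [g0 g_ge0 g_ni Q]; split.
- by rewrite /tilt powRr0 mul1r.
- by move=> t t0; rewrite mulr_ge0 ?powR_ge0 ?g_ge0.
- move=> t u /andP[t0 tu].
  apply: ler_pM; rewrite ?powR_ge0 ?g_ge0 ?(le_trans t0 tu) ?g_ni ?t0 //.
  have [->|x1'] := eqVneq x 1.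
    rewrite subrr /powR eqxx; have [u0|_] := eqVneq u 0; last exact: ler0n.
    by have -> : t = 0; [apply/eqP; rewrite eq_le t0 -u0 tu|rewrite eqxx].
  by apply: ger_powR => //; rewrite subr_gt0 lt_neqAle x1' x1 gerBl.
have [->|x1'] := eqVneq x 1.
  move=> c a y z c0 a0 /andP[ay yz].
  have y0 : 0 < y by exact: le_lt_trans ay.
  by rewrite (tilt1 _ y0) (tilt1 _ (lt_trans y0 yz)) !mulr0 ge_min lexx orbT.
move=> c a y z c0 a0 ayz; have {}x1' : x < 1 by rewrite lt_neqAle x1' x1.
rewrite !tiltE // !mulrA -!expRD -!mulrDl.
have [cl|cl] := leP 0 (c + ln (1 - x)); first exact: Q.
have /andP[ay yz] := ayz; rewrite ge_min; apply/orP; right.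
apply: ler_pM; rewrite ?expR_ge0 //.
- by rewrite g_ge0 // (le_trans a0) // ltW // (lt_trans ay).
- by rewrite ler_expR ler_wnM2l // ltW.
- by rewrite g_ni // (ltW yz) andbT (le_trans a0) // ltW.
Qed.

Lemma profile_delay x g : 0 <= x <= 1 -> profile g -> profile (delay x g).
Proof.
move=> /andP[x0 x1] pg; have [g0 g_ge0 g_ni Q] := pg.
have [->|x1'] := eqVneq x 1.
  have -> : delay 1 g = cst 1 by apply: funext => t; exact: delay1.
  exact: profile_cst1.
have {x1}x01 : 0 <= x < 1 by rewrite x0 lt_neqAle x1' x1.
pose d := x / (1 - x); have d0 : 0 <= d := delay_ge0 x01.
have E t : delay x g t = if t <= d then 1 else g (t - d) by exact: delayE.
have d_ge0 t : 0 <= t -> 0 <= delay x g t.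
  move=> t0; rewrite E; case: (leP t d) => // dt.
  by rewrite g_ge0 // subr_ge0 ltW.
have ni t u : 0 <= t <= u -> delay x g u <= delay x g t.
  move=> /andP[t0 tu]; rewrite !E; have [ud|du] := leP u d.
    by rewrite (le_trans tu ud).
  have [_|dt] := leP t d; first by rewrite profile_le1 // subr_ge0 ltW.
  by rewrite g_ni // subr_ge0 lerD2r tu ltW.
split=> //; first by rewrite E d0.
move=> c a y z c0 a0 /andP[ay yz].
have [yd|dy] := leP y d.
  rewrite !E yd (le_trans (ltW ay) yd) !mulr1 ge_min ler_expR.
  by rewrite ler_wpM2l // ltW.
have dz := lt_trans dy yz.
have [ad|da] := leP a d; last first.
  rewrite !E (lt_geF da) (lt_geF dy) (lt_geF dz).
  have := Q c (a - d) (y - d) (z - d) c0; rewrite subr_ge0 (ltW da) !ltrD2r ay yz.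
  move=> /(_ isT isT); rewrite !mulrBr !expRB.
  rewrite ![_ / expR (c * d) * _]mulrAC -minr_pMl ?invr_ge0 ?expR_ge0 //.
  by rewrite ler_pM2r // invr_gt0 expR_gt0.
rewrite !E ad (lt_geF dy) (lt_geF dz) mulr1.
have := Q c 0 (y - d) (z - d) c0 (lexx 0); rewrite subr_gt0 dy ltrD2r yz.
move=> /(_ isT); rewrite mulr0 expR0 g0 mul1r !mulrBr !expRB.
rewrite ![_ / expR (c * d) * _]mulrAC.
rewrite -{1}(@divff _ (expR (c * d))) ?gt_eqF ?expR_gt0 //.
rewrite -minr_pMl ?invr_ge0 ?expR_ge0 // ler_pM2r ?invr_gt0 ?expR_gt0 //.
apply: le_trans; rewrite le_min ge_min; apply/andP; split.
  by rewrite ler_expR ler_wpM2l.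
by rewrite ge_min lexx orbT.
Qed.

Lemma profile_step e x g : 0 <= x <= 1 -> profile g -> profile (step e x g).
Proof. by case: e => /=; [exact: profile_tilt|exact: profile_delay]. Qed.

Lemma profile_steps (l : seq (bool * R)) g :
  all (fun ex => 0 <= ex.2 <= 1) l -> profile g -> profile (steps l g).
Proof.
by move=> + pg; elim: l => [|[e x] l IH] //= /andP[? /IH]; exact: profile_step.
Qed.

Lemma profile_sim n e th : unit_param th -> profile (sim n e th).
Proof.
elim: n e th => [|n IH] e th uth /=.
  by case: e; [exact: profile_point|exact: profile_cst1].
by apply: profile_step => //; apply: IH => i; exact: uth.
Qed.

Lemma sign_changes_cst k s u D : (forall t, u < t -> 0 <= s * D t) ->
  sign_changes k s u D.
Proof. by case: k => [|k] H; left. Qed.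

Lemma sign_changes_cons k s u v D : u <= v ->
  (forall t, u < t < v -> 0 <= s * D t) -> sign_changes k (- s) v D ->
  sign_changes k.+1 s u D.
Proof. by move=> uv H C; right; exists v. Qed.

Lemma sign_changes_weaken k l s u D : (k <= l)%N ->
  sign_changes k s u D -> sign_changes l s u D.
Proof.
elim: k l s u => [|k IH] l s u /=; first by move=> _ [H|//]; exact: sign_changes_cst.
case: l => // l kl [H|[v [uv H C]]]; first exact: sign_changes_cst.
by apply: sign_changes_cons uv H _; exact: IH.
Qed.

Lemma sign_changes_mul k s u D D' :
  (forall t, u < t -> exists2 w, 0 <= w & D t = w * D' t) ->
  sign_changes k s u D' -> sign_changes k s u D.
Proof.
elim: k s u => [|k IH] s u DD' /=.
  move=> [H|//]; left => t ut; have [w w0 ->] := DD' t ut.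
  by rewrite mulrCA mulr_ge0 ?H.
move=> [H|[v [uv H C]]].
  left => t ut; have [w w0 ->] := DD' t ut.
  by rewrite mulrCA mulr_ge0 ?H.
right; exists v; split=> //.
  move=> t utv; have [w w0 ->] := DD' t (andP utv).1.
  by rewrite mulrCA mulr_ge0 ?H.
by apply: IH C => t vt; apply: DD'; exact: le_lt_trans vt.
Qed.

Lemma sign_changes_shift d k s u D : sign_changes k s u D ->
  sign_changes k s (u + d) (fun t => D (t - d)).
Proof.
elim: k s u => [|k IH] s u /=.
  by move=> [H|//]; left => t udt; apply: H; rewrite ltrBrDr.
move=> [H|[v [uv H C]]].
  by left => t udt; apply: H; rewrite ltrBrDr.
right; exists (v + d); split; first by rewrite lerD2r.
  by move=> t tuv; apply: H; rewrite ltrBrDr ltrBlDr.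
exact: IH.
Qed.

(** No change is spent on the interval from [u] to [v] if the sign there is the one
that comes next. *)
Lemma sign_changes_extend k s u v D : u <= v ->
  (forall t, u < t <= v -> 0 <= s * D t) -> sign_changes k s v D ->
  sign_changes k s u D.
Proof.
move=> uv H; case: k => [|k] /=.
  move=> [H'|//]; left => t ut; have [tv|vt] := leP t v; last exact: H'.
  by apply: H; rewrite ut.
move=> [H'|[w [vw H' C]]].
  left => t ut; have [tv|vt] := leP t v; last exact: H'.
  by apply: H; rewrite ut.
right; exists w; split=> //; first exact: le_trans vw.
move=> t /andP[ut tw]; have [tv|vt] := leP t v; last by apply: H'; rewrite vt.
by apply: H; rewrite ut.
Qed.

Arguments sign_changes : simpl never.

Lemma quasiconcave_ge1 F x y z : tilt_quasiconcave F -> 0 <= x ->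
  x <= y <= z -> 1 <= F x -> 1 <= F z -> 1 <= F y.
Proof.
move=> Q x0 /andP[]; rewrite le_eqVlt => /predU1P[->//|xy].
rewrite le_eqVlt => /predU1P[->//|yz] Fx Fz.
have := Q 0 x y z (lexx 0) x0; rewrite xy yz => /(_ isT).
rewrite !mul0r expR0 !mul1r; apply: le_trans.
by rewrite le_min Fx.
Qed.

(** The set where [1 <= F] is an interval. *)
Lemma quasiconcave_fall F a : tilt_quasiconcave F -> 0 <= a -> 1 <= F a ->
  (forall t, a < t -> 1 <= F t) \/
  exists v, [/\ a <= v, forall t, a < t < v -> 1 <= F t
                      & forall t, v < t -> F t < 1].
Proof.
move=> Q a0 Fa; pose S := [set t | a <= t /\ 1 <= F t].
have Sa : S a by split.
have below s t : S s -> a < t -> t < s -> 1 <= F t.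
  by move=> [_ Fs] a_t ts; apply: (quasiconcave_ge1 Q a0 _ Fa Fs); rewrite !ltW.
have [bS|nbS] := pselect (has_ubound S).
  have hS : has_sup S by split=> //; exists a.
  have aS : a <= sup S by exact: (sup_upper_bound hS).
  right; exists (sup S); split=> //.
  - move=> t /andP[a_t] /(sup_gt hS.1)[s Ss ts]; exact: below Ss a_t ts.
  - move=> t St; rewrite ltNge; apply/negP => Ft.
    have : t <= sup S.
      by apply: (sup_upper_bound hS); split=> //; exact: le_trans aS (ltW St).
    by rewrite leNgt St.
left => t a_t; rewrite leNgt; apply/negP => Ft; apply: nbS; exists t => s Ss.
rewrite leNgt; apply/negP => ts; move: Ft.
by rewrite ltNge (below s).
Qed.

Lemma quasiconcave_rise F t0 : tilt_quasiconcave F -> 0 <= t0 -> 1 <= F t0 ->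
  exists v, [/\ 0 <= v <= t0, forall t, 0 < t < v -> F t < 1
                      & forall t, v < t <= t0 -> 1 <= F t].
Proof.
move=> Q t00 Ft0; pose S := [set t | 0 <= t /\ 1 <= F t].
have St0 : S t0 by split.
have hS : has_inf S by split; [exists t0|exists 0 => t []].
exists (inf S); split.
- apply/andP; split; first by apply: lb_le_inf; [exists t0|move=> t []].
  exact: (inf_lbound hS.2).
- move=> t /andP[t0' tS]; rewrite ltNge; apply/negP => Ft.
  move: tS; rewrite ltNge; apply/negP; rewrite negbK.
  by apply: (inf_lbound hS.2); split=> //; exact: ltW.
- move=> t /andP[/(inf_lt hS.1)[s [s0 Fs] st] tt0].
  by apply: (quasiconcave_ge1 Q s0 _ Fs Ft0); rewrite (ltW st).
Qed.

Lemma sign_changes_rise k F D t0 : tilt_quasiconcave F -> 0 <= t0 ->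
  1 <= F t0 -> (forall t, 0 < t <= t0 -> D t = F t - 1) ->
  sign_changes k 1 t0 D -> sign_changes k.+1 (-1) 0 D.
Proof.
move=> Q t00 Ft0 DE C.
have [v [/andP[v0 vt0] lt_v ge_v]] := quasiconcave_rise Q t00 Ft0.
apply: (sign_changes_cons v0).
  move=> t /andP[t_0 tv]; rewrite DE ?t_0 ?(le_trans (ltW tv)) //.
  by rewrite mulN1r oppr_ge0 subr_le0 ltW // lt_v // t_0.
rewrite opprK; apply: sign_changes_extend vt0 _ C.
move=> t /andP[vt tt0]; have t_0 : 0 < t := le_lt_trans v0 vt.
rewrite DE ?t_0 // mul1r subr_ge0.
by rewrite ge_v // vt.
Qed.

Lemma sign_changes_cst1_ge F t0 : tilt_quasiconcave F -> 0 <= t0 ->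
  1 <= F t0 -> sign_changes 1 1 t0 (fun t => F t - 1).
Proof.
move=> Q t00 Ft0; have [H|[v [tv ge_v lt_v]]] := quasiconcave_fall Q t00 Ft0.
  by apply: sign_changes_cst => t /H; rewrite mul1r subr_ge0.
apply: sign_changes_cons tv _ _.
  by move=> t /ge_v; rewrite mul1r subr_ge0.
by apply: sign_changes_cst => t /lt_v ?; rewrite mulN1r oppr_ge0 subr_le0 ltW.
Qed.

Lemma sign_changes_cst1_le F : tilt_quasiconcave F ->
  sign_changes 2 (-1) 0 (fun t => F t - 1).
Proof.
move=> Q; have [[t0 [t00 Ft0]]|nF] := pselect (exists t0, 0 <= t0 /\ 1 <= F t0).
  by apply: (sign_changes_rise Q t00 Ft0) => //; exact: sign_changes_cst1_ge.
apply: sign_changes_cst => t t0; rewrite mulN1r oppr_ge0 subr_le0 leNgt.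
by apply/negP => /ltW Ft; apply: nF; exists t; rewrite ltW.
Qed.

(** The operations that build [sim n e th] are undone one after the other. Undoing a
tilt multiplies both functions by a growing exponential, and undoing a delay
shifts them; both preserve quasiconcavity of [F], but a shift may destroy the
condition [1 <= F 0]. During a plateau [F] is compared with the constant 1, and
since [1 <= F] holds on an interval, [F - 1] changes sign at most twice there:
each delay costs two changes at most, and a start below 1 costs one. Hence the
two statements, which are proved together. *)
Lemma sim_sign_changes n e th F : unit_param th ->
  (forall t, 0 <= t -> 0 <= F t) -> tilt_quasiconcave F ->
  let m := if e then n else n.+1 in
  (1 <= F 0 -> sign_changes m 1 0 (fun t => F t - sim n e th t)) /\
  sign_changes m.+1 (-1) 0 (fun t => F t - sim n e th t).
Proof.
elim: n e th F => [|n IH] e th F uth F_ge0 Q /=.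
  case: e => /=; last first.
    by split=> [F0|]; [exact: sign_changes_cst1_ge|exact: sign_changes_cst1_le].
  have H t : 0 < t -> 0 <= 1 * (F t - (t == 0)%:R).
    by move=> t0; rewrite mul1r (gt_eqF t0) subr0 F_ge0 // ltW.
  split=> [_|]; first exact: sign_changes_cst.
  apply: (@sign_changes_cons _ _ _ 0) => //.
    by move=> t /andP[t0 /ltW]; rewrite leNgt t0.
  by rewrite opprK; exact: sign_changes_cst.
set x := th 0%N; set th' := fun i => th i.+1.
have uth' : unit_param th' by move=> i; exact: uth.
have /andP[x0] : 0 <= x <= 1 by exact: uth.
rewrite le_eqVlt => /predU1P[x1|x1].
  rewrite x1; case: e => /=; last first.
    have -> : (fun t => F t - delay 1 (sim n true th') t) = (fun t => F t - 1).
      by apply: funext => t; rewrite delay1.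
    split=> [F0|].
      by apply: (@sign_changes_weaken 1) => //; exact: sign_changes_cst1_ge.
    by apply: (@sign_changes_weaken 2) => //; exact: sign_changes_cst1_le.
  have H t : 0 < t -> 0 <= 1 * (F t - tilt 1 (sim n false th') t).
    by move=> t0; rewrite mul1r tilt1 // subr0 F_ge0 // ltW.
  split=> [_|]; first exact: sign_changes_cst.
  apply: (@sign_changes_cons _ _ _ 0) => //.
    by move=> t /andP[t0 /ltW]; rewrite leNgt t0.
  by rewrite opprK; exact: sign_changes_cst.
have x01 : 0 <= x < 1 by rewrite x0.
case: e => /=.
  pose c := - ln (1 - x); have c0 : 0 <= c by rewrite oppr_ge0 ln1x_le0.
  pose G t := expR (c * t) * F t.
  have G_ge0 t : 0 <= t -> 0 <= G t by move=> t0; rewrite mulr_ge0 ?expR_ge0 ?F_ge0.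
  have DE t : 0 < t -> exists2 w, 0 <= w &
      F t - tilt x (sim n false th') t = w * (G t - sim n false th' t).
    move=> t0; exists (expR (ln (1 - x) * t)); first exact: expR_ge0.
    rewrite tiltE // mulrBr /G mulrA -expRD /c mulNr subrr expR0 mul1r.
    by [].
  have [H1 H2] := IH false th' G uth' G_ge0 (tilt_quasiconcave_tilt c0 Q).
  split=> [F0|]; apply: sign_changes_mul DE _; last exact: H2.
  by apply: H1; rewrite /G mulr0 expR0 mul1r.
pose d := x / (1 - x); have d0 : 0 <= d := delay_ge0 x01.
have E t : delay x (sim n true th') t = if t <= d then 1 else sim n true th' (t - d).
  exact: delayE.
set D := fun t => _ - _.
have DE t : t <= d -> D t = F t - 1 by rewrite /D E => ->.
have [|H1 H2] := IH true th' (fun t => F (d + t)) uth' _ (tilt_quasiconcave_shift d0 Q).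
  by move=> t t0; apply: F_ge0; exact: addr_ge0.
have shiftD k s : sign_changes k s 0 (fun t => F (d + t) - sim n true th' t) ->
    sign_changes k s d D.
  move=> /(sign_changes_shift d); rewrite add0r; apply: sign_changes_mul => t dt.
  exists 1 => //; rewrite mul1r /D E (lt_geF dt).
  by rewrite [d + _]addrC subrK.
rewrite addr0 in H1.
have ge_case t0 : 0 <= t0 -> t0 <= d -> 1 <= F t0 -> sign_changes n.+2 1 t0 D.
  move=> t00 t0d Ft0; have [Fd|Fd] := leP 1 (F d).
    apply: (@sign_changes_weaken n); first by rewrite leqW.
    apply: sign_changes_extend t0d _ (shiftD _ _ (H1 Fd)).
    move=> t /andP[tt0 td]; rewrite DE // mul1r subr_ge0.
    by apply: (quasiconcave_ge1 Q t00 _ Ft0 Fd); rewrite td ltW.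
  have [H|[v [t0v ge_v lt_v]]] := quasiconcave_fall Q t00 Ft0.
    move: t0d; rewrite le_eqVlt => /predU1P[t0d|/H].
      by rewrite -t0d ltNge Ft0 in Fd.
    by rewrite leNgt Fd.
  have vd : v <= d.
    rewrite leNgt; apply/negP => dv; move: Fd; rewrite ltNge => /negP; apply.
    move: t0d; rewrite le_eqVlt => /predU1P[<-//|t0d]; apply: ge_v.
    by rewrite t0d.
  apply: sign_changes_cons t0v _ _.
    move=> t /andP[t0t tv]; rewrite DE ?(le_trans (ltW tv)) // mul1r subr_ge0.
    by rewrite ge_v // t0t.
  apply: sign_changes_extend vd _ (shiftD _ _ H2).
  move=> t /andP[vt td]; rewrite DE // mulN1r oppr_ge0 subr_le0 ltW //.
  exact: lt_v.
split=> [F0|]; first exact: ge_case.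
have [[t0 [t00 t0d Ft0]]|nF] :=
    pselect (exists t0, [/\ 0 <= t0, t0 <= d & 1 <= F t0]).
  apply: (sign_changes_rise Q t00 Ft0); last exact: ge_case.
  by move=> t /andP[_ tt0]; apply: DE; exact: le_trans t0d.
apply: (@sign_changes_weaken n.+1); first exact: (leq_addl 2 n.+1).
apply: sign_changes_extend d0 _ (shiftD _ _ H2).
move=> t /andP[t0 td]; rewrite DE // mulN1r oppr_ge0 subr_le0 leNgt.
by apply/negP => /ltW Ft; apply: nF; exists t; rewrite ltW.
Qed.

(** A profile is at most 1, so that it stays below the first plateau of a simple
function; this saves one of the changes allowed by the previous lemma when the
first operation is a delay. *)
Lemma profile_sim_sign_changes n e th g : unit_param th -> profile g ->
  sign_changes n (if e then 1 else -1) 0 (fun t => g t - sim n e th t).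
Proof.
move=> uth pg; have [g0 g_ge0 g_ni Q] := pg.
case: e.
  by have [H _] := sim_sign_changes n true uth g_ge0 Q; apply: H; rewrite g0.
case: n => [|n] /=.
  apply: sign_changes_cst => t t0; rewrite mulN1r oppr_ge0 subr_le0.
  exact: profile_le1 pg (ltW t0).
set x := th 0%N; set th' := fun i => th i.+1.
have uth' : unit_param th' by move=> i; exact: uth.
have /andP[x0] : 0 <= x <= 1 by exact: uth.
rewrite le_eqVlt => /predU1P[x1|x1].
  apply: (@sign_changes_cst n.+1) => t t0.
  by rewrite x1 delay1 mulN1r oppr_ge0 subr_le0; exact: profile_le1 pg (ltW t0).
have x01 : 0 <= x < 1 by rewrite x0.
pose d := x / (1 - x); have d0 : 0 <= d := delay_ge0 x01.
have [|_ H2] := sim_sign_changes n true uth' _ (tilt_quasiconcave_shift d0 Q).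
  by move=> t t0; apply: g_ge0; exact: addr_ge0.
apply: (@sign_changes_extend n.+1 _ _ d) => //.
  move=> t /andP[t0 td]; rewrite delayE // td mulN1r oppr_ge0 subr_le0.
  exact: profile_le1 pg (ltW t0).
have := sign_changes_shift d H2; rewrite add0r.
apply: (@sign_changes_mul n.+1) => t dt; exists 1 => //.
by rewrite mul1r delayE // (lt_geF dt) [_ + (t - _)]addrC subrK.
Qed.

Lemma steps_sign_changes l k s g h : all (fun ex => 0 <= ex.2 <= 1) l ->
  sign_changes k s 0 (fun t => g t - h t) ->
  sign_changes k s 0 (fun t => steps l g t - steps l h t).
Proof.
move=> + C; elim: l => [//|[e x] l IH] /= /andP[/andP[x0 x1] /IH {IH}].
case: e => /=.
  apply: sign_changes_mul => t t0; exists ((1 - x) `^ t); first exact: powR_ge0.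
  by rewrite /tilt mulrBr.
move: x1; rewrite le_eqVlt => /predU1P[->|x1].
  by move=> _; apply: sign_changes_cst => t t0; rewrite !delay1 subrr mulr0.
have x01 : 0 <= x < 1 by rewrite x0.
move=> /(sign_changes_shift (x / (1 - x))); rewrite add0r => H.
apply: sign_changes_extend (delay_ge0 x01) _ _.
  by move=> t /andP[t0 td]; rewrite !delayE // td subrr mulr0.
apply: sign_changes_mul H => t dt; exists 1 => //.
by rewrite mul1r !delayE // leNgt dt.
Qed.

End Patterns.

Arguments sign_changes : simpl never.

(** * Extremality of simple functions *)

Section Extremality.
Variables (R : realType) (p : nat -> R).
Hypotheses (p_gt : forall i, -1 < p i) (p_inj : injective p).
Implicit Types (f g h F : R -> R) (th : nat -> R) (l : seq (bool * R)).

Definition unit_ops l := all (fun ex : bool * R => 0 <= ex.2 <= 1) l.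

(** The sign of this number says which bound [sim n e] attains for the moment of
order [n]: it comes from the first sign of a difference of profiles and from the
first sign of the generalized polynomial. *)
Definition orient n (e : bool) : R :=
  (if e then 1 else -1) * \prod_(i < n) (p i - p n).

Lemma orientN n e : orient n (~~ e) = - orient n e.
Proof. by rewrite /orient; case: e; rewrite /= !mulNr ?opprK. Qed.

Lemma orient_neq0 n e : orient n e != 0.
Proof.
rewrite mulf_neq0 //; first by case: e; rewrite ?oppr_eq0 oner_eq0.
apply/prodf_neq0 => i _; rewrite subr_eq0; apply/eqP => /p_inj E.
by have := ltn_ord i; rewrite E ltnn.
Qed.

Lemma step_le e x g h : 0 <= x <= 1 -> (forall t, 0 <= t -> g t <= h t) ->
  forall t, 0 <= t -> step e x g t <= step e x h t.
Proof.
move=> /andP[x0 x1] gh t t0; case: e => /=.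
  by rewrite ler_wpM2l ?powR_ge0 ?gh.
move: x1; rewrite le_eqVlt => /predU1P[->|x1]; first by rewrite !delay1.
rewrite !delayE ?x0 //; case: (leP t (x / (1 - x))) => // dt.
by apply: gh; rewrite subr_ge0 ltW.
Qed.

Lemma steps_le l g h : unit_ops l -> (forall t, 0 <= t -> g t <= h t) ->
  forall t, 0 <= t -> steps l g t <= steps l h t.
Proof.
by move=> + gh; elim: l => [|[e x] l IH] //= /andP[x01 /IH]; exact: step_le.
Qed.

(** Among the profiles with the same first [n] moments, simple functions minimize or
maximize the next one. The prefix [l] of further operations is what the
induction in the existence proof requires; it preserves the sign changes of the
difference, while both functions remain profiles. *)
Lemma sim_extremal n e th l g : unit_param th -> unit_ops l -> profile g ->
  (forall i, (i < n)%N ->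
     moment (p i) (steps l g) = moment (p i) (steps l (sim n e th))) ->
  (0 < orient n e ->
    (moment (p n) (steps l (sim n e th)) <= moment (p n) (steps l g))%E) /\
  (orient n e < 0 ->
    (moment (p n) (steps l g) <= moment (p n) (steps l (sim n e th)))%E).
Proof.
move=> uth ul pg meq.
have ps := profile_sim n e uth.
have pF := profile_steps ul pg; have pH := profile_steps ul ps.
(* Without constraints the extremals are the smallest and the largest profile. *)
case: n meq ps pH => [|n] meq ps pH.
  rewrite /orient big_ord0 mulr1; case: e ps pH meq => ps pH meq.
    split=> [_|]; last by rewrite ltr10.
    apply: moment_le => // t t0; apply: steps_le => //=; last exact: ltW.
    move=> u; rewrite le_eqVlt => /predU1P[<-|u0].
      by case: pg => -> _ _ _; rewrite eqxx.
    by rewrite (gt_eqF u0); case: pg => _ + _ _; apply; exact: ltW.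
  split=> [|_]; first by rewrite oppr_gt0 ltr10.
  apply: moment_le => // t t0; apply: steps_le => //=; last exact: ltW.
  by move=> u u0; exact: profile_le1.
have m0 := meq 0%N isT.
have [nF|nF] := pselect (nontrivial (steps l g));
have [nH|nH] := pselect (nontrivial (steps l (sim n.+1 e th))).
- have s0 : (if e then 1 else -1 : R) != 0 by case: (e); rewrite ?oppr_eq0 oner_eq0.
  have C := steps_sign_changes ul (profile_sim_sign_changes n.+1 e uth pg).
  have [H _] := moment_comparison p_gt p_inj pF pH nF nH s0 C meq.
  have fF := moment_fin (p_gt n.+1) pF nF.
  have fH := moment_fin (p_gt n.+1) pH nH.
  rewrite -(fineK fF) -(fineK fH) !lee_fin.
  move: H; rewrite -/(orient n.+1 e); split=> o0.
    by move: H; rewrite pmulr_rge0 // subr_ge0.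
  by move: H; rewrite nmulr_rge0 // subr_le0.
- by have := moment_fin (p_gt 0%N) pF nF; rewrite m0 (moment_trivial (p_gt _) pH nH).
- by have := moment_fin (p_gt 0%N) pH nH; rewrite -m0 (moment_trivial (p_gt _) pF nF).
- by rewrite !moment_trivial.
Qed.

(** Each of the two functions is extremal against the other, in the same direction. *)
Lemma sim_next_moment n e th th' l : unit_param th -> unit_param th' ->
  unit_ops l ->
  (forall i, (i < n)%N -> moment (p i) (steps l (sim n e th)) =
                         moment (p i) (steps l (sim n e th'))) ->
  moment (p n) (steps l (sim n e th)) = moment (p n) (steps l (sim n e th')).
Proof.
move=> uth uth' ul meq.
have [H1 H2] := sim_extremal uth' ul (profile_sim n e uth) meq.
have [H3 H4] := sim_extremal uth ul (profile_sim n e uth')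
   (fun i ik => esym (meq i ik)).
apply/eqP; rewrite eq_le.
have [lt0|gt0|eq0] := ltgtP (orient n e) 0.
- by rewrite H2 // H4.
- by rewrite H1 // H3.
- by have := orient_neq0 n e; rewrite eq0 eqxx.
Qed.

(** Joint continuity of powers at a positive exponent. At base 0 the logarithm is
not available, but there the power is at most [d `^ (t / 2)] once the base is at
most [d <= 1] and the exponent at least [t / 2]. *)
Lemma powR_cvg2 (x_ u_ : nat -> R) (x t : R) : 0 < t ->
  (forall k, 0 <= x_ k <= 1) ->
  x_ @ \oo --> x -> u_ @ \oo --> t ->
  (fun k => x_ k `^ u_ k) @ \oo --> x `^ t.
Proof.
move=> t0 x01 cx cu.
have x0 : 0 <= x.
  by apply: (cvgr_to_ge cx); apply: nearW => k; case/andP: (x01 k).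
move: x0; rewrite le_eqVlt => /predU1P[x0|x0]; last first.
  rewrite [x `^ t]/powR gt_eqF //.
  have c : (fun k => expR (u_ k * ln (x_ k))) @ \oo --> expR (t * ln x).
    apply: continuous_cvg; first exact: continuous_expR.
    apply: cvgM => //; apply: continuous_cvg => //; exact: continuous_ln.
  apply: cvg_trans c; apply: near_eq_cvg.
  near=> k; rewrite /powR gt_eqF //.
  by near: k; exact: (cvgr_gt x).
rewrite -x0 powR0 ?gt_eqF //; apply/cvgrPdist_le => eps eps0.
(* Chosen such that [d `^ (t / 2)] is the minimum of [eps] and 1. *)
pose d := Num.min eps 1 `^ (2 / t).
have m0 : 0 < Num.min eps 1 by rewrite lt_min eps0 ltr01.
have d0 : 0 < d by rewrite powR_gt0.
have d1 : d <= 1.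
  rewrite -[leRHS](powRr0 (Num.min eps 1)) ger_powR // ?m0 ?ge_min ?lexx ?orbT //.
  by rewrite divr_ge0 // ltW.
have t20 : 0 < t / 2 by rewrite divr_gt0.
near=> k.
have uk : t / 2 <= u_ k by near: k; apply: (cvgr_ge t) => //; lra.
have xk : x_ k <= d by near: k; apply: (cvgr_le x) => //; rewrite -x0.
rewrite sub0r normrN ger0_norm ?powR_ge0 //.
have /andP[xk0 _] := x01 k.
apply: (@le_trans _ _ (d `^ u_ k)).
  have u0 : 0 <= u_ k by rewrite (le_trans (ltW t20)).
  by apply: ge0_ler_powR => //; rewrite nnegrE ltW.
apply: (@le_trans _ _ (d `^ (t / 2))); first by rewrite ger_powR // d0.
have -> : d `^ (t / 2) = Num.min eps 1.
  rewrite /d -powRrM (_ : 2 / t * (t / 2) = 1) ?powRr1 ?(ltW m0) //.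
  by field; rewrite gt_eqF.
by rewrite ge_min lexx.
Unshelve. all: by end_near. Qed.

Lemma cconv_tilt (x_ : nat -> R) (x : R) (g_ : nat -> R -> R) g :
  (forall k, 0 <= x_ k <= 1) -> x_ @ \oo --> x -> cconv g_ g ->
  cconv (fun k => tilt (x_ k) (g_ k)) (tilt x g).
Proof.
move=> x01 cx [Z gZ]; exists Z => t t0 tZ u cu.
apply: cvgM; last exact: gZ.
apply: powR_cvg2 => //.
  by move=> k; have := x01 k; lra.
by apply: cvgB => //; exact: cvg_cst.
Qed.

(** The end of the plateau is added to the exceptional set, where a jump may occur;
away from it the moving point is eventually on one side. *)
Lemma cconv_delay (x_ : nat -> R) (x : R) (g_ : nat -> R -> R) g :
  (forall k, 0 <= x_ k <= 1) -> 0 <= x <= 1 -> x_ @ \oo --> x -> cconv g_ g ->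
  cconv (fun k => delay (x_ k) (g_ k)) (delay x g).
Proof.
move=> x01 /andP[x0 x1] cx [Z gZ].
have c1x : (fun k => 1 - x_ k) @ \oo --> 1 - x by apply: cvgB => //; exact: cvg_cst.
have early (t : R) (u : nat -> R) : u @ \oo --> t -> t * (1 - x) < x ->
    (fun k => delay (x_ k) (g_ k) (u k)) @ \oo --> (1 : R).
  move=> cu tx; apply: cvg_near_cst.
  have c : (fun k => x_ k - u k * (1 - x_ k)) @ \oo --> x - t * (1 - x).
    by apply: cvgB => //; apply: cvgM.
  have /cvgr_gt/(_ 0) := c; rewrite subr_gt0 => /(_ tx).
  by apply: filterS => k; rewrite subr_gt0 /delay => /ltW ->.
move: x1; rewrite le_eqVlt => /predU1P[x1|x1].
  exists [::] => t t0 _ u cu; rewrite x1 delay1; apply: (early t) => //.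
  by rewrite x1 subrr mulr0.
have x01' : 0 <= x < 1 by rewrite x0.
pose d := x / (1 - x).
exists (d :: [seq z + d | z <- Z]) => t t0; rewrite in_cons negb_or => /andP[td tZ] u cu.
rewrite delayE // -/d; have [t_d|dt] := leP t d.
  apply: (early t) => //.
  by rewrite -ltr_pdivlMr ?subr_gt0 // lt_neqAle td.
have c : (fun k => g_ k (u k - x_ k / (1 - x_ k))) @ \oo --> g (t - d).
  apply: gZ; first by rewrite subr_gt0.
    apply: contra tZ => tZ; apply/mapP; exists (t - d) => //.
    by rewrite subrK.
  apply: cvgB => //; apply: cvgM => //; apply: cvgV => //.
  by rewrite subr_eq0 gt_eqF.
apply: cvg_trans c; apply: near_eq_cvg.
have c' : (fun k => u k * (1 - x_ k) - x_ k) @ \oo --> t * (1 - x) - x.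
  by apply: cvgB => //; apply: cvgM.
have /cvgr_gt/(_ 0) := c'; rewrite subr_gt0 -ltr_pdivrMr ?subr_gt0 // => /(_ dt).
by apply: filterS => k; rewrite subr_gt0 /delay leNgt => ->.
Qed.

Lemma cconv_base e : cconv (fun=> sim 0 e (fun=> 0 : R)) (sim 0 e (fun=> 0)).
Proof.
exists [::] => t t0 _ u cu; case: e => /=; last exact: cvg_cst.
rewrite (gt_eqF t0); apply: cvg_near_cst.
have /cvgr_gt/(_ 0 t0) := cu; apply: filterS => k uk.
by rewrite (gt_eqF uk).
Qed.

Lemma cconv_step e (x_ : nat -> R) (x : R) (g_ : nat -> R -> R) g :
  (forall k, 0 <= x_ k <= 1) -> 0 <= x <= 1 -> x_ @ \oo --> x -> cconv g_ g ->
  cconv (fun k => step e (x_ k) (g_ k)) (step e x g).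
Proof. by case: e => x01 x01' cx cg; [exact: cconv_tilt|exact: cconv_delay]. Qed.

Lemma cconv_steps l (g_ : nat -> R -> R) g : unit_ops l -> cconv g_ g ->
  cconv (fun k => steps l (g_ k)) (steps l g).
Proof.
move=> + cg; elim: l => [//|[e x] l IH] /= /andP[x01 /IH].
by apply: cconv_step => //; exact: cvg_cst.
Qed.

Lemma cconv_sim n e (th_ : nat -> nat -> R) th : (forall k, unit_param (th_ k)) ->
  unit_param th -> (forall i, (i < n)%N -> (fun k => th_ k i) @ \oo --> th i) ->
  cconv (fun k => sim n e (th_ k)) (sim n e th).
Proof.
elim: n e th_ th => [|n IH] e th_ th uth_ uth cth /=.
  exact: cconv_base.
by apply: cconv_step => //; [move=> k; exact: uth_|exact: cth|
  apply: IH => [k i|i|i ni]; [exact: uth_|exact: uth|exact: cth]].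
Qed.

(** Selections are only required to satisfy [k <= sg k], which is enough to preserve
limits. *)
Lemma unit_subsequence (u : nat -> R) : (forall k, 0 <= u k <= 1) ->
  exists sg (x : R), [/\ forall k, (k <= sg k)%N, 0 <= x <= 1 & (u \o sg) @ \oo --> x].
Proof.
move=> u01.
have u_in : (u @ \oo) [set` `[(0 : R), 1]].
  by exists 0%N => // k _ /=; rewrite in_itv/= u01.
have [x [x01 clx]] := @segment_compact R 0 1 (u @ \oo) _ u_in.
have H k : exists j, (k <= j)%N /\ `|x - u j| < k.+1%:R^-1.
  have /(_ (u @` [set j | (k <= j)%N]) (ball x (k.+1%:R^-1))) := clx.
  case.
  - by exists k => // j kj; exists j.
  - by apply: nbhsx_ballx; rewrite invr_gt0.
  - by move=> _ [[j kj <-]]; exists j.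
have [sg Hsg] := choice H.
exists sg, x; split; first by move=> k; case: (Hsg k).
  by move: x01; rewrite /= in_itv.
apply/cvgrPdist_lt => eps eps0; near=> k.
have [_] := Hsg k; move=> /lt_trans; apply.
by near: k; exact: near_infty_natSinv_lt (PosNum eps0).
Unshelve. all: by end_near. Qed.

Lemma cvg_subseq (T : topologicalType) (u : nat -> T) (x : T) (sg : nat -> nat) :
  (forall k, (k <= sg k)%N) -> u @ \oo --> x -> (u \o sg) @ \oo --> x.
Proof.
move=> ksg ux; apply: cvg_comp ux => A [N _ NA]; exists N => // k /= Nk.
by apply: NA => /=; exact: leq_trans (ksg k).
Qed.

Lemma param_subsequence n (th_ : nat -> nat -> R) :
  (forall k, unit_param (th_ k)) ->
  exists sg th, [/\ forall k, (k <= sg k)%N, unit_param th &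
    forall i, (i < n)%N -> (fun k => th_ (sg k) i) @ \oo --> th i].
Proof.
move=> uth; elim: n => [|n [sg [th [ksg uth' cth]]]].
  by exists id, (fun=> 0); split=> // i; rewrite lexx ler01.
have [sg' [x [ksg' x01 cx]]] := unit_subsequence (fun k => uth (sg k) n).
exists (sg \o sg'), (fun i => if i == n then x else th i); split.
- by move=> k; apply: leq_trans (ksg' k) (ksg _).
- by move=> i; case: eqP.
move=> i; rewrite ltnS leq_eqVlt => /predU1P[->|ni]; first by rewrite eqxx.
rewrite (ltn_eqF ni); exact: (cvg_subseq ksg' (cth i ni)).
Qed.

(** Connectedness of a segment, for two sequentially closed sets that cover it. *)
Lemma segment_meet (A B : set R) (c : R) : 0 <= c ->
  (forall x, 0 <= x <= c -> A x \/ B x) ->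
  (forall (u : nat -> R) (x : R), (forall k, 0 <= u k <= c /\ A (u k)) ->
     u @ \oo --> x -> A x) ->
  (forall (u : nat -> R) (x : R), (forall k, 0 <= u k <= c /\ B (u k)) ->
     u @ \oo --> x -> B x) ->
  A 0 -> B c -> exists2 x, 0 <= x <= c & A x /\ B x.
Proof.
move=> c0 AB clA clB A0 Bc.
pose S := [set x | 0 <= x <= c /\ A x].
have S0 : S 0 by split; rewrite // lexx c0.
have hS : has_sup S by split; [exists 0|exists c => x [/andP[]]].
have s0 : 0 <= sup S by exact: (sup_upper_bound hS).
have sc : sup S <= c by apply: ge_sup; [exists 0|move=> x [/andP[]]].
have As : A (sup S).
  have H k : exists x, S x /\ sup S - k.+1%:R^-1 < x.
    have [|x Sx xs] := @sup_gt _ S (sup S - k.+1%:R^-1) hS.1.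
      by rewrite ltrBlDr ltrDl invr_gt0.
    by exists x.
  have [u Hu] := choice H.
  apply: (clA u); first by move=> k; have [[]] := Hu k.
  apply/cvgrPdist_lt => eps eps0; near=> k.
  have [Su lu] := Hu k.
  rewrite ger0_norm ?subr_ge0; last exact: (sup_upper_bound hS).
  rewrite ltrBlDl -ltrBlDr; apply: le_lt_trans lu; rewrite lerD2l lerN2 ltW //.
  by near: k; exact: near_infty_natSinv_lt (PosNum eps0).
exists (sup S); first by rewrite s0.
split=> //; move: sc; rewrite le_eqVlt => /predU1P[->//|sc].
(* Points just above the supremum of [A] belong to [B]. *)
pose u k := sup S + (c - sup S) / k.+1%:R.
have d0 : 0 < c - sup S by rewrite subr_gt0.
apply: (clB u).
  move=> k; have uc : 0 <= u k <= c.
    apply/andP; split; first by rewrite addr_ge0 // divr_ge0 // ltW.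
    rewrite -lerBrDl ler_pdivrMr // ler_peMr ?(ltW d0) //.
    by rewrite ler1n.
  split=> //; have [Au|//] := AB _ uc; exfalso.
  have : u k <= sup S by exact: (sup_upper_bound hS).
  by rewrite leNgt ltrDl divr_gt0.
rewrite -[X in _ --> X]addr0; apply: cvgD; first exact: cvg_cst.
rewrite -[X in _ --> X](mulr0 (c - sup S)); apply: cvgM; first exact: cvg_cst.
exact: cvg_harmonic.
Unshelve. all: by end_near. Qed.

Lemma step0 e g t : 0 < t -> step e 0 g t = g t.
Proof.
move=> t0; case: e => /=; first by rewrite /tilt subr0 powR1 mul1r.
by rewrite /delay subr0 mulr1 leNgt t0 mul0r subr0.
Qed.

Lemma eq_step e x g h : 0 <= x <= 1 -> (forall t, 0 < t -> g t = h t) ->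
  forall t, 0 < t -> step e x g t = step e x h t.
Proof.
move=> /andP[x0 x1] gh t t0; case: e => /=; first by rewrite /tilt gh.
move: x1; rewrite le_eqVlt => /predU1P[->|x1]; first by rewrite !delay1.
rewrite !delayE ?x0 //; case: (leP t (x / (1 - x))) => // dt.
by apply: gh; rewrite subr_gt0.
Qed.

Lemma eq_steps l g h : unit_ops l -> (forall t, 0 < t -> g t = h t) ->
  forall t, 0 < t -> steps l g t = steps l h t.
Proof.
by move=> + gh; elim: l => [|[e x] l IH] //= /andP[x01 /IH]; exact: eq_step.
Qed.

Definition scons (x : R) th (i : nat) := if i is j.+1 then th j else x.

Lemma unit_scons x th : 0 <= x <= 1 -> unit_param th -> unit_param (scons x th).
Proof. by move=> x01 uth [|i] //=. Qed.

(** A last operation with parameter 1 reproduces the base function of the other kind. *)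
Lemma sim_embed n e th : unit_param th ->
  exists th', unit_param th' /\
    forall t, 0 < t -> sim n.+1 e th' t = sim n e th t.
Proof.
elim: n e th => [|n IH] e th uth.
  exists (fun=> 1); split; first by move=> i; rewrite ler01 lexx.
  by case: e => t t0 /=; [rewrite tilt1 // (gt_eqF t0)|rewrite delay1].
have [th' [uth' E]] := IH (~~ e) (fun i => th i.+1) (fun i => uth i.+1).
exists (scons (th 0%N) th'); split; first exact: unit_scons.
move=> t t0; apply: eq_step => //; exact: uth.
Qed.

(** A first operation with parameter 0 does nothing on the open half-line. *)
Lemma sim_embed_neg n e th : unit_param th ->
  exists th', unit_param th' /\
    forall t, 0 < t -> sim n.+1 e th' t = sim n (~~ e) th t.
Proof.
move=> uth; exists (scons 0 th); split.
  by apply: unit_scons => //; rewrite lexx ler01.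
by move=> t t0; exact: step0.
Qed.

(** Tilts form a one-parameter semigroup, and so do delays: an operation can be
performed in two stages. *)
Lemma step_split e c c1 h : 0 <= c <= c1 -> c1 <= 1 ->
  exists2 c', 0 <= c' <= 1 & step e c1 h = step e c (step e c' h).
Proof.
move=> /andP[c0 cc1] c11; have [c1E|cn1] := eqVneq c 1.
  have -> : c1 = 1 by apply/eqP; rewrite eq_le c11 -c1E.
  rewrite c1E; exists 1; first by rewrite ler01 lexx.
  case: e => /=; apply: funext => t; last by rewrite !delay1.
  rewrite /tilt subrr mulrA -powRM // mul0r.
  by [].
have clt1 : c < 1 by rewrite lt_neqAle cn1 (le_trans cc1).
have c1gt0 : 0 < 1 - c by rewrite subr_gt0.
case: e => /=.
  exists (1 - (1 - c1) / (1 - c)).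
    rewrite subr_ge0 ler_pdivrMr // mul1r lerD2l lerN2 cc1 /= gerBl.
    by rewrite divr_ge0 ?subr_ge0 // ltW.
  apply: funext => t; rewrite /tilt mulrA -powRM ?(ltW c1gt0) //; last first.
    by rewrite subKr divr_ge0 ?subr_ge0 // ltW.
  by rewrite subKr mulrCA divff ?mulr1 // gt_eqF.
have c01 : 0 <= c < 1 by rewrite c0.
move: c11; rewrite le_eqVlt => /predU1P[->|c11].
  exists 1; first by rewrite ler01 lexx.
  apply: funext => t; rewrite delay1 delayE //; case: leP => // _.
  by rewrite delay1.
have c101 : 0 <= c1 < 1 by rewrite (le_trans c0).
pose d := c / (1 - c); pose d1 := c1 / (1 - c1).
have dd1 : d <= d1.
  rewrite /d /d1 ler_pdivrMr // mulrAC ler_pdivlMr ?subr_gt0 //.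
  nra.
pose d' := d1 - d; have d'0 : 0 <= d' by rewrite subr_ge0.
have d'1 : 0 < 1 + d' by rewrite ltr_pwDl.
have c'01 : 0 <= d' / (1 + d') < 1.
  by rewrite divr_ge0 // ?(ltW d'1) //= ltr_pdivrMr // mul1r ltrDr ltr01.
exists (d' / (1 + d')); first by have /andP[-> /ltW ->] := c'01.
have d'E : d' / (1 + d') / (1 - d' / (1 + d')) = d'.
  field; rewrite gt_eqF //=; apply/eqP; lra.
apply: funext => t; rewrite !delayE // d'E -/d -/d1 -[d1](subrK d) -/d'.
have [td|dt] := leP t d; first by rewrite (le_trans td) // lerDr.
by rewrite lerBlDr opprD addrA addrAC.
Qed.

End Extremality.

(** * Every moment vector comes from a simple function *)

Section Existence.
Variables (R : realType) (p : nat -> R).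
Hypotheses (p_gt : forall i, -1 < p i) (p_inj : injective p).
Implicit Types (f g h F : R -> R) (th : nat -> R) (l : seq (bool * R)).

Lemma steps_rcons l e x g : steps (rcons l (e, x)) g = steps l (step e x g).
Proof. by elim: l => [|[e' x'] l IH] //=; rewrite IH. Qed.

Lemma unit_ops_rcons l e x : unit_ops (rcons l (e, x)) = (0 <= x <= 1) && unit_ops l.
Proof. by rewrite /unit_ops all_rcons. Qed.

Lemma moment_steps_eq q l g h : unit_ops l -> (forall t, 0 < t -> g t = h t) ->
  moment q (steps l g) = moment q (steps l h).
Proof. by move=> ul gh; apply: moment_eq; exact: eq_steps. Qed.

Lemma moment_sim_cvg q l e e' n (x_ : nat -> R) (x : R) (th_ : nat -> nat -> R) th :
  -1 < q -> unit_ops l -> (forall k, 0 <= x_ k <= 1) -> 0 <= x <= 1 ->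
  (forall k, unit_param (th_ k)) -> unit_param th ->
  x_ @ \oo --> x -> (forall i, (i < n)%N -> (fun k => th_ k i) @ \oo --> th i) ->
  (fun k => moment q (steps l (step e (x_ k) (sim n e' (th_ k))))) @ \oo -->
  moment q (steps l (step e x (sim n e' th))).
Proof.
move=> q1 ul x01_ x01 uth_ uth cx cth; apply: cconv_moment => //.
- by move=> k; apply: profile_steps => //; apply: profile_step => //; exact: profile_sim.
- by apply: profile_steps => //; apply: profile_step => //; exact: profile_sim.
apply: cconv_steps => //; apply: cconv_step => //; exact: cconv_sim.
Qed.

Section Interpolate.
Variables (n : nat) (l : seq (bool * R)) (e : bool).
Hypothesis ul : unit_ops l.
Hypothesis interpolate : forall l' g, unit_ops l' -> profile g ->
  exists2 th, unit_param th & forall i, (i < n)%N ->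
    moment (p i) (steps l' (sim n (~~ e) th)) = moment (p i) (steps l' g).
Variable m : nat -> \bar R.

Let fiber (y : \bar R -> Prop) (x : R) := exists2 th, unit_param th &
  (forall i, (i < n)%N ->
    moment (p i) (steps l (step e x (sim n (~~ e) th))) = m i) /\
  y (moment (p n) (steps l (step e x (sim n (~~ e) th)))).

Let fiber_closed (y : set (\bar R)) (c : R) : c <= 1 -> closed y ->
  forall (u : nat -> R) (x : R),
  (forall k, 0 <= u k <= c /\ fiber y (u k)) -> u @ \oo --> x -> fiber y x.
Proof.
move=> c1 cly u x Hu ux.
have u01 k : 0 <= u k <= 1.
  by have [/andP[-> uc] _] := Hu k; rewrite (le_trans uc).
have x01 : 0 <= x <= 1.
  apply/andP; split.
    by apply: (cvgr_to_ge ux); apply: nearW => k; case/andP: (u01 k).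
  by apply: (cvgr_to_le ux); apply: nearW => k; case/andP: (u01 k).
have H k : exists th, [/\ unit_param th, (forall i, (i < n)%N ->
    moment (p i) (steps l (step e (u k) (sim n (~~ e) th))) = m i) &
  y (moment (p n) (steps l (step e (u k) (sim n (~~ e) th))))].
  by have [_ [th uth [? ?]]] := Hu k; exists th.
have [th_ Hth] := choice H.
have uth_ k : unit_param (th_ k) by case: (Hth k).
have [sg [th [ksg uth cth]]] := param_subsequence n uth_.
have cu := cvg_subseq ksg ux.
have cm q : -1 < q ->
    (fun k => moment q (steps l (step e (u (sg k)) (sim n (~~ e) (th_ (sg k)))))) @ \oo -->
    moment q (steps l (step e x (sim n (~~ e) th))).
  by move=> q1; apply: moment_sim_cvg.
exists th => //; split.
  move=> i ni; apply: (cvg_unique _ (cm (p i) (p_gt i))) => //.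
  apply: cvg_near_cst; apply: nearW => k.
  by have [_ E _] := Hth (sg k); exact: E.
apply: (closed_cvg y cly _ _ (cm (p n) (p_gt n))).
by apply: nearW => k; case: (Hth (sg k)).
Qed.

(** Among simple functions of order [n.+1] with first operation [e] and parameter
[x], two cases are explicit: [x = 0] gives [sim n (~~ e) th1], and some [x = c]
gives [sim n e th2]. For [x] between 0 and [c] the operation with parameter [c]
splits into the one with parameter [x] followed by another one; treating the
former as part of the prefix and interpolating the rest at order [n] shows that
every such [x] is compatible with the first [n] moments. The sets of those [x]
that allow a moment of order [n] at most [y], respectively at least [y], are
closed by compactness of the parameters, and they cover the segment from 0 to
[c], hence they meet. At a common [x] the moment of order [n] is determined by
the previous ones, so it equals [y]. *)
Lemma intermediate_moment th1 th2 y :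
  unit_param th1 -> unit_param th2 ->
  (forall i, (i < n)%N -> moment (p i) (steps l (sim n (~~ e) th1)) = m i) ->
  (forall i, (i < n)%N -> moment (p i) (steps l (sim n e th2)) = m i) ->
  ((moment (p n) (steps l (sim n (~~ e) th1)) <= y <=
    moment (p n) (steps l (sim n e th2)))%E) \/
  ((moment (p n) (steps l (sim n e th2)) <= y <=
    moment (p n) (steps l (sim n (~~ e) th1)))%E) ->
  exists2 th, unit_param th &
  (forall i, (i < n)%N -> moment (p i) (steps l (sim n.+1 e th)) = m i) /\
  moment (p n) (steps l (sim n.+1 e th)) = y.
Proof.
move=> uth1 uth2 m1 m2 yb.
have [th3 [uth3 E3]] := sim_embed n e uth2.
pose c := th3 0%N; have /andP[c0 c1] : 0 <= c <= 1 by exact: uth3.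
pose h := sim n (~~ e) (fun i => th3 i.+1).
have ph : profile h by apply: profile_sim => i; exact: uth3.
have E1 q : moment q (steps l (step e 0 (sim n (~~ e) th1))) =
           moment q (steps l (sim n (~~ e) th1)).
  by apply: moment_steps_eq => // t t0; exact: step0.
have E2 q : moment q (steps l (step e c h)) = moment q (steps l (sim n e th2)).
  by apply: moment_steps_eq.
have cover (A B : set (\bar R)) : (forall z, A z \/ B z) ->
    forall x, 0 <= x <= c -> fiber A x \/ fiber B x.
  move=> AB x xc; have [c' c'01 Ec] := step_split e h xc c1.
  have x01 : 0 <= x <= 1 by have /andP[-> xc'] := xc; rewrite (le_trans xc').
  have [|th uth Hth] := interpolate (l' := rcons l (e, x)) _ (profile_step e c'01 ph).
    by rewrite unit_ops_rcons x01.
  have mth i : (i < n)%N ->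
      moment (p i) (steps l (step e x (sim n (~~ e) th))) = m i.
    by move=> ni; have := Hth i ni; rewrite !steps_rcons -Ec E2 m2.
  by have [a|b] := AB (moment (p n) (steps l (step e x (sim n (~~ e) th))));
    [left|right]; exists th.
pose A := [set z : \bar R | (z <= y)%E]; pose B := [set z : \bar R | (y <= z)%E].
have clA : closed A by exact: closed_ereal_ge_ereal.
have clB : closed B by exact: closed_ereal_le_ereal.
have f0 (C : set (\bar R)) : C (moment (p n) (steps l (sim n (~~ e) th1))) -> fiber C 0.
  by move=> C1; exists th1 => //; split; [move=> i ni; rewrite E1 m1|rewrite E1].
have fc (C : set (\bar R)) : C (moment (p n) (steps l (sim n e th2))) -> fiber C c.
  move=> C1; exists (fun i => th3 i.+1); first by move=> i; exact: uth3.
  by split; [move=> i ni; rewrite E2 m2|rewrite E2].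
have [x xc [[ta uta [ma ya]] [tb utb [mb yb']]]] :
    exists2 x, 0 <= x <= c & fiber A x /\ fiber B x.
  case: yb => /andP[y1 y2].
    apply: (segment_meet c0); [|exact: fiber_closed|exact: fiber_closed|exact: f0|exact: fc].
    by apply: cover => z; rewrite /A/B/=; case: (leP z y) => [|/ltW]; auto.
  have [x xc [xB xA]] : exists2 x, 0 <= x <= c & fiber B x /\ fiber A x.
    apply: (segment_meet c0); [|exact: fiber_closed|exact: fiber_closed|exact: f0|exact: fc].
    by apply: cover => z; rewrite /A/B/=; case: (leP z y) => [|/ltW]; auto.
  by exists x.
have x01 : 0 <= x <= 1 by have /andP[-> xc'] := xc; rewrite (le_trans xc').
exists (scons x ta); first exact: unit_scons.
split=> //=.
have := @sim_next_moment R p p_gt p_inj n (~~ e) ta tb (rcons l (e, x)) uta utb.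
rewrite unit_ops_rcons x01 !steps_rcons => /(_ ul) Eab.
have {}Eab := Eab (fun i ni => etrans (ma i ni) (esym (mb i ni))).
apply/eqP; rewrite eq_le; apply/andP; split; first exact: ya.
by move: yb'; rewrite -Eab.
Qed.

End Interpolate.

(** The two kinds of simple functions attain opposite bounds. *)
Lemma extremal_between n e th1 th2 l g : unit_ops l -> profile g ->
  unit_param th1 -> unit_param th2 ->
  (forall i, (i < n)%N -> moment (p i) (steps l (sim n (~~ e) th1)) =
                         moment (p i) (steps l g)) ->
  (forall i, (i < n)%N -> moment (p i) (steps l (sim n e th2)) =
                         moment (p i) (steps l g)) ->
  ((moment (p n) (steps l (sim n (~~ e) th1)) <= moment (p n) (steps l g) <=
    moment (p n) (steps l (sim n e th2)))%E) \/
  ((moment (p n) (steps l (sim n e th2)) <= moment (p n) (steps l g) <=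
    moment (p n) (steps l (sim n (~~ e) th1)))%E).
Proof.
move=> ul pg uth1 uth2 m1 m2.
have [H1 H2] := sim_extremal p_gt p_inj uth1 ul pg (fun i ni => esym (m1 i ni)).
have [H3 H4] := sim_extremal p_gt p_inj uth2 ul pg (fun i ni => esym (m2 i ni)).
rewrite orientN oppr_gt0 oppr_lt0 in H1 H2.
have [lt0|gt0|eq0] := ltgtP (orient p n e) 0.
- by left; rewrite H1 // H4.
- by right; rewrite H3 // H2.
- by have := orient_neq0 p_inj n e; rewrite eq0 eqxx.
Qed.

(** The moment of order [n] of [g] lies between those of its two extremal
competitors, and simple functions of order [n.+1] reach all values in between. *)
Lemma interpolation n l e g : unit_ops l -> profile g ->
  exists2 th, unit_param th & forall i, (i < n)%N ->
    moment (p i) (steps l (sim n e th)) = moment (p i) (steps l g).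
Proof.
elim: n l e g => [|n IH] l e g ul pg.
  by exists (fun=> 0) => // i; rewrite lexx ler01.
have [th1 uth1 m1] := IH l (~~ e) g ul pg.
have [th2 uth2 m2] := IH l e g ul pg.
have [th uth [mth yth]] := intermediate_moment ul
  (fun l' g' => IH l' (~~ e) g') uth1 uth2 m1 m2
  (extremal_between ul pg uth1 uth2 m1 m2).
exists th => // i; rewrite ltnS leq_eqVlt => /predU1P[->|ni].
  exact: yth.
exact: mth.
Qed.

(** A tilt with positive slope starts strictly below 1, while a delay by a positive
length starts with a plateau. If the two extremal functions coincide, then one
of their first operations must therefore be trivial, and removing it lowers the
order. *)
Lemma coincident_extremals n th1 th2 : unit_param th1 -> unit_param th2 ->
  (forall i, (i <= n.+1)%N -> moment (p i) (sim n.+1 true th1) =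
                            moment (p i) (sim n.+1 false th2)) ->
  exists e, exists2 th, unit_param th & forall t, 0 < t ->
    sim n e th t = sim n.+1 (~~ e) (if e then th2 else th1) t.
Proof.
move=> uth1 uth2 meq.
set F := sim n.+1 true th1; set H := sim n.+1 false th2.
have pF : profile F := profile_sim _ _ uth1.
have pH : profile H := profile_sim _ _ uth2.
have [nF|nF] := pselect (nontrivial F); last first.
  exists false, (fun=> 1); first by move=> i; rewrite ler01 lexx.
  move=> t t0; have -> : sim n false (fun=> 1) t = 1.
    by case: n {th1 th2 uth1 uth2 meq F H pF pH nF} => //= n; rewrite delay1.
  apply/eqP; rewrite eq_le profile_le1 ?(ltW t0) // andbT leNgt.
  by apply/negP => Ft; apply: nF; exists t.
have nH : nontrivial H.
  apply: contrapT => nH; have := moment_fin (p_gt 0%N) pF nF.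
  by rewrite meq // (moment_trivial (p_gt _) pH nH).
have s0 : -1 != 0 :> R by rewrite oppr_eq0 oner_eq0.
have [_ eqFH] := moment_comparison p_gt p_inj pF pH nF nH s0
  (profile_sim_sign_changes n.+1 false uth2 pF) (fun i ni => meq i (ltnW ni)).
have {}eqFH := ae_eq_dense (eqFH _); rewrite meq // subrr in eqFH.
have {}eqFH := eqFH erefl.
have /andP[x0 x1] := uth1 0%N; have /andP[y0 y1] := uth2 0%N.
move: x0; rewrite le_eqVlt => /predU1P[x0|x0].
  exists false, (fun i => th1 i.+1) => [i|t t0]; first exact: uth1.
  have := step0 true (sim n false (fun i => th1 i.+1)) t0.
  by rewrite {1}x0 => <-.
move: y0; rewrite le_eqVlt => /predU1P[y0|y0].
  exists true, (fun i => th2 i.+1) => [i|t t0]; first exact: uth2.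
  have := step0 false (sim n true (fun i => th2 i.+1)) t0.
  by rewrite {1}y0 => <-.
(* Both first operations are nontrivial. *)
exfalso.
have [b b0 Hb] : exists2 b, 0 < b & forall t, 0 < t < b -> H t = 1.
  move: y1; rewrite le_eqVlt => /predU1P[y1|y1].
    by exists 1 => // t _; rewrite /H /= y1 delay1.
  exists (th2 0%N / (1 - th2 0%N)); first by rewrite divr_gt0 // subr_gt0.
  by move=> t /andP[_ /ltW tb]; rewrite /H /= delayE ?(ltW y0) // tb.
have [t /[dup] /andP[t0 _] /Hb Ht] := eqFH b b0.
rewrite Ht => /eqP; rewrite lt_eqF //.
have Gt := profile_le1 (profile_sim n false (fun i => uth1 i.+1)) (ltW t0).
rewrite /F /= /tilt; apply: (@le_lt_trans _ _ ((1 - th1 0%N) `^ t)).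
  by rewrite ler_piMr ?powR_ge0.
move: x1; rewrite le_eqVlt => /predU1P[->|x1].
  by rewrite subrr powR0 ?gt_eqF.
rewrite /powR subr_eq0 gt_eqF // -[ltRHS]expR0 ltr_expR pmulr_rlt0 //.
by rewrite ln_lt0 // subr_gt0 x1 gtrBl.
Qed.

End Existence.

(** * Profiles and even log-concave functions *)

Section LogConcaveProfiles.
Variable R : realType.
Implicit Types (f g : R -> R).

Lemma even_log_concave_profile f : even_log_concave f -> profile f.
Proof.
case=> -[V [[Vny Vcvx] fV]] fN f0.
have f_ge0 x : 0 <= f x by rewrite -lee_fin fV expeR_ge0.
have Q c x y z : x < y < z ->
    Num.min (expR (c * x) * f x) (expR (c * z) * f z) <= expR (c * y) * f y.
  move=> /andP[xy yz].
  have rhs0 : 0 <= expR (c * y) * f y by rewrite mulr_ge0 // expR_ge0.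
  have := fV x; have := fV z; have := fV y; have := Vny x; have := Vny z; have := Vny y.
  have xz : 0 < z - x by rewrite subr_gt0 (lt_trans xy).
  pose la := (z - y) / (z - x).
  have la01 : 0 <= la <= 1.
    rewrite /la divr_ge0 ?subr_ge0 ?(ltW yz) ?(ltW (lt_trans xy yz)) //=.
    rewrite ler_pdivrMr // mul1r.
    by rewrite lerD2l lerN2 ltW.
  have yE : y = la * x + (1 - la) * z.
    by rewrite /la; field; rewrite gt_eqF.
  have := Vcvx x z la la01; rewrite -yE.
  case: (V x) => [a| |//]; last first.
    move=> _ _ _ _ _ _ /= [fx]; rewrite ge_min; apply/orP; left.
    by rewrite fx mulr0.
  case: (V z) => [b| |//]; last first.
    move=> _ _ _ _ _ /= [fz] _; rewrite ge_min; apply/orP; right.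
    by rewrite fz mulr0.
  case: (V y) => [v| |//] /=; last by rewrite -!EFinM -EFinD leye_eq.
  rewrite -!EFinM -EFinD lee_fin => cvx _ _ _ [fy] [fz] [fx].
  rewrite fx fy fz -!expRD ge_min !ler_expR.
  have [H|H] := leP (c * x + - a) (c * z + - b); apply/orP; [left|right].
    have : la * (c * x - a) + (1 - la) * (c * x - a) <= la * (c * x - a) + (1 - la) * (c * z - b).
      by rewrite lerD2l ler_wpM2l // subr_ge0; case/andP: la01.
    have : c * y = la * (c * x) + (1 - la) * (c * z) by rewrite yE; ring.
    lra.
  have : la * (c * z - b) + (1 - la) * (c * z - b) <= la * (c * x - a) + (1 - la) * (c * z - b).
    rewrite lerD2r ler_wpM2l //; first by case/andP: la01.
    exact: ltW.
  have : c * y = la * (c * x) + (1 - la) * (c * z) by rewrite yE; ring.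
  lra.
split=> //; last by move=> c x y z _ _; exact: Q.
move=> x y /andP[x0]; rewrite le_eqVlt => /predU1P[->//|xy].
have := Q 0 (- y) x y; rewrite xy andbT fN !mul0r expR0 !mul1r minxx; apply.
by rewrite (lt_le_trans _ x0) // oppr_lt0 (le_lt_trans x0).
Qed.

(** Quasiconcavity is applied with the growth rate [c] that equalizes the products
with the exponential at the two end points. *)
Lemma profile_ln_concave g u w t : profile g -> 0 <= u -> 0 <= w ->
  0 < t < 1 -> 0 < g u -> 0 < g w ->
  expR (t * ln (g u) + (1 - t) * ln (g w)) <= g (t * u + (1 - t) * w).
Proof.
move=> [_ _ g_ni Q].
wlog uw : u w t / u <= w.
  move=> H u0 w0 t01 gu gw; have [uw|/ltW wu] := leP u w; first exact: H.
  have -> : t * ln (g u) + (1 - t) * ln (g w) =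
            (1 - t) * ln (g w) + (1 - (1 - t)) * ln (g u) by ring.
  have -> : t * u + (1 - t) * w = (1 - t) * w + (1 - (1 - t)) * u by ring.
  by apply: H => //; lra.
move=> u0 w0 /andP[t0 t1] gu gw; move: uw.
rewrite le_eqVlt => /predU1P[<-|uw].
  by rewrite -!mulrDl subrKC !mul1r lnK.
pose c := (ln (g u) - ln (g w)) / (w - u).
have wu0 : 0 < w - u by rewrite subr_gt0.
have c0 : 0 <= c.
  by rewrite divr_ge0 ?(ltW wu0) // subr_ge0 ler_ln // g_ni // u0 ltW.
set m := t * u + (1 - t) * w.
have umw : u < m < w.
  have -> : m = u + (1 - t) * (w - u) by rewrite /m; ring.
  rewrite ltrDl mulr_gt0 ?subr_gt0 //= -ltrBrDl.
  by rewrite gtr_pMl // gtrBl.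
have := Q c u m w c0 u0 umw.
have cwE : c * (w - u) = ln (g u) - ln (g w) by rewrite /c divfK // gt_eqF.
rewrite -{1}(lnK gu) -{1}(lnK gw) -!expRD.
have -> : c * w + ln (g w) = c * u + ln (g u).
  by rewrite -[w](subrK u) mulrDr cwE subrK; ring.
rewrite minxx => H; rewrite -(ler_pM2l (expR_gt0 (c * m))) -expRD.
apply: le_trans H; rewrite ler_expR.
have -> : c * m = c * u + (1 - t) * (c * (w - u)) by rewrite /m; ring.
by rewrite cwE; lra.
Qed.

Lemma profile_even_log_concave g f : profile g -> (forall t, f t = g `|t|) ->
  even_log_concave f.
Proof.
move=> pg fg; have [g0 g_ge0 g_ni Q] := pg; split; last by rewrite fg normr0.
  pose V x := if f x == 0 then +oo%E else (- ln (f x))%:E.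
  have f_gt0 x : f x != 0 -> 0 < f x.
    by move=> fx; rewrite lt_neqAle eq_sym fx fg g_ge0.
  exists V; split; last first.
    move=> x; rewrite /V; have [->//|fx] := eqVneq (f x) 0.
    by rewrite /= opprK lnK // posrE f_gt0.
  split; first by move=> x; rewrite /V; case: ifP.
  move=> x y t /andP[t0 t1].
  move: t0; rewrite le_eqVlt => /predU1P[<-|t0].
    by rewrite mul0e add0e mul0r add0r subr0 mul1r mul1e.
  move: t1; rewrite le_eqVlt => /predU1P[->|t1].
    by rewrite mul1r subrr mul0r addr0 mul1e mul0e adde0.
  have t1' : 0 < 1 - t by rewrite subr_gt0.
  have VN r z : 0 < r -> (r%:E * V z)%E != -oo%E.
    by move=> r0; rewrite /V; case: ifP => _; rewrite ?gt0_muley ?lte_fin // -EFinM.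
  have [fx|fx] := eqVneq (f x) 0.
    by rewrite [V x]/V fx eqxx gt0_muley ?lte_fin // addye ?leey // VN.
  have [fy|fy] := eqVneq (f y) 0.
    by rewrite [V y]/V fy eqxx gt0_muley ?lte_fin // addey ?leey // VN.
  have := f_gt0 _ fx; have := f_gt0 _ fy; rewrite !fg => gy gx.
  have := profile_ln_concave pg (normr_ge0 x) (normr_ge0 y) _ gx gy (t := t).
  rewrite t0 t1 => /(_ isT) H.
  have {}H : expR (t * ln (f x) + (1 - t) * ln (f y)) <= f (t * x + (1 - t) * y).
    rewrite !fg; apply: le_trans H _; apply: g_ni; rewrite normr_ge0 /=.
    by rewrite (le_trans (ler_normD _ _)) // !normrM (gtr0_norm t0) (gtr0_norm t1').
  have fm : 0 < f (t * x + (1 - t) * y) by apply: lt_le_trans H; exact: expR_gt0.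
  rewrite /V (negbTE fx) (negbTE fy) (gt_eqF fm) -!EFinM -EFinD lee_fin.
  rewrite !mulrN -opprD lerN2 -ler_expR; apply: le_trans H _.
  by rewrite lnK.
by move=> x; rewrite !fg normrN.
Qed.

End LogConcaveProfiles.

(** * The explicit formulas for simple functions *)

Section Formulas.
Variable R : realType.
Implicit Types (a b : nat -> \bar R) (s : bool) (t : R).

Lemma expN_ge0 (v : \bar R) : 0 <= expN v.
Proof. by rewrite /expN fine_ge0 // expeR_ge0. Qed.

Lemma expN_EFin (r : R) : expN r%:E = expR (- r).
Proof. by []. Qed.

Lemma expN_pinfty : expN (+oo%E : \bar R) = 0.
Proof. by []. Qed.

Lemma expND (u v : \bar R) : (0 <= u)%E -> (0 <= v)%E ->
  expN (u + v)%E = expN u * expN v.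
Proof.
case: u => [u| |//]; case: v => [v| |//] u0 v0.
- by rewrite /expN /= opprD expRD.
- by rewrite expN_pinfty mulr0.
- by rewrite expN_pinfty mul0r.
- by rewrite expN_pinfty mulr0.
Qed.

(** With the convention that infinity times 0 is 0, an infinite slope gives the
indicator of 0, as does the power of 0. *)
Lemma expN_mul (a : \bar R) (r : R) : (0 <= a)%E -> 0 <= r ->
  expN (a * r%:E)%E = expN a `^ r.
Proof.
case: a => [a| |//] a0 r0.
  by rewrite -EFinM !expN_EFin /powR gt_eqF ?expR_gt0 // expRK mulrN mulrC.
rewrite expN_pinfty; move: r0; rewrite le_eqVlt => /predU1P[<-|r0].
  by rewrite mule0 powRr0 expN_EFin oppr0 expR0.
by rewrite gt0_mulye ?lte_fin // expN_pinfty powR0 // gt_eqF.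
Qed.

Lemma ramp_ge0 (c : \bar R) t : (0 <= ramp c t)%E.
Proof. by rewrite /ramp le_max lexx orbT. Qed.

(** [s] tells whether the cutoff at the last knot is absent, so that the two pairs
of formulas, for even and for odd order, are each covered by one definition. *)
Definition cut s k b : \bar R := if s then +oo%E else b k.+1.
Definition fun_ramp s k a b t := expN (pot_ramp k a b t) * cutoff (cut s k b) t.
Definition fun_lin s k a b t := expN (pot_lin k a b t) * cutoff (cut s k b) t.

(** The linear term is a tilt of a function whose knots are all ramps. *)
Lemma fun_lin_tilt s k a b t : params a b ->
  fun_lin s k.+1 a b t =
  expN (a 1%N) `^ `|t| * fun_ramp s k (fun i => a i.+1) (fun i => b i.+1) t.
Proof.
move=> pab; have [a0 b0 nb] := pab.
rewrite /fun_lin /fun_ramp /pot_lin /pot_ramp big_add1 /= expND.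
- by rewrite expN_mul // mulrA; case: s.
- by rewrite mule_ge0.
- by apply: sume_ge0 => i _; rewrite mule_ge0 // ramp_ge0.
Qed.

Lemma ramp_le (c : \bar R) t : (`|t|%:E <= c)%E -> ramp c t = 0%E.
Proof.
case: c => [c| |//]; rewrite /ramp.
  rewrite lee_fin => tc; apply/max_idPr.
  by rewrite -EFinB lee_fin subr_le0.
by move=> _; rewrite /= maxNye.
Qed.

Lemma fun_ramp_le s k a b t : params a b -> (`|t|%:E <= b 1%N)%E ->
  fun_ramp s k a b t = 1.
Proof.
move=> [a0 b0 nb] tb; rewrite /fun_ramp /pot_ramp big_nat big1 => [|i /andP[i0 _]].
  rewrite expN_EFin oppr0 expR0 mul1r /cutoff /cut; case: s; first by rewrite leey.
  by rewrite (le_trans tb) // nb.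
by rewrite ramp_le ?mule0 // (le_trans tb) // nb.
Qed.

Lemma ramp_shift (c : \bar R) (d t : R) : 0 <= d < `|t| ->
  ramp c t = ramp (c - d%:E)%E (`|t| - d).
Proof.
move=> /andP[d0 dt]; rewrite /ramp [in RHS]ger0_norm ?subr_ge0 ?(ltW dt) //.
by case: c => [c| |] //=; rewrite -?EFinB; congr (maxe _%:E _); ring.
Qed.

(** Truncated at 0 so that the knots that do not occur in the formula still satisfy
the requirements on parameters. *)
Definition sub_knots b (d : R) i : \bar R := maxe (b i - d%:E)%E 0%E.

Lemma sub_knotsE a b d i : params a b -> b 1%N = d%:E -> (0 < i)%N ->
  sub_knots b d i = (b i - d%:E)%E.
Proof.
move=> [_ _ nb] b1 i0; apply/max_idPl; rewrite leeBrDr // add0e -b1.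
exact: nb.
Qed.

(** Beyond the plateau that ends at the first knot [d], the first ramp becomes
linear in [`|t| - d] and all other knots move by [d]. *)
Lemma fun_ramp_gt s k a b (d t : R) : params a b -> b 1%N = d%:E -> 0 <= d < `|t| ->
  (0 < k)%N ->
  fun_ramp s k a b t = fun_lin s k a (sub_knots b d) (`|t| - d).
Proof.
move=> pab b1 dt k0; have [a0 b0 nb] := pab.
have td : 0 <= `|t| - d by rewrite subr_ge0 ltW //; case/andP: dt.
rewrite /fun_ramp /fun_lin; congr (expN _ * _).
  rewrite /pot_ramp /pot_lin big_ltn // b1; congr (_ + _)%E.
    congr (_ * _)%E; rewrite /ramp (ger0_norm td); apply/max_idPl.
    by rewrite -EFinB lee_fin.
  apply: eq_big_nat => i /andP[i1 _].
  by rewrite (sub_knotsE pab b1) ?(ltn_trans _ i1) // -ramp_shift.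
rewrite /cutoff /cut; case: s; first by rewrite !leey.
rewrite (sub_knotsE pab b1) // (ger0_norm td) EFinB.
case: (b k.+1) (b0 k.+1) => [c| |//] _ /=; last by rewrite !leey.
by rewrite -!EFinB !lee_fin lerD2r.
Qed.

Definition is_sim n e (f : R -> R) :=
  exists2 th : nat -> R, unit_param th & forall t, f t = sim n e th `|t|.

Lemma params_shift a b : params a b ->
  params (fun i => a i.+1) (fun i => b i.+1).
Proof. by move=> [a0 b0 nb]; split=> // i j ij; apply: nb. Qed.

Lemma is_sim_lin s k a b n : params a b ->
  is_sim n false (fun_ramp s k (fun i => a i.+1) (fun i => b i.+1)) ->
  is_sim n.+1 true (fun_lin s k.+1 a b).
Proof.
move=> pab [th uth E]; have [a0 _ _] := pab.
have x01 : 0 <= 1 - expN (a 1%N) <= 1.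
  rewrite gerBl expN_ge0 andbT subr_ge0.
  case: (a 1%N) (a0 1%N) => [r| |//]; last by rewrite expN_pinfty ler01.
  by rewrite lee_fin => r0; rewrite expN_EFin -expR0 ler_expR oppr_le0.
exists (scons (1 - expN (a 1%N)) th); first exact: unit_scons.
by move=> t; rewrite fun_lin_tilt // E /= /tilt subKr.
Qed.

Lemma is_sim_const n : is_sim n false (cst 1).
Proof.
case: n => [|n]; first by exists (fun=> 1) => // i; rewrite ler01 lexx.
exists (fun=> 1) => [i|t /=]; first by rewrite ler01 lexx.
by rewrite delay1.
Qed.

(** A delay by the length [d] has the parameter [d / (1 + d)]. *)
Lemma delay_frac (d : R) : 0 <= d ->
  0 <= d / (1 + d) < 1 /\ d / (1 + d) / (1 - d / (1 + d)) = d.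
Proof.
move=> d0; have d1 : 0 < 1 + d by rewrite ltr_pwDl.
split; first by rewrite divr_ge0 // ?(ltW d1) //= ltr_pdivrMr // mul1r ltrDr.
by field; rewrite gt_eqF //=; apply/eqP; lra.
Qed.

Lemma is_sim_ramp s k a b n : params a b ->
  (forall d : R, b 1%N = d%:E -> exists2 th : nat -> R, unit_param th &
    forall t, d < `|t| -> fun_ramp s k a b t = sim n true th (`|t| - d)) ->
  is_sim n.+1 false (fun_ramp s k a b).
Proof.
move=> pab H; have [_ b0 nb] := pab.
case b1 : (b 1%N) (b0 1%N) => [d| |//] d0; last first.
  have [th uth E] := is_sim_const n.+1; exists th => // t.
  by rewrite fun_ramp_le ?b1 ?leey // -(E t).
have [th uth E] := H d b1.
have [x01 xd] := delay_frac d0.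
exists (scons (d / (1 + d)) th).
  by apply: unit_scons => //; have /andP[-> /ltW ->] := x01.
move=> t /=; rewrite delayE // xd; case: (leP `|t| d) => [td|/E//].
by rewrite fun_ramp_le // b1 lee_fin.
Qed.

Lemma params_sub a b (d : R) : params a b -> params a (sub_knots b d).
Proof.
move=> [a0 b0 nb]; split=> // [i|i j ij]; first by rewrite le_max lexx orbT.
rewrite /sub_knots ge_max !le_max lexx !orbT andbT; apply/orP; left.
by rewrite leeD2r // nb.
Qed.

(** A formula without linear term starts with a plateau that ends at the first knot,
and one with linear term starts with a tilt; stripping them alternately ends
with the constant 1, or with a cutoff, which is a delayed indicator of 0. *)
Lemma formula_is_sim s k a b : params a b ->
  is_sim (k.*2 + ~~ s) false (fun_ramp s k a b) /\
  is_sim (k.*2 + ~~ s).+1 true (fun_lin s k.+1 a b).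
Proof.
have lin_of_ramp k' : (forall a b, params a b ->
      is_sim (k'.*2 + ~~ s) false (fun_ramp s k' a b)) ->
    forall a b, params a b ->
    is_sim (k'.*2 + ~~ s) false (fun_ramp s k' a b) /\
    is_sim (k'.*2 + ~~ s).+1 true (fun_lin s k'.+1 a b).
  move=> H a' b' pab; split; first exact: H.
  by apply: is_sim_lin => //; apply: H; exact: params_shift.
elim: k a b => [|k IH]; apply: lin_of_ramp => a b pab.
  case: s; rewrite /= double0 add0n.
    have [th uth E] := is_sim_const 0; exists th => // t.
    rewrite /fun_ramp /pot_ramp big_geq // expN_EFin oppr0 expR0 mul1r.
    by rewrite -(E t) /cutoff /= leey.
  apply: is_sim_ramp => // d b1; exists (fun=> 0) => [i|t dt].
    by rewrite lexx ler01.
  rewrite /fun_ramp /cutoff /cut b1 lee_fin leNgt dt mulr0 /= subr_eq0.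
  by rewrite gt_eqF.
rewrite doubleS !addSn; apply: is_sim_ramp => // d b1.
have [th uth E] := (IH a _ (params_sub d pab)).2; exists th => // t dt.
have d0 : 0 <= d by have [_ + _] := pab => /(_ 1%N); rewrite b1.
rewrite (fun_ramp_gt _ pab b1) ?d0 // E ger0_norm // subr_ge0 ltW //.
Qed.

Lemma eq_fun_ramp s k a b a' b' t : (forall i, a i.+1 = a' i.+1) ->
  (forall i, b i.+1 = b' i.+1) -> fun_ramp s k a b t = fun_ramp s k a' b' t.
Proof.
move=> ea eb; rewrite /fun_ramp /cut eb; congr (expN _ * _).
by apply: eq_big_nat => -[//|i] _; rewrite ea eb.
Qed.

Lemma eq_fun_lin s k a b b' t : (0 < k)%N ->
  (forall i, b i.+2 = b' i.+2) -> fun_lin s k a b t = fun_lin s k a b' t.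
Proof.
case: k => // k _ eb; rewrite /fun_lin /cut eb; congr (expN (_ + _)%E * _).
by apply: eq_big_nat => -[|[|i]] //= _; rewrite eb.
Qed.

(** The converse of the previous construction, whose parameters are accumulated from
the innermost operation outwards. An infinite delay is realized by infinite
knots. *)
Lemma sim_is_formula s k th : unit_param th ->
  (exists a b, params a b /\
     forall t, sim (k.*2 + ~~ s) false th `|t| = fun_ramp s k a b t) /\
  (exists a b, params a b /\
     forall t, sim (k.*2 + ~~ s).+1 true th `|t| = fun_lin s k.+1 a b t).
Proof.
have lin_of_ramp k' : (forall th, unit_param th -> exists a b, params a b /\
      forall t, sim (k'.*2 + ~~ s) false th `|t| = fun_ramp s k' a b t) ->
    forall th, unit_param th ->
    (exists a b, params a b /\
     forall t, sim (k'.*2 + ~~ s) false th `|t| = fun_ramp s k' a b t) /\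
    (exists a b, params a b /\
     forall t, sim (k'.*2 + ~~ s).+1 true th `|t| = fun_lin s k'.+1 a b t).
  move=> H {}th uth; split; first exact: H.
  have [a [b [[a0 b0 nb] E]]] := H (fun i => th i.+1) (fun i => uth i.+1).
  have /andP[x0 x1] := uth 0%N.
  have [al [al0 alE]] : exists al : \bar R, (0 <= al)%E /\ expN al = 1 - th 0%N.
    move: x1; rewrite le_eqVlt => /predU1P[->|x1].
      by exists +oo%E; rewrite expN_pinfty subrr.
    exists (- ln (1 - th 0%N))%:E; rewrite lee_fin oppr_ge0 ln1x_le0 ?x0 //.
    by rewrite expN_EFin opprK lnK // posrE subr_gt0.
  pose a' i := if i is j.+2 then a j.+1 else al.
  pose b' i := if i is j.+2 then b j.+1 else 0%E.
  have pab : params a' b'.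
    split; [by case=> [|[|i]] //=|by case=> [|[|i]] //=|].
    by move=> [|[|i]] [|[|j]] //= ij; exact: nb.
  exists a', b'; split=> // t; rewrite fun_lin_tilt //= alE /tilt E.
  by congr (_ * _); exact: eq_fun_ramp.
elim: k th => [|k IH]; apply: lin_of_ramp => th uth;
  have /andP[x0] := uth 0%N; rewrite le_eqVlt => /predU1P[x1|x1].
- exists (fun=> 0%E), (fun=> +oo%E); split; first by split.
  move=> t; rewrite fun_ramp_le ?leey //.
  by case: s => //=; rewrite x1 delay1.
- case: s => /=.
    exists (fun=> 0%E), (fun=> +oo%E); split; first by split.
    by move=> t; rewrite fun_ramp_le ?leey.
  pose d := th 0%N / (1 - th 0%N).
  have d0 : 0 <= d by apply: delay_ge0; rewrite x0.
  exists (fun=> 0%E), (fun=> d%:E); split; first by split.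
  move=> t; rewrite delayE ?x0 // -/d; case: leP => td.
    by rewrite fun_ramp_le // lee_fin.
  rewrite /fun_ramp /cutoff /cut lee_fin leNgt td mulr0 subr_eq0.
  by rewrite gt_eqF.
- exists (fun=> 0%E), (fun=> +oo%E); split; first by split.
  by move=> t; rewrite fun_ramp_le ?leey // doubleS !addSn /= x1 delay1.
pose d := th 0%N / (1 - th 0%N).
have d0 : 0 <= d by apply: delay_ge0; rewrite x0.
have [_ [a [b [pab E]]]] := IH (fun i => th i.+1) (fun i => uth i.+1).
have [a0 b0 nb] := pab.
pose b' i := if i is j.+2 then (b j.+2 + d%:E)%E else d%:E.
have pab' : params a b'.
  split=> //; first by case=> [|[|i]] //=; rewrite ?lee_fin // adde_ge0.
  move=> [|[|i]] [|[|j]] //= ij; rewrite ?leeDr //.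
  by rewrite leeD2r // nb.
exists a, b'; split=> // t.
rewrite doubleS !addSn /= delayE ?x0 // -/d; case: leP => td.
  by rewrite fun_ramp_le // lee_fin.
rewrite (fun_ramp_gt (d := d) _ pab') ?d0 //.
have td0 : 0 <= `|t| - d by rewrite subr_ge0 ltW.
have := E (`|t| - d); rewrite (ger0_norm td0) /= => ->.
apply: eq_fun_lin => // i; rewrite (sub_knotsE pab') //= addeK //.
Qed.

Definition simple_set n e := [set f : R -> R | is_sim n e f].

Lemma is_simE n e f : is_sim n e f <->
  exists2 th : nat -> R, unit_param th & f = fun t => sim n e th `|t|.
Proof.
split=> -[th uth E]; exists th => //; first exact: funext.
by move=> t; rewrite E.
Qed.

Lemma simple_plusE n : (0 < n)%N -> simple_plus R n = simple_set n (odd n).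
Proof.
move=> n0; have nE := odd_double_half n; case: n n0 nE => // n _ nE.
rewrite /simple_plus; set k := n.+1./2 in nE *; case: ifP nE => o nE.
  have -> : n.+1 = (k.*2 + ~~ true).+1 by rewrite addn0 -nE add1n.
  apply/seteqP; split=> f /=.
    move=> [a [b [pab ->]]]; have [_ [th uth E]] := formula_is_sim true k pab.
    by exists th => // t; rewrite -E /fun_lin /cutoff /= leey mulr1.
  move=> /is_simE[th uth ->]; have [_ [a [b [pab E]]]] := sim_is_formula true k uth.
  exists a, b; split=> //; apply: funext => t.
  by rewrite E /fun_lin /cutoff /= leey mulr1.
have -> : n.+1 = (k.*2 + ~~ true)%N by rewrite addn0 -nE.
apply/seteqP; split=> f /=.
  move=> [a [b [pab ->]]]; have [[th uth E] _] := formula_is_sim true k pab.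
  by exists th => // t; rewrite -E /fun_ramp /cutoff /= leey mulr1.
move=> /is_simE[th uth ->]; have [[a [b [pab E]]] _] := sim_is_formula true k uth.
exists a, b; split=> //; apply: funext => t.
by rewrite E /fun_ramp /cutoff /= leey mulr1.
Qed.

Lemma simple_minusE n : (0 < n)%N -> simple_minus R n = simple_set n (~~ odd n).
Proof.
move=> n0; have nE := odd_double_half n; case: n n0 nE => // n _ nE.
rewrite /simple_minus; set k := n.+1./2 in nE *; case: ifP nE => o nE.
  have -> : n.+1 = (k.*2 + ~~ false)%N by rewrite addn1 -nE.
  apply/seteqP; split=> f /=.
    by move=> [a [b [pab ->]]]; have [[th uth E] _] := formula_is_sim false k pab; exists th.
  move=> /is_simE[th uth ->]; have [[a [b [pab E]]] _] := sim_is_formula false k uth.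
  by exists a, b; split=> //; apply: funext => t; rewrite E.
case: k nE => [//|k] nE.
have -> : n.+1 = (k.*2 + ~~ false).+1 by rewrite addn1 -nE doubleS.
apply/seteqP; split=> f /=.
  by move=> [a [b [pab ->]]]; have [_ [th uth E]] := formula_is_sim false k pab; exists th.
move=> /is_simE[th uth ->]; have [_ [a [b [pab E]]]] := sim_is_formula false k uth.
by exists a, b; split=> //; apply: funext => t; rewrite E.
Qed.

Lemma simple_unionE n : simple_plus R n `|` simple_minus R n =
  simple_set n true `|` simple_set n false.
Proof.
have [->|n0] := posnP n; last first.
  by rewrite simple_plusE // simple_minusE //; case: (odd n) => //=; rewrite setUC.
rewrite /= setUid /simple0; apply/seteqP; split=> f /=.
  by move=> [->|->]; [left|right]; (exists (fun=> 0); first by move=> i; rewrite lexx ler01) => t //=;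
    rewrite normr_eq0 indicE; congr (nat_of_bool _)%:R; apply/idP/eqP; rewrite inE.
move=> [|] [th uth E]; [left|right]; apply: funext => t; rewrite E //=.
by rewrite normr_eq0 indicE; congr (nat_of_bool _)%:R; apply/eqP/idP; rewrite inE.
Qed.

Lemma is_sim_log_concave n e f : is_sim n e f -> even_log_concave f.
Proof.
move=> [th uth E]; apply: profile_even_log_concave E; exact: profile_sim.
Qed.

End Formulas.

(** * Balls fibred by segments over balls *)

Section SequentialTopology.
Variable R : realType.

Section PseudoMetric.
Variable T : pseudoMetricType R.
Implicit Types (X : set T) (x : T).

Lemma avoiding_sequence X x : ~ nbhs x X ->
  exists u : nat -> T, u @ \oo --> x /\ forall k, ~ X (u k).
Proof.
move=> nX.
have H k : exists y, ball x (k.+1%:R^-1 : R) y /\ ~ X y.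
  apply: contrapT => nH; apply: nX; apply/nbhs_ballP.
  exists (k.+1%:R^-1 : R) => /=; first by rewrite invr_gt0.
  by move=> y xy; apply: contrapT => Xy; apply: nH; exists y.
have [u Hu] := choice H; exists u; split; last by move=> k; case: (Hu k).
apply/cvg_ballP => eps eps0; near=> k.
have [+ _] := Hu k; apply: le_ball; apply: ltW.
by near: k; exact: near_infty_natSinv_lt (PosNum eps0).
Unshelve. all: by end_near. Qed.

Lemma seq_closed X : (forall u x, (forall k, X (u k)) -> u @ \oo --> x -> X x) ->
  closed X.
Proof.
move=> H x clX; apply: contrapT => nXx.
have [|u [ux Xu]] := @avoiding_sequence (~` X) x.
  by move=> /clX[y []].
by apply: nXx; apply: H ux => k; apply: contrapT; exact: Xu.
Qed.

Lemma seq_within (U : topologicalType) X (f : T -> U) :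
  (forall u x, (forall k, X (u k)) -> X x -> u @ \oo --> x ->
     (f \o u) @ \oo --> f x) -> {within X, continuous f}.
Proof.
move=> H; apply/subspace_continuousP => x Xx B Bfx.
apply: contrapT => nB.
have [|u [ux Bu]] := @avoiding_sequence (fun y => X y -> B (f y)) x.
  by move=> HB; apply: nB.
have Xu k : X (u k) by apply: contrapT => nXu; apply: (Bu k).
have [N _ HN] := H u x Xu Xx ux B Bfx.
by apply: (Bu N) => _; apply: HN => /=.
Qed.
End PseudoMetric.

Lemma cvg_rV (T : topologicalType) n (u : nat -> 'rV[T]_n) (x : 'rV[T]_n) :
  u @ \oo --> x <-> forall i, (fun k => u k ord0 i) @ \oo --> x ord0 i.
Proof.
split=> [ux i A Ai|H A [P Px PA]].
  suff : nbhs x [set M : 'rV[T]_n | A (M ord0 i)] by move=> /ux.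
  exists (fun i' j => if j == i then A else setT).
    move=> i' j; rewrite (ord1 i'); case: eqP => [->//|_]; exact: filterT.
  by move=> M /(_ ord0 i); rewrite eqxx.
have : \forall k \near \oo, forall j, P ord0 j (u k ord0 j).
  by apply: filter_forall => j; exact: H (Px ord0 j).
by apply: filterS => k Pk; apply: PA => i j; rewrite (ord1 i).
Qed.

Definition last_coord n (z : 'rV[R]_n.+1) : R := z ord0 ord_max.
Definition front_coords n (z : 'rV[R]_n.+1) : 'rV[R]_n :=
  \row_(i < n) z ord0 (widen_ord (leqnSn n) i).
Definition snoc n (x : 'rV[R]_n) (v : R) : 'rV[R]_n.+1 :=
  \row_(i < n.+1) (if unlift ord_max i is Some j then x ord0 j else v).

Lemma widen_lift n (i : 'I_n) : widen_ord (leqnSn n) i = lift ord_max i.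
Proof. by apply: val_inj => /=; rewrite /bump leqNgt ltn_ord. Qed.

Lemma front_snoc n (x : 'rV[R]_n) v : front_coords (snoc x v) = x.
Proof. by apply/rowP => i; rewrite !mxE widen_lift liftK. Qed.

Lemma last_snoc n (x : 'rV[R]_n) v : last_coord (snoc x v) = v.
Proof. by rewrite /last_coord mxE unlift_none. Qed.

Lemma snoc_front_last n (z : 'rV[R]_n.+1) : snoc (front_coords z) (last_coord z) = z.
Proof.
apply/rowP => i; rewrite mxE; case: unliftP => [j ->|->//].
by rewrite mxE widen_lift.
Qed.

Lemma cvg_front n (u : nat -> 'rV[R]_n.+1) z : u @ \oo --> z ->
  (fun k => front_coords (u k)) @ \oo --> front_coords z.
Proof.
move=> /cvg_rV uz; apply/cvg_rV => i; rewrite mxE.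
under eq_fun do rewrite mxE.
exact: uz.
Qed.

Lemma cvg_last n (u : nat -> 'rV[R]_n.+1) z : u @ \oo --> z ->
  (fun k => last_coord (u k)) @ \oo --> last_coord z.
Proof. by move=> /cvg_rV; exact. Qed.

Lemma cvg_snoc n (u : nat -> 'rV[R]_n) x (v : nat -> R) y :
  u @ \oo --> x -> v @ \oo --> y ->
  (fun k => snoc (u k) (v k)) @ \oo --> snoc x y.
Proof.
move=> /cvg_rV ux vy; apply/cvg_rV => i; rewrite mxE.
under eq_fun do rewrite mxE.
by case: (unliftP ord_max i) => [j _|_] //; exact: ux.
Qed.

Definition sqnorm n (x : 'rV[R]_n) : R := \sum_(i < n) x ord0 i ^+ 2.

Lemma sqnorm_rec n (z : 'rV[R]_n.+1) :
  sqnorm z = sqnorm (front_coords z) + last_coord z ^+ 2.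
Proof.
rewrite /sqnorm big_ord_recr /=; congr (_ + _).
by apply: eq_bigr => i _; rewrite mxE.
Qed.

Lemma cvg_sqnorm n (u : nat -> 'rV[R]_n) x : u @ \oo --> x ->
  (fun k => sqnorm (u k)) @ \oo --> sqnorm x.
Proof.
move=> /cvg_rV ux; rewrite /sqnorm; elim: (index_enum _) => [|i r IH].
  by rewrite big_nil; under eq_fun do rewrite big_nil; exact: cvg_cst.
rewrite big_cons; under eq_fun do rewrite big_cons.
by apply: cvgD => //; rewrite expr2; under eq_fun do rewrite expr2; apply: cvgM.
Qed.

Definition seq_continuous n (T : topologicalType) (X : set 'rV[R]_n)
    (f : 'rV[R]_n -> T) :=
  forall u x, (forall k, X (u k)) -> X x -> u @ \oo --> x ->
  (fun k => f (u k)) @ \oo --> f x.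

(** The last two fields make [D] contain the topological boundary of [X] without an
appeal to invariance of domain. *)
Record ball_model n (X D : set 'rV[R]_n) (h g : 'rV[R]_n -> 'rV[R]_n) : Prop :=
 BallModel {
  bm_ball : forall x, X x -> sqnorm (h x) <= 1 /\ g (h x) = x;
  bm_set : forall w, sqnorm w <= 1 -> X (g w) /\ h (g w) = w;
  bm_sphere : forall x, X x -> (D x <-> sqnorm (h x) = 1);
  bm_h : seq_continuous X h;
  bm_g : seq_continuous [set w | sqnorm w <= 1] g;
  bm_closed : forall u x, (forall k, X (u k)) -> u @ \oo --> x -> X x;
  bm_interior : forall x, X x -> ~ D x -> forall u, u @ \oo --> x ->
     \forall k \near \oo, X (u k) }.

Section Fibration.
Variables (n : nat) (X : set 'rV[R]_n) (lo hi : 'rV[R]_n -> R).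
Variables (h g : 'rV[R]_n -> 'rV[R]_n).
Hypothesis lohi : forall x, X x -> lo x <= hi x.
Hypothesis lo_cont : seq_continuous X lo.
Hypothesis hi_cont : seq_continuous X hi.
Let D := [set x | X x /\ lo x = hi x].
Hypothesis BX : ball_model X D h g.

Let Y := [set z : 'rV[R]_n.+1 | X (front_coords z) /\
  lo (front_coords z) <= last_coord z <= hi (front_coords z)].
Let DY := [set z : 'rV[R]_n.+1 | X (front_coords z) /\
  (last_coord z = lo (front_coords z) \/ last_coord z = hi (front_coords z))].

(** Half the length of the vertical chord of the unit ball over [u]. *)
Let radius (u : 'rV[R]_n) := Num.sqrt (1 - sqnorm u).
(** The affine coordinate, from -1 to 1, of [y] on the segment over [x]. *)
Let pos (x : 'rV[R]_n) (y : R) := (2 * y - lo x - hi x) / (hi x - lo x).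
(** Segments over [X] are mapped affinely onto the vertical chords of the ball; both
degenerate at the same places, namely over [D] and over the sphere. *)
Let H (z : 'rV[R]_n.+1) := snoc (h (front_coords z))
  (radius (h (front_coords z)) * pos (front_coords z) (last_coord z)).
Let G (w : 'rV[R]_n.+1) := let x := g (front_coords w) in snoc x
  ((lo x + hi x) / 2 + (hi x - lo x) / 2 * (last_coord w / radius (front_coords w))).

Let pos_le1 x y : lo x <= y <= hi x -> `|pos x y| <= 1.
Proof.
move=> /andP[ly yh]; rewrite /pos; have [->|ne] := eqVneq (hi x - lo x) 0.
  by rewrite invr0 mulr0 normr0 ler01.
have d0 : 0 < hi x - lo x by rewrite lt_neqAle eq_sym ne subr_ge0 (le_trans ly).
by rewrite normf_div (gtr0_norm d0) ler_pdivrMr // mul1r ler_norml; lra.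
Qed.

Let radius_sqr u : sqnorm u <= 1 -> radius u ^+ 2 = 1 - sqnorm u.
Proof. by move=> u1; rewrite sqr_sqrtr // subr_ge0. Qed.

Let radius_ge0 u : 0 <= radius u. Proof. exact: sqrtr_ge0. Qed.

Let radius_eq0 u : sqnorm u <= 1 -> (radius u == 0) = (sqnorm u == 1).
Proof.
move=> u1; rewrite -sqrf_eq0 radius_sqr // subr_eq0 eq_sym.
by [].
Qed.

Let ratio_le1 w : sqnorm w <= 1 ->
  sqnorm (front_coords w) <= 1 /\
  `|last_coord w| <= radius (front_coords w).
Proof.
rewrite sqnorm_rec => w1; have f1 : sqnorm (front_coords w) <= 1.
  by apply: le_trans w1; rewrite lerDl sqr_ge0.
split=> //; rewrite -(ler_pXn2r (n := 2)) ?nnegrE //.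
by rewrite radius_sqr // real_normK ?num_real //; lra.
Qed.

Let ratio_norm w : sqnorm w <= 1 ->
  `|last_coord w / radius (front_coords w)| <= 1.
Proof.
move=> /ratio_le1[_]; set r := radius _; set v := last_coord w => vr.
have [->|r0] := eqVneq r 0; first by rewrite invr0 mulr0 normr0 ler01.
have r_gt0 : 0 < r by rewrite lt_neqAle eq_sym r0 radius_ge0.
by rewrite normf_div (gtr0_norm r_gt0) ler_pdivrMr // mul1r.
Qed.

Let cvg_radius (u : nat -> 'rV[R]_n) x : u @ \oo --> x ->
  (fun k => radius (u k)) @ \oo --> radius x.
Proof.
move=> ux; have c : (fun k => 1 - sqnorm (u k)) @ \oo --> 1 - sqnorm x.
  by apply: cvgB; [exact: cvg_cst|exact: cvg_sqnorm].
exact: (cvg_comp _ _ c (@sqrt_continuous R _)).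
Qed.

Let H_ball z : Y z -> sqnorm (H z) <= 1 /\ G (H z) = z.
Proof.
move=> [Xx lh]; have [hx1 gh] := bm_ball BX Xx.
set x := front_coords z in Xx lh hx1 gh *; set y := last_coord z in lh *.
have p1 : pos x y ^+ 2 <= 1.
  by rewrite -real_normK ?num_real // expr_le1 // pos_le1.
split.
  rewrite sqnorm_rec front_snoc last_snoc exprMn radius_sqr //.
  rewrite -lerBrDl ler_piMr // subr_ge0.
  by [].
rewrite /G front_snoc last_snoc gh -/x -[RHS]snoc_front_last -/x -/y.
congr snoc; have [lh0|lh0] := eqVneq (hi x - lo x) 0.
  by rewrite lh0 mul0r mul0r addr0; move/andP: lh => [? ?]; lra.
have r0 : radius (h x) != 0.
  rewrite radius_eq0 //; apply: contraNneq lh0 => hs.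
  by have [_ ->] := (bm_sphere BX Xx).2 hs; rewrite subrr.
by rewrite /pos; field; rewrite r0 lh0.
Qed.

Let G_set w : sqnorm w <= 1 -> Y (G w) /\ H (G w) = w.
Proof.
move=> w1; have [f1 vr] := ratio_le1 w1; have := ratio_norm w1.
have [Xx hg] := bm_set BX f1; rewrite /Y /= /G front_snoc last_snoc.
set x := g _ in Xx hg *; set r := radius _ in vr *; set v := last_coord w in vr *.
move=> q1; have lh := lohi Xx.
have q1' : -1 <= v / r <= 1 by rewrite -ler_norml.
split.
  split=> //; apply/andP; split.
    have : (hi x - lo x) / 2 * (-1) <= (hi x - lo x) / 2 * (v / r).
      by rewrite ler_wpM2l ?divr_ge0 ?subr_ge0 //; case/andP: q1'.
    lra.
  have : (hi x - lo x) / 2 * (v / r) <= (hi x - lo x) / 2 * 1.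
    by rewrite ler_wpM2l ?divr_ge0 ?subr_ge0 //; case/andP: q1'.
  lra.
rewrite /H front_snoc last_snoc hg -[RHS]snoc_front_last -/v; congr snoc.
rewrite -/r; have [r0|r0] := eqVneq r 0.
  by move: vr; rewrite r0 mul0r normr_le0 => /eqP ->.
have lh0 : hi x - lo x != 0.
  apply: contraNneq r0; rewrite radius_eq0 // => /eqP; rewrite subr_eq0 => /eqP E.
  by have := (bm_sphere BX Xx).1 (conj Xx (esym E)); rewrite hg => ->.
by rewrite /pos; field; rewrite r0 lh0.
Qed.

Let H_sphere z : Y z -> (DY z <-> sqnorm (H z) = 1).
Proof.
move=> [Xx lh]; have [hx1 gh] := bm_ball BX Xx; rewrite /DY /=.
rewrite sqnorm_rec front_snoc last_snoc exprMn radius_sqr //.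
set x := front_coords z in Xx lh hx1 gh *; set y := last_coord z in lh *.
have [lh0|lh0] := eqVneq (hi x - lo x) 0.
  have E : lo x = hi x by lra.
  have -> : sqnorm (h x) = 1 by apply/(bm_sphere BX Xx); split.
  split=> _; first by rewrite subrr mul0r addr0.
  by split=> //; left; case/andP: lh; lra.
have s1 : sqnorm (h x) != 1.
  apply: contraNneq lh0 => /(bm_sphere BX Xx)[_ ->].
  by rewrite subrr.
have E : pos x y ^+ 2 - 1 = 4 * ((y - lo x) * (y - hi x)) / (hi x - lo x) ^+ 2.
  by rewrite /pos; field.
split=> [[_ yE]|yE].
  have : pos x y ^+ 2 - 1 = 0.
    by rewrite E; case: yE => ->; rewrite subrr ?mul0r ?mulr0 mul0r.
  by move=> /eqP; rewrite subr_eq0 => /eqP ->; rewrite mulr1 addrC subrK.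
split=> //.
have : (1 - sqnorm (h x)) * (pos x y ^+ 2 - 1) = 0.
  by rewrite mulrBr mulr1; lra.
move=> /eqP; rewrite mulf_eq0 subr_eq0 eq_sym (negbTE s1) /= E.
rewrite !mulf_eq0 invr_eq0 sqrf_eq0 (negbTE lh0) orbF pnatr_eq0 /= !subr_eq0.
by move=> /orP[] /eqP; [left|right].
Qed.

Let cvg_dominated (v b : nat -> R) (l : R) : (forall k, `|v k - l| <= b k) ->
  b @ \oo --> (0 : R) -> v @ \oo --> l.
Proof.
move=> vb b0; apply/cvgrPdist_le => eps eps0.
have /cvgrPdist_le/(_ eps eps0) := b0; apply: filterS => k.
rewrite sub0r normrN distrC => bk; apply: le_trans (vb k) _.
exact: le_trans (ler_norm _) bk.
Qed.

(** Where the segment degenerates [pos] is not continuous, but it is bounded and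
multiplied by a radius that tends to 0. *)
Let H_cont : seq_continuous Y H.
Proof.
move=> u z Yu [Xx lh] uz; have fz := cvg_front uz; have lz := cvg_last uz.
have Xu k : X (front_coords (u k)) by case: (Yu k).
have hz := bm_h BX Xu Xx fz; have rz := cvg_radius hz.
apply: cvg_snoc => //; set x := front_coords z in Xx lh fz hz rz *.
have [lh0|lh0] := eqVneq (hi x - lo x) 0.
  have E : lo x = hi x by lra.
  have r0 : radius (h x) = 0.
    apply/eqP; rewrite radius_eq0; last by case: (bm_ball BX Xx).
    by apply/eqP/(bm_sphere BX Xx); split.
  rewrite r0 mul0r; rewrite r0 in rz; apply: cvg_dominated rz => k.
  rewrite subr0 normrM (ger0_norm (radius_ge0 _)) ler_piMr ?radius_ge0 //.
  by apply: pos_le1; case: (Yu k).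
apply: cvgM => //; rewrite /pos.
have cl := lo_cont Xu Xx fz; have ch := hi_cont Xu Xx fz.
apply: cvgM; last by apply: cvgV => //; apply: cvgB.
by apply: cvgB => //; apply: cvgB => //; apply: cvgM => //; exact: cvg_cst.
Qed.

(** Continuity over the sphere again comes from a bounded factor times the length of
a segment, which tends to 0. *)
Let G_cont : seq_continuous [set w | sqnorm w <= 1] G.
Proof.
move=> u w Bu Bw uw; have fw := cvg_front uw; have lw := cvg_last uw.
have Bfu k : [set w | sqnorm w <= 1] (front_coords (u k)) by case: (ratio_le1 (Bu k)).
have [Bfw vr] := ratio_le1 Bw.
have gw := bm_g BX Bfu Bfw fw.
have Xu k : X (g (front_coords (u k))) by case: (bm_set BX (Bfu k)).
have [Xx hg] := bm_set BX Bfw.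
have cl := lo_cont Xu Xx gw; have ch := hi_cont Xu Xx gw.
apply: cvg_snoc => //; set x := g (front_coords w) in Xx hg gw cl ch *.
have c2 (c : R) : (fun=> c : R) @ \oo --> c by exact: cvg_cst.
have c1 : (fun k => (lo (g (front_coords (u k))) + hi (g (front_coords (u k)))) / 2)
    @ \oo --> (lo x + hi x) / 2.
  by apply: cvgM => //; apply: cvgD.
have c3 : (fun k => (hi (g (front_coords (u k))) - lo (g (front_coords (u k)))) / 2)
    @ \oo --> (hi x - lo x) / 2.
  by apply: cvgM => //; apply: cvgB.
apply: cvgD => //.
have [r0|r0] := eqVneq (radius (front_coords w)) 0.
  have s1 : sqnorm (h x) = 1 by rewrite hg; apply/eqP; rewrite -radius_eq0 ?r0.
  have [_ E] := (bm_sphere BX Xx).2 s1.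
  rewrite E subrr mul0r mul0r; rewrite E subrr mul0r in c3.
  apply: cvg_dominated c3 => k; rewrite subr0 normrM.
  have d0 : 0 <= (hi (g (front_coords (u k))) - lo (g (front_coords (u k)))) / 2.
    by rewrite divr_ge0 // subr_ge0 lohi.
  by rewrite (ger0_norm d0) ler_piMr // ratio_norm //; exact: Bu.
apply: cvgM => //; apply: cvgM => //; apply: cvgV => //; exact: cvg_radius.
Qed.

Let Y_closed u z : (forall k, Y (u k)) -> u @ \oo --> z -> Y z.
Proof.
move=> Yu uz; have fz := cvg_front uz; have lz := cvg_last uz.
have Xu k : X (front_coords (u k)) by case: (Yu k).
have Xx := bm_closed BX Xu fz.
have cl := lo_cont Xu Xx fz; have ch := hi_cont Xu Xx fz.
split=> //; rewrite -subr_ge0 -[X in _ && X]subr_ge0; apply/andP; split.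
  apply: (cvgr_to_ge (cvgB lz cl)); apply: nearW => k.
  by rewrite subr_ge0; case: (Yu k) => _ /andP[].
apply: (cvgr_to_ge (cvgB ch lz)); apply: nearW => k.
by rewrite subr_ge0; case: (Yu k) => _ /andP[].
Qed.

Let Y_interior z : Y z -> ~ DY z -> forall u, u @ \oo --> z ->
  \forall k \near \oo, Y (u k).
Proof.
move=> [Xx /andP[lz zh]] nD u uz; have fz := cvg_front uz.
have lastz := cvg_last uz.
set x := front_coords z in Xx lz zh nD fz *; set y := last_coord z in lz zh nD lastz *.
have {}lz : lo x < y.
  by rewrite lt_neqAle lz andbT; apply/eqP => E; apply: nD; split => //; left.
have {}zh : y < hi x.
  by rewrite lt_neqAle zh andbT; apply/eqP => E; apply: nD; split => //; right.
have nDx : ~ D x by move=> [_ E]; move: (lt_trans lz zh); rewrite E ltxx.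
have [N _ XN] := bm_interior BX Xx nDx fz.
have Xu k : X (front_coords (u (k + N)%N)) by apply: XN => /=; exact: leq_addl.
have shift (T : ptopologicalType) (v : nat -> T) (l : T) : v @ \oo --> l ->
    (fun k => v (k + N)%N) @ \oo --> l.
  by move=> vl; apply: (cvg_comp (addn^~ N) v _ vl); exact: cvg_addnr.
have cl := lo_cont Xu Xx (shift _ _ _ fz).
have ch := hi_cont Xu Xx (shift _ _ _ fz).
have cy := shift _ _ _ lastz.
have c1 : (fun k => last_coord (u (k + N)%N) - lo (front_coords (u (k + N)%N))) @ \oo
    --> y - lo x by exact: cvgB.
have c2 : (fun k => hi (front_coords (u (k + N)%N)) - last_coord (u (k + N)%N)) @ \oo
    --> hi x - y by exact: cvgB.
have /cvgr_gt/(_ 0) := c1; rewrite subr_gt0 => /(_ lz)[N1 _ H1].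
have /cvgr_gt/(_ 0) := c2; rewrite subr_gt0 => /(_ zh)[N2 _ H2].
exists (N1 + N2 + N)%N => // k /= kN.
have kE : k = ((k - N) + N)%N.
  by rewrite subnK // (leq_trans _ kN) // leq_addl.
have kN12 : (N1 + N2 <= k - N)%N by rewrite -(leq_add2r N) -kE.
rewrite kE; split; first exact: Xu.
have := H1 (k - N)%N (leq_trans (leq_addr _ _) kN12).
have := H2 (k - N)%N (leq_trans (leq_addl _ _) kN12).
by rewrite !subr_gt0 => /ltW -> /ltW ->.
Qed.

Lemma fibration_ball_model : exists h' g', ball_model Y DY h' g'.
Proof. by exists H, G; split. Qed.

(** Move vertically out of the segment. *)
Lemma fibration_boundary z : DY z ->
  exists2 u : nat -> 'rV[R]_n.+1, u @ \oo --> z & forall k, ~ Y (u k).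
Proof.
move=> [Xx yE].
have c0 (y e : R) : (fun k : nat => y + e * k.+1%:R^-1) @ \oo --> y.
  rewrite -[X in _ --> X]addr0; apply: cvgD; first exact: cvg_cst.
  rewrite -[X in _ --> X](mulr0 e); apply: cvgM; first exact: cvg_cst.
  exact: cvg_harmonic.
pose u e k := snoc (front_coords z) (last_coord z + e * k.+1%:R^-1).
have cu e : u e @ \oo --> z.
  by rewrite -[X in _ --> X]snoc_front_last; apply: cvg_snoc => //; exact: cvg_cst.
case: yE => yE; [exists (u (-1))|exists (u 1)] => // k [_].
  rewrite front_snoc last_snoc yE => /andP[+ _].
  by rewrite lerDl mulN1r oppr_ge0 leNgt invr_gt0 ltr0n.
rewrite front_snoc last_snoc yE => /andP[_].
by rewrite gerDl mul1r leNgt invr_gt0 ltr0n.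
Qed.

End Fibration.
End SequentialTopology.

(** * The cube model of the extended half-lines *)

Section ExtendedReals.
Variable R : realType.

Lemma cvg_contract (u : nat -> \bar R) x : u @ \oo --> x ->
  (fun k => contract (u k)) @ \oo --> contract x.
Proof.
move=> /cvg_ballP ux; apply/cvgrPdist_lt => eps eps0.
by have := ux eps eps0; apply: filterS.
Qed.

Lemma cvg_expand (u : nat -> R) x : (forall k, `|u k| <= 1) -> `|x| <= 1 ->
  u @ \oo --> x -> (fun k => expand (u k)) @ \oo --> expand x.
Proof.
move=> u1 x1 /cvgrPdist_lt ux; apply/cvg_ballP => eps eps0.
have := ux eps eps0; apply: filterS => k xu.
by rewrite /ball /= /ereal_ball !expandK ?inE.
Qed.

Definition from_cube n (x : 'rV[R]_n) : 'rV[\bar R]_n := map_mx (@expand R) x.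

Lemma to_cubeK n : cancel (@to_cube R n) (@from_cube n).
Proof. by move=> x; apply/rowP => i; rewrite !mxE contractK. Qed.

Lemma cvg_to_cube n (u : nat -> 'rV[\bar R]_n) x : u @ \oo --> x ->
  (fun k => to_cube (u k)) @ \oo --> to_cube x.
Proof.
move=> /cvg_rV ux; apply/cvg_rV => i; rewrite mxE.
under eq_fun do rewrite mxE.
by apply: cvg_contract; exact: ux.
Qed.

(** In the application the values converge along a subsequence of every subsequence
because the parameters range over a compact space. *)
Lemma cvg_of_subseq (v : nat -> R) (l : R) :
  (forall phi : nat -> nat, (forall k, (k <= phi k)%N) ->
     exists2 psi : nat -> nat, (forall k, (k <= psi k)%N) &
       (fun k => v (phi (psi k))) @ \oo --> l) ->
  v @ \oo --> l.
Proof.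
move=> H; apply/cvgrPdist_lt => eps eps0; apply: contrapT => nv.
have Hk k : exists j, (k <= j)%N /\ ~ `|l - v j| < eps.
  apply: contrapT => nH; apply: nv; exists k => // j /= kj.
  by apply: contrapT => lv; apply: nH; exists j.
have [phi Hphi] := choice Hk.
have [|psi psik cv] := H phi; first by move=> k; case: (Hphi k).
have /cvgrPdist_lt/(_ eps eps0)[N _ HN] := cv.
have [_] := Hphi (psi N); apply.
exact: (HN N (leqnn N)).
Qed.

End ExtendedReals.

(** * The moment bodies *)

Section MomentBodies.
Variables (R : realType) (p : nat -> R).
Hypotheses (p_gt : forall i, -1 < p i) (p_inj : injective p).
Implicit Types (f g : R -> R) (th : nat -> R) (e : bool).

Definition mom i f : R := contract (moment (p i) f).
Definition momvec n f : 'rV[R]_n := \row_(i < n) mom i f.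
Definition body n : set 'rV[R]_n := [set momvec n f | f in @profile R].

Lemma mom_inj i f g : mom i f = mom i g -> moment (p i) f = moment (p i) g.
Proof. exact: (can_inj (@contractK R)). Qed.

Lemma momvec_eqP n f g :
  momvec n f = momvec n g <->
  forall i, (i < n)%N -> moment (p i) f = moment (p i) g.
Proof.
split=> [E i ni|E].
  by have /rowP/(_ (Ordinal ni)) := E; rewrite !mxE => /mom_inj.
by apply/rowP => i; rewrite !mxE /mom E.
Qed.

Lemma eq_momvec n f g : (forall t, 0 < t -> f t = g t) ->
  momvec n f = momvec n g.
Proof. by move=> fg; apply/momvec_eqP => i _; exact: moment_eq. Qed.

Lemma front_momvec n f : front_coords (momvec n.+1 f) = momvec n f.
Proof. by apply/rowP => i; rewrite !mxE. Qed.

Lemma body_momvec n f : profile f -> body (momvec n f).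
Proof. by exists f. Qed.

Lemma last_momvec n f : last_coord (momvec n.+1 f) = mom n f.
Proof. by rewrite /last_coord mxE. Qed.

Lemma interpolate n e f : profile f ->
  exists2 th : nat -> R, unit_param th & momvec n (sim n e th) = momvec n f.
Proof.
move=> pf; have [th uth E] := interpolation p_gt p_inj n (l := [::]) e isT pf.
by exists th => //; apply/momvec_eqP.
Qed.

Fact ext_key : unit. Proof. by []. Qed.
(** The bound on the moment of order [n] that simple functions of kind [e] attain
over the point [x]. The choice of parameters is irrelevant, since the first [n]
moments determine the next one. *)
Definition ext e n (x : 'rV[R]_n) : R := locked_with ext_key
  (mom n (sim n e (xget (fun=> 0) [set th | unit_param th /\ momvec n (sim n e th) = x]))).

Lemma ext_sim e n th : unit_param th ->
  ext e (momvec n (sim n e th)) = mom n (sim n e th).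
Proof.
move=> uth; rewrite /ext unlock; case: xgetP => [th' _ [uth' /momvec_eqP E]|/(_ th)[]//].
by congr contract; exact: (sim_next_moment (l := [::]) p_gt p_inj uth' uth isT E).
Qed.

Lemma body_sim e n x : body x ->
  exists2 th : nat -> R, unit_param th & x = momvec n (sim n e th).
Proof. by move=> [f pf <-]; have [th uth E] := interpolate n e pf; exists th. Qed.

Definition lo n (x : 'rV[R]_n) := Num.min (ext true x) (ext false x).
Definition hi n (x : 'rV[R]_n) := Num.max (ext true x) (ext false x).

Lemma lo_le_hi n (x : 'rV[R]_n) : lo x <= hi x.
Proof.
rewrite /lo /hi; move: (ext true x) (ext false x) => a b.
by rewrite ge_min le_max lexx.
Qed.

(** A body is fibred by segments over the body of lower dimension: extremality gives
one inclusion, and simple functions of higher order reach all intermediate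
values. *)
Lemma body_rec n : @body n.+1 = [set z | body (front_coords z) /\
  lo (front_coords z) <= last_coord z <= hi (front_coords z)].
Proof.
apply/seteqP; split=> z /=.
  move=> [f pf <-]; rewrite front_momvec last_momvec; split; first by exists f.
  have [th1 uth1 E1] := interpolate n false pf.
  have [th2 uth2 E2] := interpolate n true pf.
  rewrite /lo /hi -{1 3}E2 -E1 !ext_sim // ge_min le_max.
  move/momvec_eqP : E1 => E1; move/momvec_eqP : E2 => E2.
  have := extremal_between (e := true) p_gt p_inj (l := [::]) isT pf uth1 uth2 E1 E2.
  by rewrite /mom !le_contract => -[/andP[-> ->]|/andP[-> ->]]; rewrite ?orbT.
move=> [[f pf Ef] lh].
have [th1 uth1 E1] := interpolate n false pf.
have [th2 uth2 E2] := interpolate n true pf.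
have b y : last_coord z = contract y -> body z.
  move=> yE; move: lh; rewrite /lo /hi -Ef -{1 3}E2 -E1 !ext_sim // yE.
  rewrite ge_min le_max /mom !le_contract => lh.
  move/momvec_eqP : E1 => E1; move/momvec_eqP : E2 => E2.
  have [|th uth [Eth Ey]] := intermediate_moment (e := true) (l := [::]) p_gt p_inj isT
    (fun l' g ul' pg => interpolation p_gt p_inj n _ ul' pg) uth1 uth2 E1 E2 (y := y).
    move: lh; set M1 := moment _ (sim n false th1); set M2 := moment _ _.
    have [m12|/ltW m21] := leP M1 M2 => /andP[l1 l2].
      left; apply/andP; split.
        by case/orP: l1 => [|//]; exact: le_trans.
      by case/orP: l2 => [//|yM1]; exact: le_trans m12.
    right; apply/andP; split.
      by case/orP: l1 => [//|]; exact: le_trans.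
    by case/orP: l2 => [yM2|//]; exact: le_trans m21.
  exists (sim n.+1 true th); first exact: profile_sim.
  rewrite -[z]snoc_front_last -Ef yE -[LHS]snoc_front_last front_momvec last_momvec.
  by congr snoc; [exact/momvec_eqP|rewrite /mom Ey].
apply: (b (expand (last_coord z))); rewrite expandK // inE /=.
have e1 e x : -1 <= @ext e n x <= 1.
  by rewrite -ler_norml /ext unlock; exact: contract_le1.
move: lh (e1 true (front_coords z)) (e1 false (front_coords z)).
rewrite /lo /hi ge_min le_max ler_norml.
move: (ext true _) (ext false _) (last_coord z) => a b' c.
by move=> /andP[/orP l1 /orP l2] /andP[? ?] /andP[? ?]; lra.
Qed.

Lemma mom_cvg q e n (th_ : nat -> nat -> R) th :
  (forall k, unit_param (th_ k)) -> unit_param th ->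
  (forall i, (i < n)%N -> (fun k => th_ k i) @ \oo --> th i) ->
  (fun k => mom q (sim n e (th_ k))) @ \oo --> mom q (sim n e th).
Proof.
move=> uth_ uth cth; apply: cvg_contract; apply: cconv_moment => //.
- by move=> k; exact: profile_sim.
- exact: profile_sim.
- exact: cconv_sim.
Qed.

(** The graph is the image of a compact parameter space, hence closed. *)
Lemma ext_continuous e n : seq_continuous (@body n) (@ext e n).
Proof.
move=> u x Xu Xx ux.
have Hex k : exists th, unit_param th /\ u k = momvec n (sim n e th).
  by have [th uth E] := body_sim e (Xu k); exists th.
have [th_ Hth] := choice Hex.
have uth_ k : unit_param (th_ k) by case: (Hth k).
have uE k : ext e (u k) = mom n (sim n e (th_ k)).
  by have [uth ->] := Hth k; exact: ext_sim.
apply: cvg_of_subseq => phi phik.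
have [psi [th [psik uth cth]]] := param_subsequence n (fun k => uth_ (phi k)).
exists psi => //.
have cm q := @mom_cvg q e n _ th (fun k => uth_ (phi (psi k))) uth cth.
have -> : x = momvec n (sim n e th).
  apply/rowP => i; rewrite mxE.
  have /cvg_rV/(_ i) ci := cvg_subseq psik (cvg_subseq phik ux).
  apply: (cvg_unique _ ci) => //.
  apply: cvg_trans (cm i); apply: near_eq_cvg; apply: nearW => k /=.
  by have [_ ->] := Hth (phi (psi k)); rewrite mxE.
rewrite ext_sim //; apply: cvg_trans (cm n); apply: near_eq_cvg.
by apply: nearW => k /=; rewrite uE.
Qed.

Lemma cvg_minr (u v : nat -> R) a b : u @ \oo --> a -> v @ \oo --> b ->
  (fun k => Num.min (u k) (v k)) @ \oo --> Num.min a b.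
Proof.
move=> ua vb; rewrite minr_absE; under eq_fun do rewrite minr_absE.
apply: cvgM; last exact: cvg_cst.
by apply: cvgB; [exact: cvgD|apply: cvg_norm; exact: cvgB].
Qed.

Lemma cvg_maxr (u v : nat -> R) a b : u @ \oo --> a -> v @ \oo --> b ->
  (fun k => Num.max (u k) (v k)) @ \oo --> Num.max a b.
Proof.
move=> ua vb; rewrite maxr_absE; under eq_fun do rewrite maxr_absE.
apply: cvgM; last exact: cvg_cst.
by apply: cvgD; [exact: cvgD|apply: cvg_norm; exact: cvgB].
Qed.

Lemma lo_continuous n : seq_continuous (@body n) (@lo n).
Proof.
move=> u x Xu Xx ux; apply: cvg_minr.
  exact: (ext_continuous (e := true) Xu Xx ux).
exact: (ext_continuous (e := false) Xu Xx ux).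
Qed.

Lemma hi_continuous n : seq_continuous (@body n) (@hi n).
Proof.
move=> u x Xu Xx ux; apply: cvg_maxr.
  exact: (ext_continuous (e := true) Xu Xx ux).
exact: (ext_continuous (e := false) Xu Xx ux).
Qed.

Definition rim n : set 'rV[R]_n := [set x | body x /\ lo x = hi x].

Lemma lo_eq_hi n (x : 'rV[R]_n) : lo x = hi x <-> ext true x = ext false x.
Proof.
rewrite /lo /hi; move: (ext true x) (ext false x) => a b.
by split=> [|->]; [case: ltgtP => // ab E; lra|rewrite minxx maxxx].
Qed.

Lemma lo_or_hi n (x : 'rV[R]_n) v :
  v = lo x \/ v = hi x <-> exists e, v = ext e x.
Proof.
have -> : (exists e, v = ext e x) <-> v = ext true x \/ v = ext false x.
  by split=> [[[]]|[]]; [left|right|exists true|exists false].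
rewrite /lo /hi; move: (ext true x) (ext false x) => a b.
by have [_|_] := leP a b; [|exact: or_comm].
Qed.

(** A point of the rim carries two simple functions of order [n.+1], one of each
kind, with the same moments up to order [n.+1]; they coincide and come from order
[n], which is to say that the last coordinate is extremal. Conversely, a simple
function of order [n] is at the same time a simple function of order [n.+1] of
both kinds. *)
Lemma rim_rec n : @rim n.+1 = [set z | body (front_coords z) /\
  (last_coord z = lo (front_coords z) \/ last_coord z = hi (front_coords z))].
Proof.
apply/seteqP; split=> z /=.
  move=> [Xz /lo_eq_hi E].
  have [th1 uth1 E1] := body_sim true Xz.
  have [th2 uth2 E2] := body_sim false Xz.
  have E' : moment (p n.+1) (sim n.+1 true th1) = moment (p n.+1) (sim n.+1 false th2).
    by apply: mom_inj; rewrite -(ext_sim true _ uth1) -(ext_sim false _ uth2) -E1 -E2.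
  have /momvec_eqP E12 : momvec n.+1 (sim n.+1 true th1) = momvec n.+1 (sim n.+1 false th2).
    by rewrite -E1 -E2.
  have Hm i : (i <= n.+1)%N ->
      moment (p i) (sim n.+1 true th1) = moment (p i) (sim n.+1 false th2).
    by rewrite leq_eqVlt => /predU1P[->|/E12].
  have [e [th uth Eth]] := coincident_extremals p_gt p_inj uth1 uth2 Hm.
  have -> : z = momvec n.+1 (sim n e th).
    by rewrite (eq_momvec _ Eth); case: (e).
  rewrite front_momvec last_momvec.
  split; first exact: body_momvec (profile_sim _ _ uth).
  by rewrite -(ext_sim e _ uth); apply/lo_or_hi; exists e.
move=> [Xx /lo_or_hi[e eE]].
have [th uth E] := body_sim e Xx.
have zE' : z = momvec n.+1 (sim n e th).
  rewrite -[LHS]snoc_front_last -[RHS]snoc_front_last front_momvec last_momvec.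
  by rewrite eE E (ext_sim e _ uth).
have [th1 [uth1 E1]] := sim_embed n e uth.
have [th2 [uth2 E2]] := sim_embed_neg n (~~ e) uth; rewrite negbK in E2.
have z1 : z = momvec n.+1 (sim n.+1 e th1) by rewrite (eq_momvec _ E1).
have z2 : z = momvec n.+1 (sim n.+1 (~~ e) th2) by rewrite (eq_momvec _ E2).
split; first by rewrite zE'; exact: body_momvec (profile_sim _ _ uth).
have : ext e z = ext (~~ e) z.
  rewrite {1}z1 z2 !ext_sim //; congr contract.
  by rewrite (moment_eq _ E1) (moment_eq _ E2).
by move=> E'; apply/lo_eq_hi; case: (e) E'.
Qed.

Lemma body_ball_model n : exists h (g : 'rV[R]_n -> 'rV[R]_n), ball_model (@body n) (@rim n) h g.
Proof.
elim: n => [|n [h [g BM]]]; last first.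
  rewrite body_rec rim_rec.
  apply: (fibration_ball_model (fun x _ => lo_le_hi x) _ _ BM).
    exact: lo_continuous.
  exact: hi_continuous.
(* In dimension 0 the body is a point that is not on the rim: without constraints
   the extremal moments are those of the indicator of 0 and of the constant 1. *)
have eq0 (x y : 'rV[R]_0) : x = y by apply/rowP => -[].
have s0 (x : 'rV[R]_0) : sqnorm x = 0 by rewrite /sqnorm big_ord0.
have X0 (x : 'rV[R]_0) : body x.
  by exists (cst 1); [exact: profile_cst1|exact: eq0].
have nD (x : 'rV[R]_0) : ~ rim x.
  move=> [_ /lo_eq_hi].
  have u0 : unit_param (fun=> 0 : R) by move=> i; rewrite lexx ler01.
  have ext0 e : ext e x = mom 0 (sim 0 e (fun=> 0)).
    by rewrite -ext_sim //; congr (ext e); exact: eq0.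
  rewrite !ext0.
  have -> : mom 0 (sim 0 true (fun=> 0 : R)) = 0.
    rewrite /mom -contract0; congr contract; apply: integral0_eq => t /=.
    by rewrite in_itv/= andbT => t0; rewrite (gt_eqF t0) mulr0.
  have -> : mom 0 (sim 0 false (fun=> 0 : R)) = 1.
    rewrite /mom (moment_trivial (p_gt _)) //=; first exact: profile_cst1.
    by move=> [t _]; rewrite /= ltxx.
  by move=> /eqP; rewrite eq_sym oner_eq0.
exists id, id; split=> //.
- by move=> x _; rewrite s0 ler01.
- by move=> x _; split=> [/nD//|]; rewrite s0 => /eqP; rewrite eq_sym oner_eq0.
- by move=> x _ _ u _; apply: nearW => k.
Qed.

(** One inclusion is part of the ball model; for the other, points just above or
below an extremal last coordinate are outside the body. *)
Lemma body_frontier n : frontier (@body n.+1) = @rim n.+1.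
Proof.
have [h [g BM]] := body_ball_model n.+1.
have [h' [g' BM']] := body_ball_model n.
have cl : closed (@body n.+1) by apply: seq_closed => u x; exact: (bm_closed BM).
rewrite /frontier -(closure_id _).1 //; apply/seteqP; split=> z /=.
  move=> [Xz nz]; apply: contrapT => nD.
  have [u [uz Xu]] := avoiding_sequence nz.
  have [N _ HN] := bm_interior BM Xz nD uz.
  by apply: (Xu N); apply: HN => /=.
move=> Dz; split; first by case: Dz.
move=> Iz; move: Dz; rewrite rim_rec => Dz.
have [u uz Xu] := fibration_boundary Dz.
rewrite body_rec in Iz.
have [N _ HN] := uz _ Iz.
by apply: (Xu N); apply: HN => /=.
Qed.

Lemma to_cube_Psi n f : to_cube (Psi p n f) = momvec n f.
Proof. by apply/rowP => i; rewrite !mxE. Qed.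

Lemma moment_normr i f : moment (p i) (fun t => f `|t|) = moment (p i) f.
Proof. by apply: moment_eq => t t0; rewrite gtr0_norm. Qed.

Lemma Psi_normr n f : Psi p n (fun t => f `|t|) = Psi p n f.
Proof. by apply/rowP => i; rewrite !mxE moment_normr. Qed.

Lemma to_cube_B n : @to_cube R n @` B_set p n = @body n.
Proof.
apply/seteqP; split=> x.
  move=> [_ [f ef <-] <-]; rewrite to_cube_Psi.
  by exists f => //; exact: even_log_concave_profile.
move=> [f pf <-]; exists (Psi p n f); last exact: to_cube_Psi.
exists (fun t => f `|t|); last exact: Psi_normr.
exact: profile_even_log_concave pf _.
Qed.

(** Interpolation of all [n] moments of a log-concave function. *)
Lemma simple_set_B n e : Psi p n @` @simple_set R n e = B_set p n.
Proof.
apply/seteqP; split=> x.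
  by move=> [f sf <-]; exists f => //; exact: is_sim_log_concave sf.
move=> [f ef <-].
have [th uth E] := interpolate n e (even_log_concave_profile ef).
exists (fun t => sim n e th `|t|); first by exists th.
by rewrite Psi_normr; apply: (can_inj (@to_cubeK R n)); rewrite !to_cube_Psi.
Qed.

Lemma front_Psi n f : front (Psi p n.+1 f) = Psi p n f.
Proof. by apply/rowP => i; rewrite !mxE. Qed.

(** The bounds on the last moment are attained by simple functions, and everything in
between is reached as well. *)
Lemma B_eq_C n : B_set p n.+1 = C_setS p n.
Proof.
apply/seteqP; split=> x.
  move=> [f ef <-]; rewrite /C_setS /= front_Psi mxE.
  split; first by exists f.
    exact/moment_ge0/even_log_concave_profile.
  apply/andP; split.
    by apply: ereal_inf_lbound; exists f.
  by apply: ereal_sup_ubound; exists f.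
move=> [[f ef Ef] _ /andP[lx xh]].
have pf := even_log_concave_profile ef.
have [th1 uth1 E1] := interpolate n false pf.
have [th2 uth2 E2] := interpolate n true pf.
set M1 := moment (p n) (sim n false th1).
set M2 := moment (p n) (sim n true th2).
have between f' : even_log_concave f' -> Psi p n f' = front x ->
    (M1 <= moment (p n) f' <= M2)%E \/ (M2 <= moment (p n) f' <= M1)%E.
  move=> ef' Ef'; have E : momvec n f' = momvec n f.
    by rewrite -!to_cube_Psi Ef' Ef.
  have /momvec_eqP E1' := etrans E1 (esym E).
  have /momvec_eqP E2' := etrans E2 (esym E).
  exact: (extremal_between (e := true) p_gt p_inj (l := [::]) isT
    (even_log_concave_profile ef') uth1 uth2 E1' E2').
have yb : (M1 <= x ord0 ord_max <= M2)%E \/ (M2 <= x ord0 ord_max <= M1)%E.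
  have [m12|/ltW m21] := leP M1 M2; [left|right]; apply/andP; split.
  - apply: le_trans lx; apply: le_ereal_inf_tmp => _ [f' [ef' Ef'] <-].
    by have [/andP[]//|/andP[h _]] := between f' ef' Ef'; exact: le_trans m12 h.
  - apply: le_trans xh _; apply: ge_ereal_sup => _ [f' [ef' Ef'] <-].
    by have [/andP[]//|/andP[_ h]] := between f' ef' Ef'; exact: le_trans h m12.
  - apply: le_trans lx; apply: le_ereal_inf_tmp => _ [f' [ef' Ef'] <-].
    by have [/andP[h _]|/andP[]//] := between f' ef' Ef'; exact: le_trans m21 h.
  - apply: le_trans xh _; apply: ge_ereal_sup => _ [f' [ef' Ef'] <-].
    by have [/andP[_ h]|/andP[]//] := between f' ef' Ef'; exact: le_trans h m21.
move/momvec_eqP : E1 => E1; move/momvec_eqP : E2 => E2.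
have [th uth [Eth Ey]] := intermediate_moment (e := true) (l := [::]) p_gt p_inj isT
    (fun l' g ul' pg => interpolation p_gt p_inj n _ ul' pg) uth1 uth2 E1 E2 yb.
exists (fun t => sim n.+1 true th `|t|).
  by apply: is_sim_log_concave; exists th.
rewrite Psi_normr; apply/rowP => i; rewrite mxE.
have [j ->|->] := unliftP ord_max i; last exact: Ey.
have /rowP/(_ j) := Ef; rewrite !mxE -widen_lift /= => <-.
exact: Eth.
Qed.

Lemma B_homeomorphic n : homeomorphic (B_set p n) (euclidean_ball R n).
Proof.
have [h [g BM]] := body_ball_model n.
have toX x : B_set p n x -> body (to_cube x).
  by move=> Bx; rewrite -to_cube_B; exists x.
have ofX x : body x -> B_set p n (from_cube x) /\ to_cube (from_cube x) = x.
  by rewrite -to_cube_B => -[y By <-]; rewrite to_cubeK.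
exists (h \o @to_cube R n), (@from_cube R n \o g); split.
- apply: seq_within => u x Bu Bx ux.
  apply: (bm_h BM) (cvg_to_cube ux); last exact: toX.
  by move=> k; exact: toX.
- apply: seq_within => u w Bu Bw uw.
  have cg := bm_g BM Bu Bw uw.
  move/cvg_rV : cg => cg; apply/cvg_rV => i; rewrite mxE.
  have le1 y : euclidean_ball R n y -> `|g y ord0 i| <= 1.
    by move=> /(bm_set BM)[[f pf <-] _]; rewrite mxE; exact: contract_le1.
  have := cvg_expand (fun k => le1 _ (Bu k)) (le1 _ Bw) (cg i).
  by apply: cvg_trans; apply: near_eq_cvg; apply: nearW => k /=; rewrite mxE.
- move=> x /toX Xx; have [h1 gh] := bm_ball BM Xx; split; first exact: h1.
  by rewrite /= gh to_cubeK.
- move=> w Bw; have [Xg hg] := bm_set BM Bw; have [Bg E] := ofX _ Xg.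
  by split=> //; rewrite /= E.
Qed.

Lemma simple_rim n : @to_cube R n.+1 @` (Psi p n.+1 @` simple_plus R n `|`
  Psi p n.+1 @` simple_minus R n) = @rim n.+1.
Proof.
rewrite -image_setU simple_unionE rim_rec; apply/seteqP; split=> z.
  move=> [_ [f sf <-] <-]; rewrite to_cube_Psi.
  have [e [th uth ->]] : exists e, exists2 th : nat -> R, unit_param th &
      f = fun t => sim n e th `|t|.
    by case: sf => /is_simE sf; [exists true|exists false].
  rewrite /= front_momvec last_momvec.
  have E i : momvec i (fun t => sim n e th `|t|) = momvec i (sim n e th).
    by apply: eq_momvec => t t0; rewrite gtr0_norm.
  split; first by rewrite E; exact: body_momvec (profile_sim _ _ uth).
  rewrite E /mom moment_normr -/(mom n (sim n e th)) -(ext_sim e _ uth).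
  by apply/lo_or_hi; exists e.
move=> /= [Xx /lo_or_hi[e eE]].
have [th uth E] := body_sim e Xx.
exists (Psi p n.+1 (sim n e th)); last first.
  rewrite to_cube_Psi -[LHS]snoc_front_last -[RHS]snoc_front_last.
  by rewrite front_momvec last_momvec eE E ext_sim.
exists (fun t => sim n e th `|t|); last exact: Psi_normr.
by case: e {eE E} => //; [left|right]; exists th.
Qed.

End MomentBodies.

Theorem theorem25 (R : realType) (p : nat -> R)
    (p_gt : forall i : nat, -1 < p i) (p_inj : injective p) (n : nat) :
  [/\ A_plus p n.+1 = A_minus p n.+1,
      A_minus p n.+1 = B_set p n.+1,
      B_set p n.+1 = C_setS p n,
      homeomorphic (B_set p n.+1) (euclidean_ball R n.+1) &
      is_boundary (B_set p n.+1)
        (Psi p n.+1 @` simple_plus R n `|` Psi p n.+1 @` simple_minus R n)].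
Proof.
have AB : A_minus p n.+1 = B_set p n.+1.
  by rewrite /A_minus simple_minusE // simple_set_B.
split=> //.
- by rewrite AB /A_plus simple_plusE // simple_set_B.
- exact: B_eq_C.
- exact: B_homeomorphic.
- by rewrite /is_boundary to_cube_B // body_frontier // simple_rim.
Qed.
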